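(* Let $0<k<1$ be the elliptic modulus, $K=K(k)=\int_0^1\frac{dt}{\sqrt{(1-t^2)(1-k^2t^2)}}$, $K'=K(\sqrt{1-k^2})$, $z=2K/\pi$, and $q=\exp(-\pi K'/K)$, so that $q=e^{2\pi i\tau}$ with $\tau=iK'/(2K)$. Let the polynomials $(\mathrm{ns}^2)_m(k^2)$ be defined by the Laurent expansion $\mathrm{ns}^2(u,k)=\frac{1}{u^2}+\sum_{m=1}^\infty(\mathrm{ns}^2)_m(k^2)\frac{u^{2m-2}}{(2m-2)!}$. Then for every integer $m\ge2$, $$E_{2m}(q^2)=\frac{(-1)^{m-1}m\,z^{2m}}{2^{2m-1}B_{2m}}\,(\mathrm{ns}^2)_m(k^2),$$ $$E_{2m}(q)=\frac{(-1)^{m-1}m\,z^{2m}(1+k)^{2m}}{2^{2m-1}B_{2m}}\,(\mathrm{ns}^2)_m\!\left(\frac{4k}{(1+k)^2}\right).$$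
   Context: $\mathrm{ns}(u,k)=1/\mathrm{sn}(u,k)$ where $\mathrm{sn}$ is the Jacobi elliptic function with modulus $k$; $(\mathrm{ns}^2)_m(k^2)$ is a polynomial in $k^2$. For $n\ge 2$ the Eisenstein series is $E_{2n}(q)=1-\frac{4n}{B_{2n}}\sum_{r=1}^\infty \frac{r^{2n-1}q^r}{1-q^r}$, where the Bernoulli numbers $B_n$ are defined by $\frac{t}{e^t-1}=\sum_{n\ge0}B_n\frac{t^n}{n!}$ for $|t|<2\pi$. *)

(* Defs.v *)
From mathcomp Require Import ssralg poly Rstruct.
From Stdlib Require Import Reals Factorial ClassicalEpsilon.
From Coquelicot Require Import Coquelicot.

Open Scope R_scope.

(** The integral is improper at [t = 1], hence the filter [at_left 1]. *)
Definition ellipticK (k : R) : R :=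
  RInt_gen (fun t => / sqrt ((1 - t ^ 2) * (1 - k ^ 2 * t ^ 2)))
    (at_point 0) (at_left 1).

Definition ellipticF (phi k : R) : R :=
  RInt (fun theta => / sqrt (1 - k ^ 2 * sin theta ^ 2)) 0 phi.

(** Jacobi's amplitude: for [0 < k < 1] the map [phi |-> ellipticF phi k] is an
    increasing bijection of [R], so exactly one [phi] satisfies the equation. *)
Definition jacobi_am (u k : R) : R := iota (fun phi : R => ellipticF phi k = u).

Definition jacobi_sn (u k : R) : R := sin (jacobi_am u k).

Definition jacobi_ns (u k : R) : R := / jacobi_sn u k.

(** [b n] is the [n]-th coefficient; [t = 0], where [t / (exp t - 1)] has a
    removable singularity, is left out. *)
Definition bernoulli_gen (b : nat -> R) : Prop :=
  forall t : R, 0 < Rabs t < 2 * PI ->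
    is_series (fun n => b n * (t ^ n / INR (fact n))) (t / (exp t - 1)).

(** [bernoulli_gen] has exactly one solution. *)
Definition bernoulli : nat -> R :=
  epsilon (inhabits (fun _ => 0)) bernoulli_gen.

(** [eisenstein n q] is the series of weight [2 * n], that is E_{2n}(q);
    [Series] starts at [0], so its index is [r - 1]. *)
Definition eisenstein (n : nat) (q : R) : R :=
  1 - 4 * INR n / bernoulli (2 * n) *
      Series (fun i => INR (S i) ^ (2 * n - 1) * q ^ (S i) / (1 - q ^ (S i))).

(** Evaluation of a polynomial, with the argument parsed in [R_scope] instead
    of MathComp's [ring_scope]. *)
Definition peval (p : {poly R}) (x : R) : R := horner p x.

(** Laurent expansion of ns^2 at its double pole [u = 0]. With [m = S j] the
    term (ns^2)_m(k^2) u^(2m-2) / (2m-2)! has exponent [2 * j]. *)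
Definition ns2_laurent (P : nat -> {poly R}) : Prop :=
  forall k : R, 0 < k < 1 ->
    locally' 0 (fun u : R =>
      is_series
        (fun j => peval (P (S j)) (k ^ 2) * (u ^ (2 * j) / INR (fact (2 * j))))
        (jacobi_ns u k ^ 2 - 1 / u ^ 2)).

(** [ns2_poly m] is the polynomial (ns^2)_m, for [m >= 1]; [ns2_laurent]
    determines these uniquely and does not involve the index [0]. *)
Definition ns2_poly : nat -> {poly R} :=
  epsilon (inhabits (fun _ => polyC 0)) ns2_laurent.

(* Main.v *)
(* Fix [y0 > 0], put [Q = exp (- 4 y0)] and let [W x = csc^2 x - 8 sum_n n Q^n / (1 - Q^n) cos 2nx];
   this is the Weierstrass function of the lattice generated by [PI] and [2 i y0], up to a constant.
   An identity of Ramanujan for the Lambert coefficients shows that W satisfies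
   [W'' = 6 W^2 - mu W - beta], and the same computation with cosh in place of cos shows that
   [V y = - W (i y)] satisfies the companion equation.  Uniqueness for these equations forces W to
   decrease on (0, PI/2) and V on (0, y0), so both can be inverted by elliptic integrals:
   [W = e3 + lam^2 ns^2 (lam x, k)] with [K = lam PI / 2] and [K' = lam y0], whence [Q = q^2].
   As [K'/K] is injective in [k], every modulus arises this way.  The Laurent coefficients of W at 0
   are a Bernoulli number, coming from csc^2, plus a Lambert series, which gives the first formula;
   the second one is the first at the modulus given by Landen's transformation. *)
From mathcomp Require Import ssralg poly Rstruct.
From Stdlib Require Import Reals Ranalysis5 Lra Lia Arith ClassicalEpsilon.
From Coquelicot Require Import Coquelicot.
Require Import Defs.

Open Scope R_scope.

(** * Series and power series *)

(** The argument stays on the real line. The lattice is seen only along its two axes, and W and V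
    are tied together by one power series in v, read at v = x^2 for W and at v = - y^2 for V. For
    this reason the cotangent, the cosine and W are all expanded in the square of the variable, and
    an identity proved for small v > 0 is carried to v < 0 before it says anything about V. The
    midpoints PI/2 and y0 are critical points, so W (PI/2) and - V y0 are two roots of the cubic in
    the first integral, and the third follows from the sum of the roots. [jacobi_am] is given by
    [iota], [bernoulli] and [ns2_poly] by [epsilon]: each is reached through an explicit candidate
    and a uniqueness argument. The candidate for [ns2_poly] must be one polynomial in k^2 for all k
    at once; this comes from the recursion that Jacobi's differential equation imposes on the
    Laurent coefficients of ns^2. For the second formula, the modulus 2 sqrt k / (1 + k) has half
    the ratio K'/K of k, so its q^2 is the q of k. *)

Ltac eq_R := match goal with |- ?a = ?b => change (@eq R a b) end.
Ltac ring_R := eq_R; ring.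

(** [auto_derive] leaves an eta-expanded [Derive] for a function known only through a hypothesis;
    this rewrites it to the known derivative. *)
Ltac derive_subst D := match type of D with is_derive ?f ?x ?l =>
  replace (Derive (fun y => f y) x) with l by (symmetry; exact (is_derive_unique _ _ _ D)) end.

Lemma ex_series_dom (a b : nat -> R) :
  (forall n, Rabs (a n) <= b n) -> ex_series b -> ex_series a.
Proof. intros H Hb. exact (ex_series_le a b H Hb). Qed.

Lemma ex_series_Rscal (c : R) (a : nat -> R) : ex_series a -> ex_series (fun n => c * a n).
Proof. exact (ex_series_scal_l c a). Qed.

Lemma Series_Rabs_le (a b : nat -> R) :
  (forall n, Rabs (a n) <= b n) -> ex_series b -> Rabs (Series a) <= Series b.
Proof.
  intros H Hb.
  assert (Ha : ex_series (fun n => Rabs (a n))).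
  { apply ex_series_dom with b; auto. intros n. now rewrite Rabs_Rabsolu. }
  apply Rle_trans with (1 := Series_Rabs a Ha).
  apply Series_le; auto. intros n; split; auto. apply Rabs_pos.
Qed.

Lemma Series_sum_f_R0 (f : nat -> nat -> R) (N : nat) :
  (forall m, ex_series (f m)) ->
  ex_series (fun n => sum_f_R0 (fun m => f m n) N) /\
  sum_f_R0 (fun m => Series (f m)) N = Series (fun n => sum_f_R0 (fun m => f m n) N).
Proof.
  intros H. induction N as [|N [IH1 IH2]]; simpl.
  - split; auto.
  - split.
    + exact (ex_series_plus _ _ IH1 (H (S N))).
    + rewrite IH2. symmetry. apply Series_plus; auto.
Qed.

Lemma is_lim_seq_Series_tail (a : nat -> R) :
  ex_series a -> is_lim_seq (fun N => Series (fun k => a (S N + k)%nat)) 0.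
Proof.
  intros Ha.
  apply is_lim_seq_ext with (fun N => Series a - sum_f_R0 a N).
  - intros N. rewrite (Series_incr_n a (S N)); auto; try lia. simpl pred.
    rewrite Rplus_comm. unfold Rminus. rewrite Rplus_assoc, Rplus_opp_r. ring.
  - replace (Finite 0) with (Finite (Series a - Series a)) by (f_equal; ring).
    apply is_lim_seq_minus'; [apply is_lim_seq_const|].
    apply is_lim_seq_ext with (sum_n a). { intros n; apply sum_n_Reals. }
    apply (Series_correct a Ha).
Qed.

Section Fubini.

Variables (f : nat -> nat -> R) (a b : nat -> R).
Hypothesis fab : forall m n, Rabs (f m n) <= a m * b n.
Hypothesis exa : ex_series a.
Hypothesis exb : ex_series b.

Lemma ex_series_dom_row m : ex_series (f m).
Proof.
  apply ex_series_dom with (fun n => a m * b n); auto.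
  exact (ex_series_scal_l (a m) b exb).
Qed.

Lemma ex_series_dom_col n : ex_series (fun m => f m n).
Proof.
  apply ex_series_dom with (fun m => b n * a m).
  - intros m; rewrite Rmult_comm; auto.
  - exact (ex_series_scal_l (b n) a exa).
Qed.

Lemma ex_series_Series_row : ex_series (fun m => Series (f m)).
Proof.
  apply ex_series_dom with (fun m => Series b * a m).
  - intros m. rewrite Rmult_comm, <- Series_scal_l.
    apply Series_Rabs_le; auto. exact (ex_series_scal_l (a m) b exb).
  - exact (ex_series_scal_l (Series b) a exa).
Qed.

(** After N rows, the difference from the sum by columns is a series of tails in [m]; domination by
    [a m * b n] bounds it by a tail of [a] times [Series b]. *)
Lemma Series_swap :
  Series (fun m => Series (f m)) = Series (fun n => Series (fun m => f m n)).
Proof.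
  apply is_series_unique.
  set (T := Series (fun n => Series (fun m => f m n))).
  assert (Hc : ex_series (fun n => Series (fun m => f m n))).
  { apply ex_series_dom with (fun n => Series a * b n).
    - intros n. rewrite <- Series_scal_r.
      apply Series_Rabs_le; auto. exact (ex_series_scal_r (b n) a exa).
    - exact (ex_series_scal_l (Series a) b exb). }
  assert (Hl : is_lim_seq (fun N => sum_f_R0 (fun m => Series (f m)) N) T).
  { apply is_lim_seq_spec. intros eps.
    assert (Ht := is_lim_seq_Series_tail a exa).
    apply (fun H => is_lim_seq_scal_r _ (Series b) _ H) in Ht.
    simpl in Ht. rewrite Rmult_0_l in Ht.
    apply is_lim_seq_spec in Ht. destruct (Ht eps) as [N0 HN0].
    exists N0. intros N HN. specialize (HN0 N HN).
    destruct (Series_sum_f_R0 f N ex_series_dom_row) as [H1 H2].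
    rewrite H2. unfold T. rewrite <- Series_minus; auto.
    rewrite Rminus_0_r in HN0.
    apply Rle_lt_trans with (2 := HN0).
    apply Rle_trans with (2 := Rle_abs _).
    rewrite <- Series_scal_l.
    apply Series_Rabs_le.
    2:{ exact (ex_series_scal_l _ b exb). }
    intros n.
    rewrite (Series_incr_n (fun m => f m n) (S N)); [|lia|apply ex_series_dom_col].
    simpl pred.
    rewrite Rabs_minus_sym.
    match goal with |- Rabs (?x + ?y - ?z) <= _ =>
      replace (x + y - z) with y by ring end.
    rewrite <- Series_scal_r.
    assert (E : ex_series (fun k => a (S N + k)%nat)) by (apply ex_series_incr_n; auto).
    apply Series_Rabs_le; [|exact (ex_series_scal_r (b n) _ E)].
    intros k; apply fab. }
  red. apply filterlim_ext with (2 := Hl).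
  intros N; symmetry; apply sum_n_Reals.
Qed.

End Fubini.

(** Half of the exponential absorbs one factor: n exp (- a n / 2) is at most 2 / a, so the power
    drops by one and [a] is halved. *)
Lemma ex_series_poly_exp (p : nat) (a : R) :
  0 < a -> ex_series (fun n => INR n ^ p * exp (- a * INR n)).
Proof.
  revert a. induction p as [|p IH]; intros a Ha.
  - apply ex_series_ext with (fun n => exp (- a) ^ n).
    { intros n. simpl. rewrite Rmult_1_l. rewrite <- Rpower_pow by apply exp_pos.
      unfold Rpower. rewrite ln_exp. f_equal; ring. }
    apply ex_series_geom. rewrite Rabs_pos_eq; [|apply Rlt_le, exp_pos].
    rewrite <- exp_0. apply exp_increasing. lra.
  - apply ex_series_dom with (fun n => (2 / a) * (INR n ^ p * exp (- (a / 2) * INR n))).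
    + intros n. rewrite Rabs_pos_eq.
      2:{ apply Rmult_le_pos; [apply pow_le, pos_INR|apply Rlt_le, exp_pos]. }
      replace (exp (- a * INR n)) with (exp (- (a/2) * INR n) * exp (- (a/2) * INR n))
        by (rewrite <- exp_plus; f_equal; field).
      simpl pow.
      replace (INR n * INR n ^ p * (exp (- (a / 2) * INR n) * exp (- (a / 2) * INR n)))
        with (INR n * exp (- (a / 2) * INR n) * (INR n ^ p * exp (- (a / 2) * INR n))) by ring.
      apply Rmult_le_compat_r.
      { apply Rmult_le_pos; [apply pow_le, pos_INR|apply Rlt_le, exp_pos]. }
      assert (H := exp_ineq1_le (a / 2 * INR n)).
      replace (- (a / 2) * INR n) with (- (a / 2 * INR n)) by ring.
      rewrite exp_Ropp. assert (P := exp_pos (a / 2 * INR n)).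
      apply (Rmult_le_reg_r (exp (a / 2 * INR n))); auto.
      replace (INR n * / exp (a / 2 * INR n) * exp (a / 2 * INR n)) with (INR n) by (field; lra).
      apply Rmult_le_reg_l with (a / 2); [lra|].
      replace (a / 2 * (2 / a * exp (a / 2 * INR n))) with (exp (a / 2 * INR n)) by (field; lra).
      lra.
    + exact (ex_series_scal_l (2 / a) _ (IH (a / 2) ltac:(lra))).
Qed.

Lemma ex_series_poly_geom (p : nat) (r : R) :
  0 < r < 1 -> ex_series (fun n => INR n ^ p * r ^ n).
Proof.
  intros [H0 H1].
  apply ex_series_ext with (fun n => INR n ^ p * exp (- (- ln r) * INR n)).
  - intros n. rewrite <- (Rpower_pow n r) by lra. unfold Rpower. do 2 f_equal. ring.
  - apply ex_series_poly_exp.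
    assert (H := ln_increasing r 1 H0 H1). rewrite ln_1 in H. lra.
Qed.

(** A uniform bound on the second derivatives makes the error of linearization of each term at most
    h^2 [M n], by the mean value theorem applied twice; these errors sum to a multiple of h^2. *)
Lemma is_derive_Series (u u1 u2 : nat -> R -> R) (M : nat -> R) (x d : R) :
  0 < d ->
  (forall n t, Rabs (t - x) < d -> is_derive (u n) t (u1 n t)) ->
  (forall n t, Rabs (t - x) < d -> is_derive (u1 n) t (u2 n t)) ->
  (forall n t, Rabs (t - x) < d -> Rabs (u2 n t) <= M n) ->
  ex_series M ->
  (forall t, Rabs (t - x) < d -> ex_series (fun n => u n t)) ->
  ex_series (fun n => u1 n x) ->
  is_derive (fun t => Series (fun n => u n t)) x (Series (fun n => u1 n x)).
Proof.
  intros Hd D1 D2 HM exM exu exu1.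
  assert (Key : forall n h, Rabs h < d ->
    Rabs (u n (x + h) - u n x - h * u1 n x) <= h ^ 2 * M n).
  { intros n h Hh.
    assert (In : forall c, Rmin x (x + h) <= c <= Rmax x (x + h) -> Rabs (c - x) <= Rabs h).
    { intros c. unfold Rmin, Rmax, Rabs. repeat destruct Rle_dec; repeat destruct Rcase_abs; lra. }
    destruct (MVT_gen (u n) x (x + h) (u1 n)) as [c [Hc E]].
    { intros t Ht. apply D1. apply Rle_lt_trans with (2 := Hh). apply In; lra. }
    { intros t Ht. apply derivable_continuous_pt. exists (u1 n t).
      apply is_derive_Reals, D1. apply Rle_lt_trans with (2 := Hh). apply In; lra. }
    rewrite E.
    assert (Hc' := In c Hc).
    destruct (MVT_gen (u1 n) x c (u2 n)) as [c' [Hc2 E']].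
    { intros t Ht. apply D2. apply Rle_lt_trans with (2 := Hh).
      apply Rle_trans with (2 := Hc'). revert Ht.
      unfold Rmin, Rmax, Rabs. repeat destruct Rle_dec; repeat destruct Rcase_abs; lra. }
    { intros t Ht. apply derivable_continuous_pt. exists (u2 n t).
      apply is_derive_Reals, D2. apply Rle_lt_trans with (2 := Hh).
      apply Rle_trans with (2 := Hc'). revert Ht.
      unfold Rmin, Rmax, Rabs. repeat destruct Rle_dec; repeat destruct Rcase_abs; lra. }
    replace (u1 n c * (x + h - x) - h * u1 n x) with (h * (u1 n c - u1 n x)) by ring.
    rewrite E'. rewrite !Rabs_mult.
    assert (Hc'' : Rabs (c' - x) < d).
    { apply Rle_lt_trans with (2 := Hh). apply Rle_trans with (2 := Hc'). revert Hc2.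
      unfold Rmin, Rmax, Rabs. repeat destruct Rle_dec; repeat destruct Rcase_abs; lra. }
    assert (B := HM n c' Hc'').
    rewrite <- (pow2_abs h). simpl. rewrite Rmult_1_r, Rmult_assoc.
    apply Rmult_le_compat_l; [apply Rabs_pos|]. rewrite Rmult_comm.
    apply Rmult_le_compat; auto using Rabs_pos. }
  apply is_derive_Reals. intros eps Heps.
  set (B := Series M).
  assert (HB : 0 <= B).
  { apply Rle_trans with (1 := Rabs_pos (Series (fun n => u2 n x))).
    apply Series_Rabs_le; auto. intros n. apply HM. rewrite Rminus_diag, Rabs_R0. auto. }
  assert (Hdel : 0 < Rmin d (eps / (B + 1))).
  { apply Rmin_pos; auto. apply Rdiv_lt_0_compat; lra. }
  exists (mkposreal _ Hdel). intros h Hh0 Hh. simpl in Hh.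
  assert (Hhd : Rabs h < d) by (apply Rlt_le_trans with (1 := Hh), Rmin_l).
  assert (Hhe : Rabs h < eps / (B + 1)) by (apply Rlt_le_trans with (1 := Hh), Rmin_r).
  assert (E1 : ex_series (fun n => u n (x + h))).
  { apply exu. replace (x + h - x) with h by ring. auto. }
  assert (E0 : ex_series (fun n => u n x)).
  { apply exu. rewrite Rminus_diag, Rabs_R0. auto. }
  assert (E2 := ex_series_minus _ _ E1 E0).
  assert (E3 : ex_series (fun n => h * u1 n x)) by exact (ex_series_scal_l h _ exu1).
  assert (G : Rabs (Series (fun n => u n (x + h)) - Series (fun n => u n x)
     - h * Series (fun n => u1 n x)) <= h ^ 2 * B).
  { rewrite <- Series_minus, <- Series_scal_l by auto.
    rewrite <- Series_minus by auto. unfold B.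
    rewrite <- (Series_scal_l (h ^ 2)).
    apply Series_Rabs_le; [|exact (ex_series_scal_l _ _ exM)].
    intros n. apply Key; auto. }
  match goal with |- Rabs ?X < _ => replace X with
    ((Series (fun n => u n (x + h)) - Series (fun n => u n x)
     - h * Series (fun n => u1 n x)) * / h) by (field; auto) end.
  rewrite Rabs_mult, Rabs_inv.
  assert (Ph : 0 < Rabs h) by (apply Rabs_pos_lt; auto).
  apply Rmult_lt_reg_r with (Rabs h); auto.
  rewrite Rmult_assoc, Rinv_l, Rmult_1_r by lra.
  apply Rle_lt_trans with (1 := G).
  rewrite <- (pow2_abs h). simpl. rewrite Rmult_1_r, Rmult_assoc, (Rmult_comm eps).
  apply Rmult_lt_compat_l; auto.
  apply Rle_lt_trans with (Rabs h * (B + 1)). { apply Rmult_le_compat_l; lra. }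
  apply Rlt_le_trans with (eps / (B + 1) * (B + 1)).
  - apply Rmult_lt_compat_r; lra.
  - right; field; lra.
Qed.

Lemma CV_radius_ge (a : nat -> R) (d : R) :
  ex_series (fun n => a n * d ^ n) -> Rbar_le (Rabs d) (CV_radius a).
Proof.
  intros E. destruct (Rbar_le_lt_dec (Rabs d) (CV_radius a)) as [h|h]; auto.
  destruct (CV_disk_outside a d h). apply ex_series_lim_0. auto.
Qed.

Lemma is_pseries_zero_right_0 (a : nat -> R) (d : R) :
  0 < d -> (forall v, 0 < v < d -> is_pseries a v 0) -> a 0%nat = 0.
Proof.
  intros Hd H.
  assert (Hr : Rbar_lt 0 (CV_radius a)).
  { apply Rbar_lt_le_trans with (Rabs (d / 2)). simpl; apply Rabs_pos_lt; lra.
    apply CV_radius_ge. exists 0. apply is_pseries_R, H. lra. }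
  assert (C : continuity_pt (PSeries a) 0).
  { apply PSeries_continuity. rewrite Rabs_R0. auto. }
  rewrite <- (PSeries_0 a).
  destruct (Req_dec (PSeries a 0) 0) as [e|ne]; auto. exfalso.
  destruct (C (Rabs (PSeries a 0))) as [e [He Hc]]; [apply Rabs_pos_lt; auto|].
  set (v := Rmin (d / 2) (e / 2)).
  assert (Hv : 0 < v) by (apply Rmin_pos; lra).
  assert (Hv1 : v <= d / 2) by apply Rmin_l.
  assert (Hv2 : v <= e / 2) by apply Rmin_r.
  specialize (Hc v). simpl in Hc. unfold Rdist in Hc.
  assert (X : Rabs (PSeries a v - PSeries a 0) < Rabs (PSeries a 0)).
  { apply Hc. split; [split; [exact I|lra]|]. rewrite Rminus_0_r, Rabs_pos_eq; lra. }
  rewrite (is_pseries_unique a v 0) in X by (apply H; lra).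
  rewrite Rminus_0_l, Rabs_Ropp in X. lra.
Qed.

(** Only arguments to the right of 0 are available below, because the variable is a square.
    Continuity at 0 kills the constant term, and dividing by [v] shifts the series. *)
Lemma is_pseries_zero_right (a : nat -> R) (d : R) :
  0 < d -> (forall v, 0 < v < d -> is_pseries a v 0) -> forall n, a n = 0.
Proof.
  intros Hd H n. revert a H. induction n as [|n IH]; intros a H.
  - now apply is_pseries_zero_right_0 with d.
  - assert (a0 := is_pseries_zero_right_0 a d Hd H).
    apply (IH (PS_decr_1 a)). intros v Hv.
    assert (E : is_pseries (PS_decr_1 a) v (scal (/ v) (plus 0 (opp (a 0%nat))))).
    { apply (is_pseries_decr_1 a v (/ v) 0); [change (/ v * v = 1); field; lra|auto]. }
    change (is_pseries (PS_decr_1 a) v (/ v * (0 + - a 0%nat))) in E.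
    rewrite a0 in E. replace (/ v * (0 + - 0)) with 0 in E by ring. exact E.
Qed.

Lemma is_pseries_unique_right (a b : nat -> R) (f : R -> R) (d : R) :
  0 < d -> (forall v, 0 < v < d -> is_pseries a v (f v)) ->
  (forall v, 0 < v < d -> is_pseries b v (f v)) -> forall n, a n = b n.
Proof.
  intros Hd Ha Hb n. apply Rminus_diag_uniq.
  apply (is_pseries_zero_right (PS_minus a b) d Hd). intros v Hv.
  assert (E := is_pseries_minus a b v _ _ (Ha v Hv) (Hb v Hv)).
  change (is_pseries (PS_minus a b) v (f v + - f v)) in E.
  rewrite Rplus_opp_r in E. exact E.
Qed.

Lemma ex_series_Series_col (f : nat -> nat -> R) (a b : nat -> R) :
  (forall m n, Rabs (f m n) <= a m * b n) -> ex_series a -> ex_series b ->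
  ex_series (fun n => Series (fun m => f m n)).
Proof.
  intros H Ha Hb. apply (ex_series_Series_row (fun n m => f m n) b a); auto.
  intros m n; rewrite Rmult_comm; auto.
Qed.

Lemma is_series_finite (a : nat -> R) (N : nat) :
  (forall n, (N < n)%nat -> a n = 0) -> is_series a (sum_f_R0 a N).
Proof.
  intros H. apply (is_series_decr_n a (S N)); [lia|].
  replace (plus _ _) with (0 : R).
  2:{ rewrite sum_n_Reals. simpl pred. change (0 = sum_f_R0 a N + - sum_f_R0 a N). ring. }
  apply is_series_ext with (fun k => 0 * 0 ^ k).
  - intros k. rewrite H by lia. apply Rmult_0_l.
  - assert (E := is_series_scal_l 0 _ _ (is_series_geom 0 ltac:(rewrite Rabs_R0; lra))).
    change (is_series (fun n => 0 * 0 ^ n) (0 * / (1 - 0))) in E.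
    rewrite Rmult_0_l in E. exact E.
Qed.

Lemma Series_finite (a : nat -> R) (N : nat) :
  (forall n, (N < n)%nat -> a n = 0) -> Series a = sum_f_R0 a N.
Proof. intros H. now apply is_series_unique, is_series_finite. Qed.

Lemma sum_f_R0_rev (g : nat -> R) (n : nat) :
  sum_f_R0 (fun k => g (n - k)%nat) n = sum_f_R0 g n.
Proof.
  induction n as [|n IH]; [reflexivity|].
  rewrite decomp_sum by lia. simpl pred.
  replace (sum_f_R0 (fun i => g (S n - S i)%nat) n) with (sum_f_R0 g n) by (rewrite <- IH; reflexivity).
  simpl. ring.
Qed.

Lemma term_le_Series (a : nat -> R) (n : nat) :
  (forall k, 0 <= a k) -> ex_series a -> a n <= Series a.
Proof.
  intros P E. rewrite (Series_incr_n _ (S n)); auto; [|lia]. simpl pred.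
  apply Rle_trans with (sum_f_R0 a n).
  - destruct n; [apply Rle_refl|]. rewrite tech5.
    rewrite <- (Rplus_0_l (a (S n))) at 1. apply Rplus_le_compat_r, cond_pos_sum, P.
  - rewrite <- (Rplus_0_r (sum_f_R0 _ _)) at 1. apply Rplus_le_compat_l.
    rewrite <- (Rmult_0_l (Series (fun k => a (S n + k)%nat))), <- Series_scal_l.
    apply Series_le.
    + intros k; split; rewrite Rmult_0_l; [apply Rle_refl|apply P].
    + apply (ex_series_incr_n a (S n)). auto.
Qed.

(** The constant is the full sum of n^p (q/r)^n, which dominates each of its terms. *)
Lemma poly_geom_bound (p : nat) (q r : R) :
  0 < q < r -> exists C, forall n, INR n ^ p * q ^ n <= C * r ^ n.
Proof.
  intros [Hq Hr].
  assert (Hqr : 0 < q / r < 1).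
  { split; [apply Rdiv_lt_0_compat; lra|].
    apply Rmult_lt_reg_r with r; [lra|]. field_simplify; lra. }
  assert (E := ex_series_poly_geom p (q / r) Hqr).
  exists (Series (fun n => INR n ^ p * (q / r) ^ n)). intros n.
  assert (P : forall k, 0 <= INR k ^ p * (q / r) ^ k).
  { intros k. apply Rmult_le_pos; apply pow_le; [apply pos_INR|lra]. }
  assert (L := term_le_Series (fun n => INR n ^ p * (q / r) ^ n) n P E). cbv beta in L.
  replace (q ^ n) with ((q / r) ^ n * r ^ n).
  2:{ rewrite <- Rpow_mult_distr. f_equal. field; lra. }
  rewrite <- Rmult_assoc. apply Rmult_le_compat_r; [apply pow_le; lra|auto].
Qed.

(** * Lambert coefficients *)

(** At [n = 0] the denominator vanishes, but the factor [INR n] makes the value 0; series over all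
    of [nat] are therefore the intended ones over n >= 1. *)
Definition lambert (Q : R) (n : nat) : R := INR n * (Q ^ n / (1 - Q ^ n)).

Lemma pow_lt_1_S (Q : R) (n : nat) : 0 < Q < 1 -> (1 <= n)%nat -> 0 < Q ^ n <= Q.
Proof.
  intros HQ Hn. split; [apply pow_lt; lra|].
  destruct n; [lia|]. simpl. apply Rle_trans with (Q * 1); [|lra].
  apply Rmult_le_compat_l; [lra|]. rewrite <- (pow1 n). apply pow_incr; lra.
Qed.

Lemma lambert_0 (Q : R) : lambert Q 0 = 0.
Proof. unfold lambert. simpl INR. ring. Qed.

Lemma lambert_bound (Q : R) (n : nat) :
  0 < Q < 1 -> 0 <= lambert Q n <= / (1 - Q) * (INR n * Q ^ n).
Proof.
  intros HQ. destruct (Nat.eq_dec n 0) as [->|Hn].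
  - rewrite lambert_0. simpl. lra.
  - assert (H := pow_lt_1_S Q n HQ ltac:(lia)). unfold lambert.
    assert (P : 0 <= INR n) by apply pos_INR.
    assert (I : 0 < / (1 - Q ^ n) <= / (1 - Q)).
    { split; [apply Rinv_0_lt_compat; lra|apply Rinv_le_contravar; lra]. }
    unfold Rdiv. split.
    + repeat apply Rmult_le_pos; lra.
    + rewrite (Rmult_comm (Q ^ n)), <- Rmult_assoc, (Rmult_comm (INR n)), Rmult_assoc.
      apply Rmult_le_compat_r; [|lra]. apply Rmult_le_pos; lra.
Qed.

Lemma lambert_geom_bound (Q r : R) (p : nat) :
  0 < Q < r -> r < 1 -> exists C, 0 <= C /\ forall n, INR n ^ p * lambert Q n <= C * r ^ n.
Proof.
  intros HQ Hr. destruct (poly_geom_bound (S p) Q r HQ) as [C HC].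
  assert (B : forall n, INR n ^ p * lambert Q n <= / (1 - Q) * C * r ^ n).
  { intros n. assert (H := lambert_bound Q n ltac:(lra)).
    apply Rle_trans with (/ (1 - Q) * (INR n ^ S p * Q ^ n)).
    - simpl. replace (/ (1 - Q) * (INR n * INR n ^ p * Q ^ n))
        with (INR n ^ p * (/ (1 - Q) * (INR n * Q ^ n))) by ring.
      apply Rmult_le_compat_l; [apply pow_le, pos_INR|apply H].
    - rewrite Rmult_assoc. apply Rmult_le_compat_l; [|apply HC].
      apply Rlt_le, Rinv_0_lt_compat; lra. }
  exists (/ (1 - Q) * C). split; auto.
  specialize (B 1%nat). assert (H := lambert_bound Q 1 ltac:(lra)).
  simpl in B. rewrite pow1 in B.
  apply Rmult_le_reg_r with r; lra.
Qed.

Lemma ex_series_lambert (Q : R) (p : nat) :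
  0 < Q < 1 -> ex_series (fun n => INR n ^ p * lambert Q n).
Proof.
  intros HQ. destruct (lambert_geom_bound Q ((Q + 1) / 2) p) as [C [_ HC]]; try lra.
  apply ex_series_dom with (fun n => C * ((Q + 1) / 2) ^ n).
  - intros n. rewrite Rabs_pos_eq; auto.
    apply Rmult_le_pos; [apply pow_le, pos_INR|apply lambert_bound; auto].
  - apply (ex_series_scal_l C (fun n => ((Q + 1) / 2) ^ n)).
    apply ex_series_geom. rewrite Rabs_pos_eq; lra.
Qed.

Lemma ex_series_lambert_0 (Q : R) : 0 < Q < 1 -> ex_series (lambert Q).
Proof.
  intros HQ. refine (ex_series_ext _ _ _ (ex_series_lambert Q 0 HQ)). intros n; simpl; ring_R.
Qed.

(** Addition formula of coth in disguise: Q^n / (1 - Q^n) is (coth a - 1) / 2 with exp (- 2 a) =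
    Q^n. *)
Lemma lambert_product (Q : R) (m j : nat) :
  0 < Q < 1 -> (1 <= m)%nat -> (1 <= j)%nat ->
  Q ^ m / (1 - Q ^ m) * (Q ^ j / (1 - Q ^ j)) =
  Q ^ (m + j) / (1 - Q ^ (m + j)) * (1 + Q ^ m / (1 - Q ^ m) + Q ^ j / (1 - Q ^ j)).
Proof.
  intros HQ Hm Hj.
  assert (H1 := pow_lt_1_S Q m HQ Hm). assert (H2 := pow_lt_1_S Q j HQ Hj).
  assert (H3 := pow_lt_1_S Q (m + j) HQ ltac:(lia)).
  rewrite pow_add in *. field. repeat split; lra.
Qed.

Lemma sum_mult_rev (j n : nat) :
  sum_f_R0 (fun m => INR m * (INR j - INR m)) n =
  INR n * (INR n + 1) * (3 * INR j - 2 * INR n - 1) / 6.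
Proof.
  induction n as [|n IH].
  { unfold sum_f_R0. change (INR 0) with 0. field. }
  rewrite tech5, IH, !S_INR. field.
Qed.

(* Ramanujan's convolution identity: both infinite sums are brought to the form
   [f j * _] by [lambert_product], after which they telescope. *)
Lemma lambert_convolution (Q : R) (j : nat) :
  0 < Q < 1 -> (1 <= j)%nat ->
  Series (fun r => INR r * lambert Q (j + r)) + Series (fun m => lambert Q m * lambert Q (m + j))
  + sum_f_R0 (fun m => lambert Q m * lambert Q (j - m)) j / 2 =
  lambert Q j * (2 * Series (lambert Q) + (INR j ^ 2 - 1) / 12).
Proof.
  intros HQ Hj.
  assert (E1 := ex_series_lambert Q 1 HQ).
  assert (E0' := ex_series_lambert_0 Q HQ).
  set (f := fun n => Q ^ n / (1 - Q ^ n)).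
  assert (Ef : forall n, lambert Q n = INR n * f n) by reflexivity.
  (* [h] vanishes at 0 and at [j]. The two infinite sums together become a multiple of the sum of
     [h m - h (j + m)], which leaves finitely many values of [h]. *)
  set (h := fun n => INR n * (INR n - INR j) * f n).
  assert (Eh : ex_series h).
  { apply ex_series_ext with (fun n => INR n ^ 1 * lambert Q n - INR j * lambert Q n).
    - intros n. unfold h. rewrite Ef. ring_R.
    - refine (ex_series_minus _ _ E1 _). exact (ex_series_scal_l (INR j) _ E0'). }
  assert (Ehj : ex_series (fun m => h (j + m)%nat)) by (apply ex_series_incr_n; auto).
  assert (ER : ex_series (fun r => INR r * lambert Q (j + r))).
  { apply ex_series_ext with (2 := Ehj). intros n. unfold h. rewrite Ef, plus_INR. ring_R. }
  assert (ED : ex_series (fun m => lambert Q m * lambert Q (m + j))).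
  { assert (Ej : ex_series (fun m => lambert Q (m + j))).
    { apply ex_series_ext with (fun m => lambert Q (j + m)); [intros n; f_equal; lia|].
      apply ex_series_incr_n; auto. }
    destruct (lambert_geom_bound Q ((Q + 1) / 2) 0) as [C [HC0 HC]]; try lra.
    apply ex_series_dom with (fun m => C * lambert Q (m + j)).
    - intros m. assert (B1 := lambert_bound Q m HQ). assert (B2 := lambert_bound Q (m + j) HQ).
      rewrite Rabs_pos_eq by (apply Rmult_le_pos; [apply B1|apply B2]).
      apply Rmult_le_compat_r; [apply B2|].
      specialize (HC m). simpl in HC. rewrite Rmult_1_l in HC.
      apply Rle_trans with (1 := HC). rewrite <- (Rmult_1_r C) at 2.
      apply Rmult_le_compat_l; auto. apply Rle_trans with (1 ^ m); [apply pow_incr; lra|rewrite pow1; lra].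
    - exact (ex_series_scal_l C _ Ej). }
  assert (H1 : Series (fun r => INR r * lambert Q (j + r))
      + Series (fun m => lambert Q m * lambert Q (m + j))
      = f j * (2 * INR j * Series (lambert Q) + sum_f_R0 h (pred j))).
  { rewrite <- Series_plus by auto.
    rewrite (Series_ext _ (fun m => f j * ((h m + 2 * INR j * lambert Q m) - h (j + m)%nat))).
    - rewrite Series_scal_l, Series_minus, Series_plus, Series_scal_l; auto.
      + rewrite (Series_incr_n h j) by (auto; lia). ring.
      + exact (ex_series_scal_l _ _ E0').
      + refine (ex_series_plus _ _ Eh _). exact (ex_series_scal_l _ _ E0').
    - intros m. rewrite (Nat.add_comm m j). unfold h. rewrite !Ef, !plus_INR.
      destruct (Nat.eq_dec m 0) as [->|Hm].
      + simpl INR. ring.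
      + assert (P := lambert_product Q m j HQ ltac:(lia) Hj). rewrite (Nat.add_comm m j) in P.
        fold (f m) (f j) (f (j + m)%nat) in P.
        transitivity (INR m * (INR m + INR j) * (f (j + m)%nat + f m * f (j + m)%nat)).
        { ring. }
        transitivity (INR m * (INR m + INR j) * (f m * f j - f (j + m)%nat * f j)).
        { rewrite P. ring. }
        ring. }
  (* Here the indices [m] and [j - m] add up to [j], so [lambert_product] makes [f j] a common
     factor. The end terms, where one index is 0, are checked separately. *)
  assert (H2 : sum_f_R0 (fun m => lambert Q m * lambert Q (j - m)) j =
     f j * (INR j * (INR j ^ 2 - 1) / 6 - 2 * sum_f_R0 h j)).
  { rewrite (sum_eq _ (fun m => INR m * (INR j - INR m) * f j - h m * f j - h (j - m)%nat * f j)).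
    - rewrite !minus_sum, (sum_f_R0_rev (fun i => h i * f j) j), <- !scal_sum, sum_mult_rev.
      field.
    - intros m Hm. unfold h. rewrite !Ef, minus_INR by lia.
      destruct (Nat.eq_dec m 0) as [->|Hm0]. { simpl INR. ring. }
      destruct (Nat.eq_dec m j) as [->|Hmj]. { ring. }
      assert (P := lambert_product Q m (j - m) HQ ltac:(lia) ltac:(lia)).
      replace (m + (j - m))%nat with j in P by lia.
      fold (f m) (f j) (f (j - m)%nat) in P.
      transitivity (INR m * (INR j - INR m) * (f m * f (j - m)%nat)); [ring|].
      rewrite P. ring. }
  assert (H3 : sum_f_R0 h j = sum_f_R0 h (pred j)).
  { destruct j; [lia|]. simpl. unfold h at 2. ring. }
  rewrite H1, H2, H3, Ef. field.
Qed.

(** * A quadratic identity for trigonometric Lambert series *)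

Lemma ex_series_scal_geom (C s : R) : 0 <= s < 1 -> ex_series (fun n => C * s ^ n).
Proof.
  intros Hs. apply (ex_series_scal_l C (fun n => s ^ n)), ex_series_geom.
  rewrite Rabs_pos_eq; lra.
Qed.

Lemma pow_decr (s : R) (m n : nat) : 0 <= s <= 1 -> (m <= n)%nat -> s ^ n <= s ^ m.
Proof.
  intros Hs Hmn. replace n with (m + (n - m))%nat by lia. rewrite pow_add.
  rewrite <- (Rmult_1_r (s ^ m)) at 2. apply Rmult_le_compat_l; [apply pow_le; lra|].
  apply Rle_trans with (1 ^ (n - m)); [apply pow_incr; lra|rewrite pow1; lra].
Qed.

Lemma Series_shift (a : nat -> R) (m : nat) :
  (forall j, (j < m)%nat -> a j = 0) -> Series a = Series (fun n => a (m + n)%nat).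
Proof. intros H. apply Series_incr_n_aux. auto. Qed.

Definition absdiff (m n : nat) : nat := ((m - n) + (n - m))%nat.

Section TrigSquare.

(** [c n] stands for cos (2 n x), with [E = 1], or for cosh (2 n x), with [E = exp (2 x)]. Both
    satisfy the same product formula, and [Q * E < 1] makes the series with coefficients
    [lambert Q n] converge. *)
Variables (Q E : R) (c : nat -> R).
Hypothesis HQ : 0 < Q < 1.
Hypothesis HE : 1 <= E.
Hypothesis HQE : Q * E < 1.
Hypothesis c_bound : forall n, Rabs (c n) <= E ^ n.
Hypothesis c_0 : c 0%nat = 1.
Hypothesis c_mult : forall m n, 2 * c m * c n = c (m + n)%nat + c (absdiff m n).

Notation b := (lambert Q).

(** [r] lies between [Q] and [/ E], and [s] is the square root of [r * E]. A factor (r E)^n thus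
    splits into s^n s^n, one half for each index of a double series, as [Series_swap] requires. *)
Lemma lambert_double_geom_bound : exists C r s,
  0 <= C /\ 0 < r < 1 /\ 0 < s < 1 /\ r <= s * s /\ r * E <= s * s /\
  forall n, b n <= C * r ^ n /\ INR n * b n <= C * r ^ n /\ INR n ^ 2 * b n <= C * r ^ n.
Proof.
  assert (HE' : 0 < / E <= 1).
  { split; [apply Rinv_0_lt_compat; lra|]. rewrite <- Rinv_1. apply Rinv_le_contravar; lra. }
  assert (Hr : Q < (Q + / E) / 2 < / E).
  { assert (Q < / E). { apply Rmult_lt_reg_r with E; [lra|]. rewrite Rinv_l; lra. } lra. }
  set (r := (Q + / E) / 2) in *.
  assert (Hs : 0 < r * E < 1).
  { split; [apply Rmult_lt_0_compat; lra|].
    apply Rmult_lt_reg_r with (/ E); [lra|]. field_simplify; lra. }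
  destruct (lambert_geom_bound Q r 0) as [C0 [P0 H0]]; try lra.
  destruct (lambert_geom_bound Q r 1) as [C1 [P1 H1]]; try lra.
  destruct (lambert_geom_bound Q r 2) as [C2 [P2 H2]]; try lra.
  exists (C0 + C1 + C2), r, (sqrt (r * E)).
  assert (Hsq : sqrt (r * E) * sqrt (r * E) = r * E) by (apply sqrt_sqrt; lra).
  rewrite Hsq. repeat split; try lra.
  - apply sqrt_lt_R0; lra.
  - rewrite <- sqrt_1. apply sqrt_lt_1; lra.
  - rewrite <- (Rmult_1_r r) at 1. apply Rmult_le_compat_l; lra.
  - specialize (H0 n). simpl in H0. assert (P := pow_le r n ltac:(lra)). nra.
  - specialize (H1 n). rewrite pow_1 in H1. assert (P := pow_le r n ltac:(lra)). nra.
  - specialize (H2 n). assert (P := pow_le r n ltac:(lra)). nra.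
Qed.

Lemma ex_series_lambert_trig (p : nat) : (p <= 2)%nat ->
  ex_series (fun n => INR n ^ p * b n * c n).
Proof.
  intros Hp. destruct lambert_double_geom_bound as (C & r & s & HC & Hr & Hs & Hrs & HrE & B).
  apply ex_series_dom with (fun n => C * (s * s) ^ n).
  - intros n. rewrite Rabs_mult, Rabs_pos_eq.
    + apply Rle_trans with (C * r ^ n * E ^ n).
      * apply Rmult_le_compat; auto using Rabs_pos.
        -- apply Rmult_le_pos; [apply pow_le, pos_INR|apply lambert_bound; auto].
        -- destruct (B n) as (B0 & B1 & B2).
           destruct p as [|[|[|]]]; simpl in *; try lra; lia.
      * rewrite Rmult_assoc, <- Rpow_mult_distr. apply Rmult_le_compat_l; auto.
        apply pow_incr. split; [apply Rmult_le_pos; lra|auto].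
    + apply Rmult_le_pos; [apply pow_le, pos_INR|apply lambert_bound; auto].
  - apply ex_series_scal_geom. split; nra.
Qed.

(** The three sums of [lambert_convolution], as coefficients of [c j]. In the square of the series,
    pairs with sum [j] give [conv_coef] and pairs with difference [j] give [corr_coef]; [tail_coef]
    arises from multiplication by [g]. *)
Definition conv_coef (j : nat) : R := sum_f_R0 (fun m => b m * b (j - m)) j.
Definition corr_coef (j : nat) : R := Series (fun m => b m * b (m + j)).
Definition tail_coef (j : nat) : R := Series (fun r => INR r * b (j + r)).

(** The pair (m, n) is replaced by (m, j) with j = m + n, and the array is filled with zeros for j <
    m. The bound (r E)^j <= s^j s^j <= s^m s^j is then of product form. *)
Lemma Series_conv :
  ex_series (fun j => c j * conv_coef j) /\
  Series (fun m => Series (fun n => b m * b n * c (m + n)%nat)) = Series (fun j => c j * conv_coef j).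
Proof.
  destruct lambert_double_geom_bound as (C & r & s & HC & Hr & Hs & Hrs & HrE & B).
  set (F := fun m j => if (m <=? j)%nat then b m * b (j - m) * c j else 0).
  assert (HF : forall m j, Rabs (F m j) <= (C * C * s ^ m) * s ^ j).
  { intros m j. unfold F. destruct (Nat.leb_spec m j) as [Hmj|Hmj].
    - assert (B1 := lambert_bound Q m HQ). assert (B2 := lambert_bound Q (j - m) HQ).
      rewrite !Rabs_mult, (Rabs_pos_eq (b m)), (Rabs_pos_eq (b (j - m))); [|apply B2|apply B1].
      apply Rle_trans with ((C * r ^ m) * (C * r ^ (j - m)) * E ^ j).
      { apply Rmult_le_compat; auto using Rabs_pos.
        - apply Rmult_le_pos; [apply B1|apply B2].
        - apply Rmult_le_compat; [apply B1|apply B2|apply B|apply B]. }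
      replace (C * r ^ m * (C * r ^ (j - m)) * E ^ j) with (C * C * (r * E) ^ j).
      2:{ rewrite Rpow_mult_distr. replace j with (m + (j - m))%nat at 1 by lia.
          rewrite pow_add. ring. }
      rewrite !Rmult_assoc. do 2 (apply Rmult_le_compat_l; auto).
      apply Rle_trans with ((s * s) ^ j).
      + apply pow_incr. split; [apply Rmult_le_pos; lra|auto].
      + rewrite Rpow_mult_distr. apply Rmult_le_compat_r; [apply pow_le; lra|].
        apply pow_decr; auto; lra.
    - rewrite Rabs_R0. repeat apply Rmult_le_pos; auto; apply pow_le; lra. }
  assert (ea := ex_series_scal_geom (C * C) s ltac:(lra)).
  assert (eb : ex_series (fun n => s ^ n)).
  { apply ex_series_geom. rewrite Rabs_pos_eq; lra. }
  assert (Ecol : forall j, Series (fun m => F m j) = c j * conv_coef j).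
  { intros j. rewrite (Series_finite _ j).
    - unfold conv_coef. rewrite scal_sum. apply sum_eq. intros m Hm. unfold F.
      destruct (Nat.leb_spec m j); [ring|lia].
    - intros m Hm. unfold F. destruct (Nat.leb_spec m j); auto; lia. }
  split.
  - apply ex_series_ext with (fun j => Series (fun m => F m j)); [intros; apply Ecol|].
    exact (ex_series_Series_col F _ _ HF ea eb).
  - rewrite <- (Series_ext _ _ Ecol), <- (Series_swap F _ _ HF ea eb).
    apply Series_ext. intros m. rewrite (Series_shift (F m) m).
    + apply Series_ext. intros n. unfold F. destruct (Nat.leb_spec m (m + n)); [|lia].
      do 3 f_equal; lia.
    + intros j Hj. unfold F. destruct (Nat.leb_spec m j); auto; lia.
Qed.

Lemma Series_corr :
  ex_series (fun j => c j * corr_coef j) /\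
  Series (fun m => Series (fun j => b m * b (m + j) * c j)) = Series (fun j => c j * corr_coef j).
Proof.
  destruct lambert_double_geom_bound as (C & r & s & HC & Hr & Hs & Hrs & HrE & B).
  set (F := fun m j => b m * b (m + j) * c j).
  assert (HF : forall m j, Rabs (F m j) <= (C * C * r ^ m) * (s * s) ^ j).
  { intros m j. unfold F.
    assert (B1 := lambert_bound Q m HQ). assert (B2 := lambert_bound Q (m + j) HQ).
    rewrite !Rabs_mult, (Rabs_pos_eq (b m)), (Rabs_pos_eq (b (m + j))); [|apply B2|apply B1].
    apply Rle_trans with ((C * r ^ m) * (C * r ^ (m + j)) * E ^ j).
    { apply Rmult_le_compat; auto using Rabs_pos.
      - apply Rmult_le_pos; [apply B1|apply B2].
      - apply Rmult_le_compat; [apply B1|apply B2|apply B|apply B]. }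
    replace (C * r ^ m * (C * r ^ (m + j)) * E ^ j)
      with (C * C * r ^ m * ((r * E) ^ j * r ^ m)) by (rewrite Rpow_mult_distr, pow_add; ring).
    apply Rmult_le_compat_l. { repeat apply Rmult_le_pos; auto; apply pow_le; lra. }
    rewrite <- (Rmult_1_r ((s * s) ^ j)). apply Rmult_le_compat.
    - apply pow_le, Rmult_le_pos; lra.
    - apply pow_le; lra.
    - apply pow_incr. split; [apply Rmult_le_pos; lra|auto].
    - apply Rle_trans with (1 ^ m); [apply pow_incr; lra|rewrite pow1; lra]. }
  assert (ea := ex_series_scal_geom (C * C) r ltac:(lra)).
  assert (eb : ex_series (fun n => (s * s) ^ n)).
  { apply ex_series_geom. rewrite Rabs_pos_eq; nra. }
  assert (Ecol : forall j, Series (fun m => F m j) = c j * corr_coef j).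
  { intros j. unfold F, corr_coef. rewrite Series_scal_r. ring. }
  split.
  - apply ex_series_ext with (fun j => Series (fun m => F m j)); [intros; apply Ecol|].
    exact (ex_series_Series_col F _ _ HF ea eb).
  - rewrite <- (Series_ext _ _ Ecol). exact (Series_swap F _ _ HF ea eb).
Qed.

Lemma ex_series_lambert_sqr : ex_series (fun m => b m * b m).
Proof.
  destruct lambert_double_geom_bound as (C & r & s & HC & Hr & Hs & Hrs & HrE & B).
  apply ex_series_dom with (fun m => C * b m).
  - intros m. assert (B1 := lambert_bound Q m HQ).
    rewrite Rabs_pos_eq by (apply Rmult_le_pos; apply B1).
    apply Rmult_le_compat_r; [apply B1|]. destruct (B m) as [Bm _].
    apply Rle_trans with (1 := Bm). rewrite <- (Rmult_1_r C) at 2. apply Rmult_le_compat_l; auto.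
    apply Rle_trans with (1 ^ m); [apply pow_incr; lra|rewrite pow1; lra].
  - apply (ex_series_scal_l C b), ex_series_lambert_0, HQ.
Qed.

Lemma lambert_pair_bound : exists C s, 0 <= s < 1 /\ forall m n k, (k <= m + n)%nat ->
  Rabs (b m * b n * c k) <= (C * s ^ m) * s ^ n.
Proof.
  destruct lambert_double_geom_bound as (C & r & s & HC & Hr & Hs & Hrs & HrE & B).
  exists (C * C), (s * s). split; [split; nra|].
  intros m n k Hk.
  assert (B1 := lambert_bound Q m HQ). assert (B2 := lambert_bound Q n HQ).
  rewrite !Rabs_mult, (Rabs_pos_eq (b m)), (Rabs_pos_eq (b n)); [|apply B2|apply B1].
  apply Rle_trans with ((C * r ^ m) * (C * r ^ n) * E ^ (m + n)).
  { apply Rmult_le_compat; auto using Rabs_pos.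
    - apply Rmult_le_pos; [apply B1|apply B2].
    - apply Rmult_le_compat; [apply B1|apply B2|apply B|apply B].
    - apply Rle_trans with (1 := c_bound _). apply Rle_pow; auto. }
  replace (C * r ^ m * (C * r ^ n) * E ^ (m + n))
    with (C * C * (r * E) ^ m * (r * E) ^ n) by (rewrite !Rpow_mult_distr, pow_add; ring).
  assert (0 <= r * E) by (apply Rmult_le_pos; lra).
  apply Rmult_le_compat.
  - repeat apply Rmult_le_pos; auto; apply pow_le; lra.
  - apply pow_le; lra.
  - apply Rmult_le_compat_l; [apply Rmult_le_pos; auto|]. apply pow_incr; lra.
  - apply pow_incr; lra.
Qed.

(** The array is symmetric: the half m <= n counts twice and the diagonal, on which [c 0 = 1], has
    to be removed once. *)
Lemma Series_absdiff :
  Series (fun m => Series (fun n => b m * b n * c (absdiff m n))) =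
  2 * Series (fun j => c j * corr_coef j) - corr_coef 0.
Proof.
  destruct lambert_pair_bound as (C & s & Hss & HB).
  set (F := fun m n => b m * b n * c (absdiff m n)).
  set (F1 := fun m n => if (m <=? n)%nat then F m n else 0).
  assert (HF : forall m n, Rabs (F m n) <= (C * s ^ m) * s ^ n)
    by (intros; apply HB; unfold absdiff; lia).
  assert (HF1 : forall m n, Rabs (F1 m n) <= (C * s ^ m) * s ^ n).
  { intros m n. unfold F1. destruct (Nat.leb m n); auto. rewrite Rabs_R0.
    apply Rle_trans with (2 := HF m n). apply Rabs_pos. }
  assert (ea := ex_series_scal_geom C s Hss).
  assert (eb : ex_series (fun n => s ^ n)).
  { apply ex_series_geom. rewrite Rabs_pos_eq; lra. }
  destruct Series_corr as [_ EC]. rewrite <- EC.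
  assert (E1 : Series (fun m => Series (F1 m)) = Series (fun m => Series (fun j => b m * b (m + j) * c j))).
  { apply Series_ext. intros m. rewrite (Series_shift (F1 m) m).
    - apply Series_ext. intros n. unfold F1. destruct (Nat.leb_spec m (m + n)); [|lia].
      unfold F. do 2 f_equal. unfold absdiff; lia.
    - intros j Hj. unfold F1. destruct (Nat.leb_spec m j); auto; lia. }
  rewrite <- E1.
  assert (E2 : forall m, Series (F m) = Series (F1 m) + Series (fun n => F1 n m) - b m * b m).
  { intros m.
    set (D := fun n => if Nat.eqb n m then b m * b m else 0).
    assert (HD : is_series D (b m * b m)).
    { assert (X : sum_f_R0 D m = b m * b m).
      { unfold D. destruct m as [|m]; [reflexivity|]. rewrite tech5, Nat.eqb_refl.
        rewrite (sum_eq _ (fun _ => 0)).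
        - rewrite sum_cte. ring.
        - intros i Hi. destruct (Nat.eqb_spec i (S m)); auto; lia. }
      rewrite <- X. apply is_series_finite. intros n Hn. unfold D.
      destruct (Nat.eqb_spec n m); auto; lia. }
    assert (e1 := ex_series_dom_row F1 _ _ HF1 eb m).
    assert (e2 := ex_series_dom_col F1 _ _ HF1 ea m).
    rewrite <- (is_series_unique _ _ HD), <- Series_plus, <- Series_minus; auto.
    - apply Series_ext. intros n. unfold F1, D.
      destruct (Nat.leb_spec m n); destruct (Nat.leb_spec n m); destruct (Nat.eqb_spec n m);
        try lia; unfold F.
      + subst n. replace (absdiff m m) with 0%nat by (unfold absdiff; lia). rewrite c_0. ring.
      + ring.
      + replace (absdiff m n) with (absdiff n m) by (unfold absdiff; lia). ring.
    - apply (ex_series_plus _ _ e1 e2).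
    - now exists (b m * b m). }
  transitivity (Series (fun m => Series (F m))); [reflexivity|].
  rewrite (Series_ext _ _ E2).
  assert (e1 := ex_series_Series_row F1 _ _ HF1 ea eb).
  assert (e2 := ex_series_Series_col F1 _ _ HF1 ea eb).
  rewrite Series_minus, Series_plus; auto.
  - rewrite <- (Series_swap F1 _ _ HF1 ea eb).
    unfold corr_coef. rewrite (Series_ext (fun m => b m * b (m + 0)) (fun m => b m * b m)).
    + ring.
    + intros m. now rewrite Nat.add_0_r.
  - apply (ex_series_plus _ _ e1 e2).
  - apply ex_series_lambert_sqr.
Qed.

(** The product formula splits every term of the squared series into a sum term and a difference
    term. *)
Lemma lambert_trig_sqr :
  2 * Series (fun n => b n * c n) ^ 2 =
  Series (fun j => c j * conv_coef j) + 2 * Series (fun j => c j * corr_coef j) - corr_coef 0.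
Proof.
  destruct lambert_pair_bound as (C & s & Hss & HB).
  assert (ea := ex_series_scal_geom C s Hss).
  assert (eb : ex_series (fun n => s ^ n)).
  { apply ex_series_geom. rewrite Rabs_pos_eq; lra. }
  set (F1 := fun m n => b m * b n * c (m + n)%nat).
  set (F2 := fun m n => b m * b n * c (absdiff m n)).
  assert (H1 : forall m n, Rabs (F1 m n) <= (C * s ^ m) * s ^ n)
    by (intros; apply HB; lia).
  assert (H2 : forall m n, Rabs (F2 m n) <= (C * s ^ m) * s ^ n)
    by (intros; apply HB; unfold absdiff; lia).
  rewrite <- (proj2 Series_conv). unfold Rminus. rewrite Rplus_assoc.
  fold (2 * Series (fun j => c j * corr_coef j) - corr_coef 0).
  rewrite <- Series_absdiff.
  fold F1 F2.
  rewrite <- Series_plus.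
  2:{ exact (ex_series_Series_row F1 _ _ H1 ea eb). }
  2:{ exact (ex_series_Series_row F2 _ _ H2 ea eb). }
  set (S := Series (fun n => b n * c n)).
  transitivity (Series (fun m => 2 * S * (b m * c m))).
  { rewrite Series_scal_l. fold S. ring. }
  apply Series_ext. intros m.
  rewrite <- Series_plus.
  2:{ exact (ex_series_dom_row F1 _ _ H1 eb m). }
  2:{ exact (ex_series_dom_row F2 _ _ H2 eb m). }
  transitivity (Series (fun n => 2 * (b m * c m) * (b n * c n))).
  { rewrite Series_scal_l. fold S. ring. }
  apply Series_ext. intros n. unfold F1, F2.
  replace (2 * (b m * c m) * (b n * c n)) with (b m * b n * (2 * c m * c n)) by ring.
  rewrite c_mult. ring.
Qed.

(** The part of W with the double pole. As 1 - cos 2x = 2 sin^2 x, it is 1 / sin^2 x for the cosine,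
    and it is - 1 / sinh^2 x for cosh. *)
Variable g : R.
Hypothesis Hg : g * (1 - c 1%nat) = 2.

(* For [c n = cos (2 n x)] and [g = 1 / sin^2 x] this is the cosine expansion of Fejer's kernel. *)
Lemma inv_trig_mult (n : nat) :
  g * c n = g + 2 * INR n - 4 * sum_f_R0 (fun j => INR (n - j) * c j) n.
Proof.
  assert (H : forall n, g * c n = g + 2 * INR n - 4 * sum_f_R0 (fun j => INR (n - j) * c j) n
    /\ g * c (S n) = g + 2 * INR (S n) - 4 * sum_f_R0 (fun j => INR (S n - j) * c j) (S n)).
  2:{ apply H. }
  assert (T : forall n, sum_f_R0 (fun j => INR (S n - j) * c j) (S n)
     = sum_f_R0 (fun j => INR (n - j) * c j) n + sum_f_R0 c n).
  { intros k. rewrite tech5, Nat.sub_diag. change (INR 0) with 0. rewrite Rmult_0_l, Rplus_0_r.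
    rewrite <- plus_sum. apply sum_eq. intros i Hi.
    replace (S k - i)%nat with (S (k - i)) by lia. rewrite S_INR. ring. }
  intros k. induction k as [|k [IH1 IH2]].
  - rewrite T. unfold sum_f_R0. rewrite Nat.sub_diag, !S_INR, c_0. change (INR 0) with 0.
    split; [ring|]. replace (g * c 1%nat) with (g - 2) by (rewrite <- Hg; ring). ring.
  - split; auto.
    assert (X := c_mult (S k) 1).
    replace (S k + 1)%nat with (S (S k)) in X by lia.
    replace (absdiff (S k) 1) with k in X by (unfold absdiff; lia).
    rewrite !T in *. rewrite tech5 in *. rewrite !S_INR in *.
    assert (Y : g * c (S (S k)) = 2 * c (S k) * (g * c 1%nat) - g * c k).
    { replace (2 * c (S k) * (g * c 1%nat)) with (g * (2 * c (S k) * c 1%nat)) by ring.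
      rewrite X. ring. }
    replace (g * c 1%nat) with (g - 2) in Y by (rewrite <- Hg; ring).
    lra.
Qed.

(** [inv_trig_mult] writes [g * c n] through the [c j] with j <= n, with weights n - j. After
    exchanging the sums, the coefficient of [c j] collects r [b (j + r)] over r = n - j. *)
Lemma Series_tail :
  ex_series (fun j => c j * tail_coef j) /\
  g * Series (fun n => b n * c n) =
  g * Series b + 2 * Series (fun n => INR n * b n) - 4 * Series (fun j => c j * tail_coef j).
Proof.
  destruct lambert_double_geom_bound as (C & r & s & HC & Hr & Hs & Hrs & HrE & B).
  set (F := fun n j => if (j <=? n)%nat then b n * INR (n - j) * c j else 0).
  assert (HF : forall n j, Rabs (F n j) <= (C * s ^ n) * s ^ j).
  { intros n j. unfold F. destruct (Nat.leb_spec j n) as [Hmj|Hmj].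
    - assert (B1 := lambert_bound Q n HQ).
      rewrite !Rabs_mult, (Rabs_pos_eq (b n)), (Rabs_pos_eq (INR _)); [|apply pos_INR|apply B1].
      apply Rle_trans with ((C * r ^ n) * E ^ n).
      { apply Rmult_le_compat; auto using Rabs_pos.
        - apply Rmult_le_pos; [apply B1|apply pos_INR].
        - apply Rle_trans with (INR n * b n); [|apply B].
          rewrite Rmult_comm. apply Rmult_le_compat_r; [apply B1|]. apply le_INR; lia.
        - apply Rle_trans with (1 := c_bound _). apply Rle_pow; auto. }
      rewrite !Rmult_assoc. apply Rmult_le_compat_l; auto. rewrite <- Rpow_mult_distr.
      apply Rle_trans with ((s * s) ^ n).
      + apply pow_incr. split; [apply Rmult_le_pos; lra|auto].
      + rewrite Rpow_mult_distr. apply Rmult_le_compat_l; [apply pow_le; lra|].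
        apply pow_decr; auto; lra.
    - rewrite Rabs_R0. repeat apply Rmult_le_pos; auto; apply pow_le; lra. }
  assert (ea := ex_series_scal_geom C s ltac:(lra)).
  assert (eb : ex_series (fun n => s ^ n)).
  { apply ex_series_geom. rewrite Rabs_pos_eq; lra. }
  assert (Ecol : forall j, Series (fun n => F n j) = c j * tail_coef j).
  { intros j. rewrite (Series_shift (fun n => F n j) j).
    - unfold tail_coef. rewrite <- Series_scal_l. apply Series_ext. intros n. unfold F.
      destruct (Nat.leb_spec j (j + n)); [|lia]. replace (j + n - j)%nat with n by lia. ring.
    - intros n Hn. unfold F. destruct (Nat.leb_spec j n); auto; lia. }
  assert (Erow : forall n, Series (F n) = b n * sum_f_R0 (fun j => INR (n - j) * c j) n).
  { intros n. rewrite (Series_finite _ n).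
    - rewrite scal_sum. apply sum_eq. intros j Hj. unfold F.
      destruct (Nat.leb_spec j n); [ring|lia].
    - intros j Hj. unfold F. destruct (Nat.leb_spec j n); auto; lia. }
  assert (Hex : ex_series (fun j => c j * tail_coef j)).
  { apply ex_series_ext with (fun j => Series (fun m => F m j)); [intros; apply Ecol|].
    exact (ex_series_Series_col F _ _ HF ea eb). }
  split; auto.
  rewrite <- (Series_ext _ _ Ecol), <- (Series_swap F _ _ HF ea eb).
  assert (e0 := ex_series_lambert_0 Q HQ).
  assert (e1 : ex_series (fun n => INR n * b n)).
  { refine (ex_series_ext _ _ _ (ex_series_lambert Q 1 HQ)). intros n; simpl; ring_R. }
  assert (e2 := ex_series_Series_row F _ _ HF ea eb).
  rewrite <- !Series_scal_l.
  assert (e0' : ex_series (fun n => g * b n)) by exact (ex_series_scal_l g _ e0).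
  assert (e1' : ex_series (fun n => 2 * (INR n * b n))) by exact (ex_series_scal_l 2 _ e1).
  assert (e2' : ex_series (fun n => 4 * Series (F n))) by exact (ex_series_scal_l 4 _ e2).
  rewrite <- Series_plus, <- Series_minus; auto.
  - apply Series_ext. intros n. rewrite Erow.
    replace (g * (b n * c n)) with (b n * (g * c n)) by ring. rewrite inv_trig_mult. ring.
  - exact (ex_series_plus _ _ e0' e1').
Qed.

(** The left side is the second derivative of W in the cosine case, and of V = - U in the cosh case.
    In 6 U^2 the mixed term is given by [Series_tail] and the squared series by [lambert_trig_sqr];
    together they produce 384 times the combination tail + corr + conv / 2, which
    [lambert_convolution] evaluates. *)
Lemma lambert_trig_ode :
  let U := g - 8 * Series (fun n => b n * c n) in
  6 * g ^ 2 - 4 * g + 32 * Series (fun n => INR n ^ 2 * b n * c n) =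
  6 * U ^ 2 - (4 - 96 * Series b) * U
  - 192 * (Series (fun n => INR n * b n) + corr_coef 0).
Proof.
  intros U.
  assert (e1 := proj1 Series_conv). assert (e2 := proj1 Series_corr).
  destruct Series_tail as [e3 ET].
  assert (ES := lambert_trig_sqr).
  assert (e4 := ex_series_lambert_trig 0 ltac:(lia)).
  assert (e5 := ex_series_lambert_trig 2 ltac:(lia)).
  assert (e4' : ex_series (fun n => b n * c n)).
  { refine (ex_series_ext _ _ _ e4). intros n; simpl; ring_R. }
  set (S0 := Series (fun n => b n * c n)) in *.
  set (S2 := Series (fun n => INR n ^ 2 * b n * c n)) in *.
  set (B1 := Series b). set (B2 := Series (fun n => INR n * b n)) in *.
  set (D0 := corr_coef 0) in *.
  assert (Key : Series (fun j => c j * tail_coef j) + Series (fun j => c j * corr_coef j)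
     + Series (fun j => c j * conv_coef j) / 2
     = B2 + D0 + 2 * B1 * S0 + (S2 - S0) / 12).
  { unfold Rdiv. rewrite <- Series_scal_r.
    assert (e1' : ex_series (fun j => c j * conv_coef j * / 2)) by exact (ex_series_scal_r (/2) _ e1).
    rewrite <- Series_plus, <- Series_plus; auto.
    2:{ exact (ex_series_plus _ _ e3 e2). }
    (* [lambert_convolution] starts at j = 1. The term at j = 0 is [B2 + D0], since [conv_coef 0]
       vanishes. *)
    rewrite Series_incr_1.
    2:{ exact (ex_series_plus _ _ (ex_series_plus _ _ e3 e2) e1'). }
    assert (Z : Series (fun k => c (S k) * tail_coef (S k) + c (S k) * corr_coef (S k)
        + c (S k) * conv_coef (S k) * / 2) = 2 * B1 * S0 + (S2 - S0) * / 12).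
    { unfold S0, S2. rewrite <- Series_minus, <- Series_scal_l, <- Series_scal_r; auto.
      assert (e6 : ex_series (fun n => (INR n ^ 2 * b n * c n - b n * c n) * / 12)).
      { apply (ex_series_scal_r (/ 12) (fun n => INR n ^ 2 * b n * c n - b n * c n)).
        apply (ex_series_minus _ _ e5 e4'). }
      assert (e7 : ex_series (fun n => 2 * B1 * (b n * c n))) by exact (ex_series_scal_l _ _ e4').
      rewrite <- Series_plus; auto.
      rewrite (Series_incr_1 (fun n => 2 * B1 * (b n * c n) + _)).
      2:{ exact (ex_series_plus _ _ e7 e6). }
      rewrite lambert_0. rewrite !Rmult_0_r, !Rmult_0_l, Rmult_0_r, Rminus_0_r, Rmult_0_l, !Rplus_0_l.
      apply Series_ext. intros k.
      assert (L := lambert_convolution Q (S k) HQ ltac:(lia)).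
      fold (tail_coef (S k)) (corr_coef (S k)) (conv_coef (S k)) B1 in L.
      transitivity (c (S k) * (tail_coef (S k) + corr_coef (S k) + conv_coef (S k) / 2)); [field|].
      rewrite L. field. }
    rewrite Z. unfold tail_coef at 1, conv_coef at 1. unfold sum_f_R0.
    rewrite lambert_0, c_0. fold D0.
    change (Series (fun r => INR r * b (0 + r))) with B2. ring. }
  fold B1 in ET. unfold U. nra.
Qed.

End TrigSquare.

(** * The expansion of the cotangent *)

Lemma is_derive_sum_f_R0 (f g : nat -> R -> R) (x : R) (n : nat) :
  (forall k, is_derive (f k) x (g k x)) ->
  is_derive (fun y => sum_f_R0 (fun k => f k y) n) x (sum_f_R0 (fun k => g k x) n).
Proof.
  intros H. induction n as [|n IH]; simpl; auto.
  exact (is_derive_plus _ _ x _ _ IH (H (S n))).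
Qed.

Lemma is_derive_incr (f f' : R -> R) (a b : R) :
  a <= b -> (forall t, a <= t <= b -> is_derive f t (f' t)) ->
  (forall t, a <= t <= b -> 0 <= f' t) -> f a <= f b.
Proof.
  intros Hab D P. destruct (MVT_gen f a b f') as [c [Hc E]].
  - intros t. rewrite Rmin_left, Rmax_right by auto. intros; apply D; lra.
  - intros t. rewrite Rmin_left, Rmax_right by auto. intros Ht.
    apply derivable_continuous_pt. exists (f' t). apply is_derive_Reals, D; auto.
  - rewrite Rmin_left, Rmax_right in Hc by auto.
    assert (0 <= f' c * (b - a)) by (apply Rmult_le_pos; [apply P; auto|lra]). lra.
Qed.

(** To the right of [t0] the function g exp (- M t) decreases, to the left g exp (M t) increases
    towards [t0]; being nonnegative, [g] is 0. Applied to squares, this proves identities from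
    differential equations. *)
Lemma gronwall_zero (g g' : R -> R) (M a b t0 : R) :
  a <= t0 <= b -> g t0 = 0 ->
  (forall t, a <= t <= b -> 0 <= g t) ->
  (forall t, a <= t <= b -> is_derive g t (g' t)) ->
  (forall t, a <= t <= b -> Rabs (g' t) <= M * g t) ->
  forall t, a <= t <= b -> g t = 0.
Proof.
  intros Ht0 H0 Hp D B t Ht.
  destruct (Rle_dec t0 t) as [L|L].
  - assert (X : - (g t0 * exp (- M * t0)) <= - (g t * exp (- M * t))).
    { apply is_derive_incr with (f := fun t => - (g t * exp (- M * t)))
        (f' := fun t => - (g' t * exp (- M * t) + g t * (- M * exp (- M * t)))); auto.
      - intros s Hs. assert (Ds := D s ltac:(lra)). auto_derive.
        + now exists (g' s).
        + derive_subst Ds. ring.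
      - intros s Hs. assert (Bs := B s ltac:(lra)). assert (E := exp_pos (- M * s)).
        replace (- (g' s * exp (- M * s) + g s * (- M * exp (- M * s))))
          with ((M * g s - g' s) * exp (- M * s)) by ring.
        apply Rmult_le_pos; [|lra]. apply Rabs_le_between in Bs. lra. }
    rewrite H0 in X. assert (E := exp_pos (- M * t)). assert (P := Hp t Ht). nra.
  - assert (X : g t * exp (M * t) <= g t0 * exp (M * t0)).
    { apply is_derive_incr with (f := fun t => g t * exp (M * t))
        (f' := fun t => g' t * exp (M * t) + g t * (M * exp (M * t))); [lra| |].
      - intros s Hs. assert (Ds := D s ltac:(lra)). auto_derive.
        + now exists (g' s).
        + derive_subst Ds. ring.
      - intros s Hs. assert (Bs := B s ltac:(lra)). assert (E := exp_pos (M * s)).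
        replace (g' s * exp (M * s) + g s * (M * exp (M * s)))
          with ((M * g s + g' s) * exp (M * s)) by ring.
        apply Rmult_le_pos; [|lra]. apply Rabs_le_between in Bs. lra. }
    rewrite H0 in X. assert (E := exp_pos (M * t)). assert (P := Hp t Ht). nra.
Qed.

(* [cot x = 1/x - sum_j cot_coef j * x^(2j+1)]; the Riccati equation [cot' = -1 - cot^2]
   makes these coefficients positive. [cot_table n] is correct below [n]. *)
Fixpoint cot_table (n : nat) : nat -> R :=
  match n with
  | O => fun _ => 0
  | S n' => fun j =>
      if (j <? n')%nat then cot_table n' j else
      match n' with
      | O => / 3
      | S k => sum_f_R0 (fun i => cot_table n' i * cot_table n' (k - i)) k / (2 * INR k + 5)
      end
  end.

Definition cot_coef (j : nat) : R := cot_table (S j) j.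

Lemma cot_table_coef (n j : nat) : (j < n)%nat -> cot_table n j = cot_coef j.
Proof.
  induction n as [|n IH]; intros H; [lia|].
  destruct (Nat.eq_dec j n) as [->|Hj]; [reflexivity|].
  simpl. destruct (Nat.ltb_spec j n); [apply IH; lia|lia].
Qed.

Lemma cot_coef_0 : cot_coef 0 = / 3.
Proof. reflexivity. Qed.

Lemma cot_coef_S (k : nat) :
  (2 * INR k + 5) * cot_coef (S k) = sum_f_R0 (fun i => cot_coef i * cot_coef (k - i)) k.
Proof.
  unfold cot_coef at 1. set (n := S k).
  assert (E : cot_table (S n) n = sum_f_R0 (fun i => cot_coef i * cot_coef (k - i)) k / (2 * INR k + 5)).
  { unfold n. change (cot_table (S (S k)) (S k)) with
     (if (S k <? S k)%nat then cot_table (S k) (S k) else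
      sum_f_R0 (fun i => cot_table (S k) i * cot_table (S k) (k - i)) k / (2 * INR k + 5)).
    rewrite Nat.ltb_irrefl. f_equal. apply sum_eq. intros i Hi.
    rewrite !cot_table_coef by lia. reflexivity. }
  rewrite E. field. assert (H := pos_INR k). lra.
Qed.

Lemma cot_coef_pos (j : nat) : 0 < cot_coef j.
Proof.
  induction j as [j IH] using lt_wf_ind. destruct j as [|k].
  - rewrite cot_coef_0. lra.
  - assert (H := pos_INR k). apply Rmult_lt_reg_l with (2 * INR k + 5); [lra|].
    rewrite cot_coef_S, Rmult_0_r.
    assert (X : forall n, (n <= k)%nat -> 0 < sum_f_R0 (fun i => cot_coef i * cot_coef (k - i)) n).
    { induction n as [|n IHn]; intros Hn; simpl.
      - apply Rmult_lt_0_compat; apply IH; lia.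
      - apply Rplus_lt_0_compat; [apply IHn; lia|]. apply Rmult_lt_0_compat; apply IH; lia. }
    apply X; auto.
Qed.

(** The recursion turns the left side into x plus x times the low-degree part of the Cauchy square
    of the partial sum; the omitted products are nonnegative. *)
Lemma cot_partial_riccati (N : nat) (x : R) : 0 <= x ->
  sum_f_R0 (fun j => (2 * INR j + 3) * cot_coef j * x ^ (2 * j + 1)) N
  <= x * (1 + sum_f_R0 (fun j => cot_coef j * x ^ (2 * j + 1)) N ^ 2).
Proof.
  intros Hx. assert (Pc := cot_coef_pos).
  set (An := fun j => cot_coef j * x ^ (2 * j + 1)).
  assert (PA : forall j, 0 <= An j).
  { intros j. apply Rmult_le_pos; [apply Rlt_le, Pc|apply pow_le; auto]. }
  destruct N as [|N].
  { unfold sum_f_R0. rewrite cot_coef_0. simpl.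
    assert (H := pow2_ge_0 (An 0%nat)). simpl in H. nra. }
  assert (C := cauchy_finite An An (S N) ltac:(lia)).
  assert (H : sum_f_R0 (fun k => sum_f_R0 (fun p => An p * An (k - p)%nat) k) (S N)
     <= sum_f_R0 An (S N) ^ 2).
  { replace (sum_f_R0 An (S N) ^ 2) with (sum_f_R0 An (S N) * sum_f_R0 An (S N)) by ring.
    rewrite C.
    match goal with |- ?a <= ?a + ?b => enough (0 <= b) by lra end.
    apply cond_pos_sum. intros k. apply cond_pos_sum. intros l. apply Rmult_le_pos; auto. }
  rewrite tech5 in H.
  assert (H2 : 0 <= sum_f_R0 (fun p => An p * An (S N - p)%nat) (S N)).
  { apply cond_pos_sum. intros l. apply Rmult_le_pos; auto. }
  rewrite decomp_sum by lia. simpl pred.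
  rewrite (sum_eq _ (fun k => sum_f_R0 (fun p => An p * An (k - p)%nat) k * x)).
  - rewrite <- scal_sum. rewrite cot_coef_0. change (INR 0) with 0. simpl (x ^ (2 * 0 + 1)).
    replace ((2 * 0 + 3) * / 3 * (x * 1)) with x by field.
    rewrite Rmult_plus_distr_l, Rmult_1_r. apply Rplus_le_compat_l, Rmult_le_compat_l; auto. lra.
  - intros k Hk. rewrite S_INR. replace (2 * (INR k + 1) + 3) with (2 * INR k + 5) by ring.
    rewrite cot_coef_S, (Rmult_comm _ x), scal_sum, (Rmult_comm _ (x ^ _)), scal_sum.
    apply sum_eq. intros i Hi. unfold An.
    replace (2 * S k + 1)%nat with (S ((2 * i + 1) + (2 * (k - i) + 1)))%nat by lia.
    rewrite <- tech_pow_Rmult, pow_add. ring.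
Qed.

(** The partial sum is at most 1/x - cot x on all of (0, PI), which gives convergence up to PI. With
    A' = S, the product of sin t (1 - t S) - t cos t and the integrating factor exp (- A) vanishes
    at 0 and increases, by the Riccati inequality. *)
Lemma cot_partial_bound (N : nat) (x : R) : 0 < x < PI ->
  sin x * (x * sum_f_R0 (fun j => cot_coef j * x ^ (2 * j + 1)) N) <= sin x - x * cos x.
Proof.
  intros Hx.
  set (S := fun t => sum_f_R0 (fun j => cot_coef j * t ^ (2 * j + 1)) N).
  set (S' := fun t => sum_f_R0 (fun j => (2 * INR j + 1) * cot_coef j * t ^ (2 * j)) N).
  set (A := fun t => sum_f_R0 (fun j => cot_coef j * t ^ (2 * j + 2) / (2 * INR j + 2)) N).
  assert (DS : forall t, is_derive S t (S' t)).
  { intros t. unfold S, S'.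
    apply (is_derive_sum_f_R0 (fun j t => cot_coef j * t ^ (2 * j + 1))
      (fun j t => (2 * INR j + 1) * cot_coef j * t ^ (2 * j))).
    intros k. auto_derive; auto. replace (Init.Nat.pred (k + (k + 0) + 1)) with (2 * k)%nat by lia.
    rewrite !plus_INR. change (INR 0) with 0. change (INR 1) with 1. ring. }
  assert (DA : forall t, is_derive A t (S t)).
  { intros t. unfold S, A.
    apply (is_derive_sum_f_R0 (fun j t => cot_coef j * t ^ (2 * j + 2) / (2 * INR j + 2))
      (fun j t => cot_coef j * t ^ (2 * j + 1))).
    intros k. assert (P := pos_INR k). auto_derive; auto.
    replace (Init.Nat.pred (k + (k + 0) + 2)) with (2 * k + 1)%nat by lia.
    rewrite !plus_INR. change (INR 0) with 0. change (INR 2) with (1 + 1). field. lra. }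
  fold (S x).
  assert (X : (sin 0 * (1 - 0 * S 0) - 0 * cos 0) * exp (- A 0)
     <= (sin x * (1 - x * S x) - x * cos x) * exp (- A x)).
  { apply is_derive_incr with (f := fun t => (sin t * (1 - t * S t) - t * cos t) * exp (- A t))
      (f' := fun t => sin t * (t * (1 + S t ^ 2) - 2 * S t - t * S' t) * exp (- A t)); [lra| |].
    - intros t Ht. auto_derive.
      + repeat split; [exists (S' t)|exists (S t)]; auto.
      + assert (D1 := DS t). assert (D2 := DA t). derive_subst D1. derive_subst D2. ring.
    - intros t Ht. apply Rmult_le_pos; [|apply Rlt_le, exp_pos].
      apply Rmult_le_pos. { apply sin_ge_0; lra. }
      assert (R := cot_partial_riccati N t ltac:(lra)). fold (S t) in R.
      enough (E : sum_f_R0 (fun j => (2 * INR j + 3) * cot_coef j * t ^ (2 * j + 1)) N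
        = 2 * S t + t * S' t) by lra.
      unfold S, S'. rewrite !scal_sum, <- plus_sum. apply sum_eq. intros i Hi.
      rewrite pow_add. ring. }
  rewrite sin_0 in X. assert (E := exp_pos (- A x)).
  assert (0 <= sin x * (1 - x * S x) - x * cos x); [|nra].
  apply Rmult_le_reg_r with (exp (- A x)); auto. nra.
Qed.

Lemma ex_series_cot (x : R) : 0 < x < PI -> ex_series (fun j => cot_coef j * (x ^ 2) ^ j).
Proof.
  intros Hx. assert (Hs := sin_gt_0 x (proj1 Hx) (proj2 Hx)).
  destruct (ex_finite_lim_seq_incr (sum_n (fun j => cot_coef j * (x ^ 2) ^ j))
    ((sin x - x * cos x) / (sin x * x ^ 2))) as [l Hl].
  - intros n. rewrite sum_Sn. change (sum_n (fun j => cot_coef j * (x ^ 2) ^ j) n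
      <= sum_n (fun j => cot_coef j * (x ^ 2) ^ j) n + cot_coef (S n) * (x ^ 2) ^ S n).
    assert (0 <= cot_coef (S n) * (x ^ 2) ^ S n); [|lra].
    apply Rmult_le_pos; [apply Rlt_le, cot_coef_pos|apply pow_le, pow2_ge_0].
  - intros n. rewrite sum_n_Reals. assert (B := cot_partial_bound n x Hx).
    assert (0 < sin x * x ^ 2) by (apply Rmult_lt_0_compat; [|apply pow_lt]; lra).
    apply Rmult_le_reg_r with (sin x * x ^ 2); auto.
    unfold Rdiv. rewrite (Rmult_assoc (sin x - _)), Rinv_l, Rmult_1_r by lra.
    apply Rle_trans with (2 := B). right.
    rewrite (Rmult_comm _ (sin x * x ^ 2)), !Rmult_assoc. f_equal.
    rewrite !scal_sum. apply sum_eq. intros i Hi. rewrite pow_add, pow_mult. ring.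
  - exists l. exact Hl.
Qed.

Lemma cot_radius (v : R) : Rabs v < PI ^ 2 -> Rbar_lt (Rabs v) (CV_radius cot_coef).
Proof.
  intros Hv. assert (P := PI_RGT_0). assert (Pv := Rabs_pos v).
  set (x := (sqrt (Rabs v) + PI) / 2).
  assert (Q : 0 <= sqrt (Rabs v) < PI).
  { split; [apply sqrt_pos|]. rewrite <- (sqrt_pow2 PI) by lra. apply sqrt_lt_1; lra. }
  assert (Hx : 0 < x < PI) by (unfold x; lra).
  apply Rbar_lt_le_trans with (Rabs (x ^ 2)).
  - rewrite (Rabs_pos_eq (x ^ 2)) by (apply pow2_ge_0). simpl. assert (E := sqrt_sqrt (Rabs v) Pv).
    assert (sqrt (Rabs v) < x) by (unfold x; lra). nra.
  - apply CV_radius_ge, ex_series_cot; auto.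
Qed.

(** At v = x^2 this is (1 - x cot x) / x^2, at v = - x^2 it is (x coth x - 1) / x^2. *)
Definition cot_series : R -> R := PSeries cot_coef.
Definition cot_series' : R -> R := PSeries (PS_derive cot_coef).

Lemma is_derive_cot_series (v : R) : Rabs v < PI ^ 2 -> is_derive cot_series v (cot_series' v).
Proof. intros Hv. apply is_derive_PSeries, cot_radius, Hv. Qed.

Lemma cot_series_riccati (v : R) : Rabs v < PI ^ 2 ->
  3 * cot_series v + 2 * v * cot_series' v = 1 + v * cot_series v ^ 2.
Proof.
  intros Hv. assert (Hr := cot_radius v Hv).
  assert (E1 := PSeries_correct _ _ (CV_radius_inside _ _ Hr)). fold (cot_series v) in E1.
  assert (E2 := PSeries_correct _ _ (ex_pseries_derive _ _ Hr)). fold (cot_series' v) in E2.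
  assert (E3 := is_pseries_mult _ _ v _ _ E1 E1 Hr Hr).
  apply is_pseries_incr_1 in E2. apply is_pseries_incr_1 in E3.
  apply is_pseries_R in E1. apply is_pseries_R in E2. apply is_pseries_R in E3.
  assert (L : is_series (fun n => (2 * INR n + 3) * cot_coef n * v ^ n)
     (3 * cot_series v + 2 * (v * cot_series' v))).
  { assert (X := is_series_plus _ _ _ _ (is_series_scal_l 3 _ _ E1) (is_series_scal_l 2 _ _ E2)).
    refine (is_series_ext _ _ _ _ X). intros n.
    change (3 * (cot_coef n * v ^ n) + 2 * (PS_incr_1 (PS_derive cot_coef) n * v ^ n)
      = (2 * INR n + 3) * cot_coef n * v ^ n).
    destruct n as [|n].
    - unfold PS_incr_1. change (zero : R) with 0. change (INR 0) with 0. ring.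
    - unfold PS_incr_1, PS_derive. ring. }
  assert (E4 : is_series (fun n => (match n with O => 1 | _ => 0 end) * v ^ n) 1).
  { assert (X := is_series_finite (fun n => (match n with O => 1 | _ => 0 end) * v ^ n) 0).
    unfold sum_f_R0 in X. simpl (_ * v ^ 0) in X. rewrite Rmult_1_r in X. apply X.
    intros n Hn. destruct n; [lia|ring]. }
  assert (M : is_series (fun n => (2 * INR n + 3) * cot_coef n * v ^ n)
     (1 + v * (cot_series v * cot_series v))).
  { assert (X := is_series_plus _ _ _ _ E4 E3).
    refine (is_series_ext _ _ _ _ X). intros n.
    change ((match n with O => 1 | _ => 0 end) * v ^ n
       + PS_incr_1 (PS_mult cot_coef cot_coef) n * v ^ n = (2 * INR n + 3) * cot_coef n * v ^ n).
    destruct n as [|n].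
    - unfold PS_incr_1. change (zero : R) with 0. change (INR 0) with 0. rewrite cot_coef_0. field.
    - unfold PS_incr_1, PS_mult. rewrite <- cot_coef_S, S_INR. ring. }
  apply is_series_unique in L. apply is_series_unique in M. rewrite L in M.
  simpl. lra.
Qed.

Lemma cot_series_le (v w : R) : Rabs w <= v -> v < PI ^ 2 -> Rabs (cot_series w) <= cot_series v.
Proof.
  intros Hw Hv. assert (P := Rabs_pos w).
  assert (Hr := cot_radius v ltac:(rewrite Rabs_pos_eq; lra)).
  apply CV_radius_inside in Hr. apply ex_pseries_R in Hr.
  unfold cot_series, PSeries. apply Series_Rabs_le; auto.
  intros n. rewrite Rabs_mult, <- RPow_abs, (Rabs_pos_eq (cot_coef n)).
  - apply Rmult_le_compat_l; [apply Rlt_le, cot_coef_pos|]. apply pow_incr; lra.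
  - apply Rlt_le, cot_coef_pos.
Qed.

Lemma sqr_lt_PI (t x : R) : 0 <= t <= x -> x < PI -> Rabs (t ^ 2) < PI ^ 2 /\ Rabs (- t ^ 2) < PI ^ 2
  /\ Rabs (t ^ 2) <= x ^ 2 /\ Rabs (- t ^ 2) <= x ^ 2.
Proof. intros Ht Hx. rewrite Rabs_Ropp, Rabs_pos_eq by nra. repeat split; nra. Qed.

(** By the Riccati equation the defect [m] satisfies m' = t [cot_series (t ^ 2)] m with m 0 = 0, so
    Gronwall applies to its square. [coth_expansion] is the same argument at v = - t^2. *)
Lemma cot_expansion (x : R) : 0 <= x < PI ->
  x * cos x = sin x * (1 - x ^ 2 * cot_series (x ^ 2)).
Proof.
  intros Hx.
  set (m := fun t => sin t * (1 - t ^ 2 * cot_series (t ^ 2)) - t * cos t).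
  assert (H : m x ^ 2 = 0).
  { apply (gronwall_zero (fun t => m t ^ 2) (fun t => 2 * (t * cot_series (t ^ 2)) * m t ^ 2)
      (2 * (x * cot_series (x ^ 2))) 0 x 0); try lra.
    - unfold m. rewrite sin_0. ring.
    - intros; apply pow2_ge_0.
    - intros t Ht. destruct (sqr_lt_PI t x Ht (proj2 Hx)) as (B1 & _ & _ & _).
      assert (D := is_derive_cot_series _ B1). unfold m. auto_derive.
      + repeat split; eexists; apply D.
      + replace (t * (t * 1)) with (t ^ 2) by ring. derive_subst D.
        assert (R := cot_series_riccati _ B1).
        set (p := cot_series (t ^ 2)) in *. set (q := cot_series' (t ^ 2)) in *.
        assert (R0 : 1 + t ^ 2 * p ^ 2 - 3 * p - 2 * t ^ 2 * q = 0) by lra.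
        set (mt := sin t * (1 - t ^ 2 * p) - t * cos t).
        transitivity (2 * mt * (t * p * mt + sin t * t * (1 + t ^ 2 * p ^ 2 - 3 * p - 2 * t ^ 2 * q))).
        { unfold mt. ring. }
        rewrite R0. ring.
    - intros t Ht. destruct (sqr_lt_PI t x Ht (proj2 Hx)) as (B1 & _ & B2 & _).
      assert (C := cot_series_le (x ^ 2) (t ^ 2) B2 ltac:(nra)).
      rewrite Rabs_mult, (Rabs_pos_eq (m t ^ 2)) by apply pow2_ge_0.
      apply Rmult_le_compat_r; [apply pow2_ge_0|].
      rewrite !Rabs_mult, (Rabs_pos_eq 2), (Rabs_pos_eq t) by lra.
      apply Rmult_le_compat_l; [lra|]. apply Rmult_le_compat; auto using Rabs_pos; lra. }
  assert (m x = 0) by nra. unfold m in *. lra.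
Qed.

Lemma coth_expansion (x : R) : Rabs x < PI ->
  x * cosh x = sinh x * (1 + x ^ 2 * cot_series (- x ^ 2)).
Proof.
  assert (Pos : forall x, 0 <= x < PI ->
    x * cosh x = sinh x * (1 + x ^ 2 * cot_series (- x ^ 2))).
  2:{ intros Hx. apply Rabs_lt_between in Hx. destruct (Rle_dec 0 x) as [h|h]; [apply Pos; lra|].
      assert (E := Pos (- x) ltac:(lra)).
      replace (cosh (- x)) with (cosh x) in E by (unfold cosh; rewrite Ropp_involutive; field).
      replace (sinh (- x)) with (- sinh x) in E by (unfold sinh; rewrite Ropp_involutive; field).
      replace ((- x) ^ 2) with (x ^ 2) in E by ring. lra. }
  clear x. intros x Hx.
  assert (Dc : forall t, is_derive cosh t (sinh t))
    by (intros t; unfold cosh, sinh; auto_derive; auto; field).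
  assert (Ds : forall t, is_derive sinh t (cosh t))
    by (intros t; unfold cosh, sinh; auto_derive; auto; field).
  set (m := fun t => sinh t * (1 + t ^ 2 * cot_series (- t ^ 2)) - t * cosh t).
  assert (H : m x ^ 2 = 0).
  { apply (gronwall_zero (fun t => m t ^ 2) (fun t => 2 * (- t * cot_series (- t ^ 2)) * m t ^ 2)
      (2 * (x * cot_series (x ^ 2))) 0 x 0); try lra.
    - unfold m. rewrite sinh_0. ring.
    - intros; apply pow2_ge_0.
    - intros t Ht. destruct (sqr_lt_PI t x Ht (proj2 Hx)) as (_ & B1 & _ & _).
      assert (D := is_derive_cot_series _ B1). unfold m. auto_derive.
      + repeat split; eexists; first [apply D|apply Dc|apply Ds].
      + replace (t * (t * 1)) with (t ^ 2) by ring. derive_subst D.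
        assert (D1 := Dc t). derive_subst D1. assert (D2 := Ds t). derive_subst D2.
        assert (R := cot_series_riccati _ B1).
        set (p := cot_series (- t ^ 2)) in *. set (q := cot_series' (- t ^ 2)) in *.
        assert (R0 : 1 + - t ^ 2 * p ^ 2 - 3 * p - 2 * - t ^ 2 * q = 0) by lra.
        set (mt := sinh t * (1 + t ^ 2 * p) - t * cosh t).
        transitivity (2 * mt * (- t * p * mt - sinh t * t * (1 + - t ^ 2 * p ^ 2 - 3 * p - 2 * - t ^ 2 * q))).
        { unfold mt. ring. }
        rewrite R0. ring.
    - intros t Ht. destruct (sqr_lt_PI t x Ht (proj2 Hx)) as (_ & B1 & _ & B2).
      assert (C := cot_series_le (x ^ 2) (- t ^ 2) B2 ltac:(nra)).
      rewrite Rabs_mult, (Rabs_pos_eq (m t ^ 2)) by apply pow2_ge_0.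
      apply Rmult_le_compat_r; [apply pow2_ge_0|].
      rewrite !Rabs_mult, Rabs_Ropp, (Rabs_pos_eq 2), (Rabs_pos_eq t) by lra.
      apply Rmult_le_compat_l; [lra|]. apply Rmult_le_compat; auto using Rabs_pos; lra. }
  assert (m x = 0) by nra. unfold m in *. lra.
Qed.

(** Since csc^2 = - cot', the expansion of the cotangent is differentiated term by term. *)
Definition csc_coef (j : nat) : R := (2 * INR j + 1) * cot_coef j.

Lemma is_pseries_csc (v : R) : Rabs v < PI ^ 2 ->
  is_pseries csc_coef v (cot_series v + 2 * v * cot_series' v).
Proof.
  intros Hv. assert (Hr := cot_radius v Hv).
  assert (E1 := PSeries_correct _ _ (CV_radius_inside _ _ Hr)). fold (cot_series v) in E1.
  assert (E2 := PSeries_correct _ _ (ex_pseries_derive _ _ Hr)). fold (cot_series' v) in E2.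
  apply is_pseries_incr_1 in E2.
  apply is_pseries_R in E1. apply is_pseries_R in E2. apply is_pseries_R.
  assert (X := is_series_plus _ _ _ _ E1 (is_series_scal_l 2 _ _ E2)).
  replace (cot_series v + 2 * v * cot_series' v)
    with (cot_series v + 2 * (v * cot_series' v)) by ring.
  refine (is_series_ext _ _ _ _ X). intros n.
  change (cot_coef n * v ^ n + 2 * (PS_incr_1 (PS_derive cot_coef) n * v ^ n)
    = csc_coef n * v ^ n). unfold csc_coef.
  destruct n as [|n].
  - unfold PS_incr_1. change (zero : R) with 0. change (INR 0) with 0. ring.
  - unfold PS_incr_1, PS_derive. ring.
Qed.

Lemma csc_sqr_expansion (x : R) : 0 < x < PI ->
  / sin x ^ 2 = / x ^ 2 + PSeries csc_coef (x ^ 2).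
Proof.
  intros Hx. assert (Hs := sin_gt_0 x (proj1 Hx) (proj2 Hx)).
  destruct (sqr_lt_PI x x) as (B & _); try lra.
  rewrite (is_pseries_unique _ _ _ (is_pseries_csc _ B)).
  assert (R := cot_series_riccati _ B).
  replace (cot_series (x ^ 2) + 2 * x ^ 2 * cot_series' (x ^ 2))
    with (1 + x ^ 2 * cot_series (x ^ 2) ^ 2 - 2 * cot_series (x ^ 2)) by lra.
  assert (C := cot_expansion x ltac:(lra)).
  assert (T := sin2_cos2 x). unfold Rsqr in T.
  set (p := cot_series (x ^ 2)) in *.
  apply Rmult_eq_reg_r with (sin x ^ 2 * x ^ 2).
  2:{ apply Rgt_not_eq, Rmult_lt_0_compat; apply pow_lt; lra. }
  transitivity (x ^ 2); [field; lra|].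
  transitivity (x ^ 2 * sin x ^ 2 + (sin x * (1 - x ^ 2 * p)) ^ 2); [rewrite <- C|field; lra].
  transitivity (x ^ 2 * (sin x * sin x + cos x * cos x)); [rewrite T|]; ring.
Qed.

Lemma csch_sqr_expansion (x : R) : 0 < x < PI ->
  / sinh x ^ 2 = / x ^ 2 - PSeries csc_coef (- x ^ 2).
Proof.
  intros Hx. assert (Hs := sinh_lt 0 x (proj1 Hx)). rewrite sinh_0 in Hs.
  destruct (sqr_lt_PI x x) as (_ & B & _); try lra.
  rewrite (is_pseries_unique _ _ _ (is_pseries_csc _ B)).
  assert (R := cot_series_riccati _ B).
  replace (cot_series (- x ^ 2) + 2 * - x ^ 2 * cot_series' (- x ^ 2))
    with (1 - x ^ 2 * cot_series (- x ^ 2) ^ 2 - 2 * cot_series (- x ^ 2)) by lra.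
  assert (C := coth_expansion x ltac:(rewrite Rabs_pos_eq; lra)).
  assert (T : cosh x * cosh x - sinh x * sinh x = 1).
  { unfold cosh, sinh. field_simplify. rewrite exp_Ropp. field. assert (X := exp_pos x); lra. }
  set (p := cot_series (- x ^ 2)) in *.
  apply Rmult_eq_reg_r with (sinh x ^ 2 * x ^ 2).
  2:{ apply Rgt_not_eq, Rmult_lt_0_compat; apply pow_lt; lra. }
  transitivity (x ^ 2); [field; lra|].
  transitivity ((sinh x * (1 + x ^ 2 * p)) ^ 2 - x ^ 2 * sinh x ^ 2); [rewrite <- C|field; lra].
  transitivity (x ^ 2 * (cosh x * cosh x - sinh x * sinh x)); [rewrite T|]; ring.
Qed.

(** * Bernoulli numbers *)

(** From t / (exp t - 1) = (t/2) coth (t/2) - t/2: the odd part is the single term - t/2, and the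
    even part is [coth_expansion] at t/2. For k = 2 i the coefficient of t^(2i+2) is (-1)^i
    [cot_coef i] / 4^(i+1). *)
Definition bernoulli_coef (n : nat) : R :=
  match n with
  | O => 1
  | S O => - / 2
  | S (S k) => if Nat.even k then (-1) ^ (k / 2) * cot_coef (k / 2) / 4 ^ S (k / 2) else 0
  end.

Lemma is_pseries_bernoulli_coef (t : R) : 0 < Rabs t < 2 * PI ->
  is_pseries bernoulli_coef t (t / (exp t - 1)).
Proof.
  intros Ht. set (x := t / 2).
  assert (Hx : Rabs x < PI). { unfold x, Rdiv. rewrite Rabs_mult, (Rabs_pos_eq (/2)); lra. }
  assert (Hx0 : x <> 0). { intros E. unfold x in E. replace t with 0 in Ht by lra. rewrite Rabs_R0 in Ht; lra. }
  assert (Hv : Rabs (- x ^ 2) < PI ^ 2).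
  { rewrite Rabs_Ropp, <- RPow_abs. assert (P := Rabs_pos x). nra. }
  replace (t / (exp t - 1)) with ((1 + x ^ 2 * cot_series (- x ^ 2)) + t * (- / 2)).
  - apply is_pseries_odd_even.
    + assert (E := PSeries_correct _ _ (CV_radius_inside _ _ (cot_radius _ Hv))).
      apply is_pseries_R in E. apply is_pseries_R.
      apply (is_series_decr_1 (fun k => bernoulli_coef (2 * k) * (t ^ 2) ^ k)).
      match goal with |- is_series _ ?l =>
        replace l with (x ^ 2 * cot_series (- x ^ 2))
          by (change l with (1 + x ^ 2 * cot_series (- x ^ 2) + - (1 * 1)); ring) end.
      assert (X := is_series_scal_l (x ^ 2) _ _ E).
      refine (is_series_ext _ _ _ _ X). intros n.
      change (x ^ 2 * (cot_coef n * (- x ^ 2) ^ n) = bernoulli_coef (2 * S n) * (t ^ 2) ^ S n).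
      replace (2 * S n)%nat with (S (S (2 * n))) by lia.
      unfold bernoulli_coef. rewrite Nat.even_even.
      replace (2 * n / 2)%nat with n by (rewrite Nat.mul_comm, Nat.div_mul; lia).
      replace (t ^ 2) with (4 * x ^ 2) by (unfold x; field).
      replace (- x ^ 2) with ((-1) * x ^ 2) by ring.
      rewrite !Rpow_mult_distr. rewrite <- (tech_pow_Rmult (x ^ 2)). field. apply pow_nonzero; lra.
    + apply is_pseries_R.
      assert (X := is_series_finite (fun k => bernoulli_coef (2 * k + 1) * (t ^ 2) ^ k) 0).
      unfold sum_f_R0 in X. simpl (_ ^ 0) in X. rewrite Rmult_1_r in X. apply X.
      intros n Hn. destruct n as [|n]; [lia|].
      replace (2 * S n + 1)%nat with (S (S (2 * n + 1))) by lia.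
      unfold bernoulli_coef. rewrite Nat.even_odd. ring.
  - assert (C := coth_expansion x Hx).
    assert (Hs : sinh x <> 0).
    { intros E. destruct (Rtotal_order x 0) as [h|[h|h]]; [|lra|]; apply sinh_lt in h;
        rewrite sinh_0 in h; lra. }
    replace t with (2 * x) at 2 3 by (unfold x; field).
    apply Rmult_eq_reg_r with (sinh x); auto.
    transitivity (x * cosh x - x * sinh x). { rewrite C. unfold x; field. }
    assert (E2 : exp (2 * x) = exp x * exp x) by (rewrite <- exp_plus; f_equal; ring).
    unfold cosh, sinh in *. rewrite exp_Ropp in *. assert (P := exp_pos x).
    rewrite E2. field. split; [lra|].
    intros E. apply Hs. field_simplify; [|lra]. simpl. unfold Rdiv.
    replace (exp x * (exp x * 1) - 1) with 0 by lra. ring.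
Qed.

Lemma bernoulli_spec : bernoulli_gen bernoulli.
Proof.
  unfold bernoulli. apply epsilon_spec. exists (fun n => bernoulli_coef n * INR (fact n)).
  intros t Ht. assert (H := is_pseries_bernoulli_coef t Ht). apply is_pseries_R in H.
  refine (is_series_ext _ _ _ _ H). intros n.
  change (bernoulli_coef n * t ^ n = bernoulli_coef n * INR (fact n) * (t ^ n / INR (fact n))).
  field. apply INR_fact_neq_0.
Qed.

(** Uniqueness of power series coefficients pins down the function picked by [epsilon]. *)
Lemma bernoulli_eq (n : nat) : bernoulli n = bernoulli_coef n * INR (fact n).
Proof.
  assert (P := PI_RGT_0).
  assert (E : bernoulli n / INR (fact n) = bernoulli_coef n).
  { apply (is_pseries_unique_right (fun n => bernoulli n / INR (fact n)) bernoulli_coef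
      (fun t => t / (exp t - 1)) (2 * PI)); [lra| |].
    - intros t Ht. apply is_pseries_R.
      assert (H := bernoulli_spec t ltac:(rewrite Rabs_pos_eq; lra)).
      refine (is_series_ext _ _ _ _ H). intros k. unfold Rdiv. ring_R.
    - intros t Ht. apply is_pseries_bernoulli_coef. rewrite Rabs_pos_eq; lra. }
  rewrite <- E. field. apply INR_fact_neq_0.
Qed.

Lemma bernoulli_even (j : nat) :
  bernoulli (2 * S j) = (-1) ^ j * cot_coef j / 4 ^ S j * INR (fact (2 * S j)).
Proof.
  rewrite bernoulli_eq. f_equal. replace (2 * S j)%nat with (S (S (2 * j))) by lia.
  unfold bernoulli_coef. rewrite Nat.even_even.
  replace (2 * j / 2)%nat with j by (rewrite Nat.mul_comm, Nat.div_mul; lia). reflexivity.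
Qed.

(** * Symmetric solutions with a double pole *)

Lemma is_derive_continuity_pt (f : R -> R) (x l : R) : is_derive f x l -> continuity_pt f x.
Proof. intros D. apply derivable_continuous_pt. exists l. now apply is_derive_Reals. Qed.

Lemma continuity_bounded (f : R -> R) (a b : R) :
  a <= b -> (forall c, a <= c <= b -> continuity_pt f c) ->
  exists M, forall c, a <= c <= b -> Rabs (f c) <= M.
Proof.
  intros Hab Hc.
  destruct (continuity_ab_maj f a b Hab Hc) as [x [Hx _]].
  destruct (continuity_ab_min f a b Hab Hc) as [y [Hy _]].
  exists (Rabs (f x) + Rabs (f y)). intros c Hc'.
  assert (H1 := Hx c Hc'). assert (H2 := Hy c Hc').
  revert H1 H2. unfold Rabs. repeat destruct Rcase_abs; lra.
Qed.

(** The difference d = f - h satisfies d'' = (6 (f + h) + p) d, whose factor is bounded on the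
    compact interval; Gronwall applies to d^2 + d'^2. *)
Lemma quadratic_ode_unique (p q a b t0 : R) (f f' h h' : R -> R) :
  a <= t0 <= b ->
  (forall t, a <= t <= b -> is_derive f t (f' t)) ->
  (forall t, a <= t <= b -> is_derive f' t (6 * f t ^ 2 + p * f t + q)) ->
  (forall t, a <= t <= b -> is_derive h t (h' t)) ->
  (forall t, a <= t <= b -> is_derive h' t (6 * h t ^ 2 + p * h t + q)) ->
  f t0 = h t0 -> f' t0 = h' t0 ->
  forall t, a <= t <= b -> f t = h t.
Proof.
  intros Ht0 Df Df' Dh Dh' E0 E0' t Ht.
  destruct (continuity_bounded f a b) as [Mf HMf]; [lra|intros c Hc; eapply is_derive_continuity_pt; auto|].
  destruct (continuity_bounded h a b) as [Mh HMh]; [lra|intros c Hc; eapply is_derive_continuity_pt; auto|].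
  set (d := fun s => f s - h s). set (d' := fun s => f' s - h' s).
  assert (H : (fun s => d s ^ 2 + d' s ^ 2) t = 0).
  { apply (gronwall_zero (fun s => d s ^ 2 + d' s ^ 2)
      (fun s => 2 * (d s * d' s) * (1 + 6 * (f s + h s) + p))
      (1 + 6 * (Mf + Mh) + Rabs p) a b t0); auto.
    - unfold d, d'. rewrite E0, E0'. ring.
    - intros s Hs. assert (H1 := pow2_ge_0 (d s)). assert (H2 := pow2_ge_0 (d' s)). lra.
    - intros s Hs. unfold d, d'. assert (D1 := Df s Hs). assert (D2 := Df' s Hs).
      assert (D3 := Dh s Hs). assert (D4 := Dh' s Hs).
      auto_derive.
      + repeat split; eexists; eassumption.
      + derive_subst D1. derive_subst D2. derive_subst D3. derive_subst D4. ring.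
    - intros s Hs. rewrite Rabs_mult, Rmult_comm. apply Rmult_le_compat; auto using Rabs_pos.
      + assert (B1 := HMf s Hs). assert (B2 := HMh s Hs).
        apply Rabs_le_between in B1. apply Rabs_le_between in B2.
        assert (B3 := Rle_abs p). assert (B4 := Rle_abs (- p)). rewrite Rabs_Ropp in B4.
        apply Rabs_le_between. lra.
      + apply Rabs_le_between. assert (H1 := pow2_ge_0 (d s + d' s)).
        assert (H2 := pow2_ge_0 (d s - d' s)). lra. }
  simpl in H. unfold d in H. nra.
Qed.

(** Shared by W, with a = PI/2 and p = - mu, and by V, with a = y0 and p = mu, so that monotonicity
    and inversion are proved once. The poles are at 0 and, by symmetry, at 2 a. *)
Record blowup_solution (f f' : R -> R) (p q a : R) : Prop := {
  bs_pos : 0 < a;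
  bs_derive : forall x, 0 < x < 2 * a -> is_derive f x (f' x);
  bs_derive2 : forall x, 0 < x < 2 * a -> is_derive f' x (6 * f x ^ 2 + p * f x + q);
  bs_sym : forall x, 0 < x < 2 * a -> f (2 * a - x) = f x;
  bs_blowup : forall M, exists d, 0 < d /\ forall x, 0 < x < d -> M < f x }.

Section Blowup.

Variables (f f' : R -> R) (p q a : R).
Hypothesis bs : blowup_solution f f' p q a.

Lemma blowup_unbounded (b M : R) : 0 < b -> exists x, 0 < x < b /\ M < f x.
Proof.
  intros Hb. destruct (bs_blowup _ _ _ _ _ bs M) as [d [Hd H]].
  assert (P : 0 < Rmin d b) by (apply Rmin_pos; auto).
  assert (L1 := Rmin_l d b). assert (L2 := Rmin_r d b).
  exists (Rmin d b / 2). split; [lra|]. apply H. lra.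
Qed.

Lemma blowup_derive_mid : f' a = 0.
Proof.
  assert (Ha := bs_pos _ _ _ _ _ bs).
  assert (D := bs_derive _ _ _ _ _ bs a ltac:(lra)).
  assert (D1 : is_derive (fun x => f (2 * a - x)) a (- f' a)).
  { assert (D' := D). replace a with (2 * a - a) in D' at 1 by ring.
    auto_derive; replace (2 * a + - a) with a by ring.
    - now exists (f' a).
    - derive_subst D. ring. }
  assert (D2 : is_derive f a (- f' a)).
  { apply is_derive_ext_loc with (2 := D1).
    exists (mkposreal a Ha). intros y Hy. apply bs_sym with (1 := bs).
    change (Rabs (y - a) < a) in Hy. apply Rabs_lt_between in Hy. lra. }
  apply is_derive_unique in D. apply is_derive_unique in D2. lra.
Qed.

(* At a critical point the solution would be symmetric by uniqueness, hence would blow up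
   again inside the interval. *)
Lemma blowup_derive_neq (x0 : R) : 0 < x0 < a -> f' x0 <> 0.
Proof.
  intros Hx0 E.
  assert (Sym : forall x, 0 < x < 2 * x0 -> f x = f (2 * x0 - x)).
  { intros x Hx.
    set (lo := Rmin x (2 * x0 - x)).
    assert (Hlo : 0 < lo) by (apply Rmin_pos; lra).
    assert (L1 : lo <= x) by apply Rmin_l. assert (L2 : lo <= 2 * x0 - x) by apply Rmin_r.
    apply (quadratic_ode_unique p q lo (2 * x0 - lo) x0 f f' (fun t => f (2 * x0 - t))
       (fun t => - f' (2 * x0 - t))); try lra.
    - intros t Ht. apply bs; lra.
    - intros t Ht. apply bs; lra.
    - intros t Ht. assert (D := bs_derive _ _ _ _ _ bs (2 * x0 + - t) ltac:(lra)).
      auto_derive.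
      + now exists (f' (2 * x0 + - t)).
      + derive_subst D. unfold Rminus. ring.
    - intros t Ht. assert (D := bs_derive2 _ _ _ _ _ bs (2 * x0 + - t) ltac:(lra)).
      auto_derive.
      + eexists; eassumption.
      + derive_subst D. unfold Rminus. ring.
    - f_equal; ring.
    - replace (2 * x0 - x0) with x0 by ring. rewrite E. ring. }
  assert (C := is_derive_continuity_pt _ _ _ (bs_derive _ _ _ _ _ bs (2 * x0) ltac:(lra))).
  destruct (C 1 ltac:(lra)) as [e [He Hc]].
  destruct (blowup_unbounded (Rmin e (2 * x0)) (f (2 * x0) + 1)) as [x [Hx Hfx]].
  { apply Rmin_pos; lra. }
  assert (L1 := Rmin_l e (2 * x0)). assert (L2 := Rmin_r e (2 * x0)).
  specialize (Hc (2 * x0 - x)).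
  assert (X : Rabs (f (2 * x0 - x) - f (2 * x0)) < 1).
  { apply Hc. split; [split; [exact I|lra]|]. simpl. unfold Rdist.
    replace (2 * x0 - x - 2 * x0) with (- x) by ring. rewrite Rabs_Ropp, Rabs_pos_eq; lra. }
  rewrite <- Sym in X by lra. apply Rabs_lt_between in X. lra.
Qed.

(** A positive derivative at [x] and the growth of [f] near 0 would force a sign change of [f'],
    hence a zero, on the way. *)
Lemma blowup_derive_neg (x : R) : 0 < x < a -> f' x < 0.
Proof.
  intros Hx. destruct (Rtotal_order (f' x) 0) as [H|[H|H]]; auto.
  { destruct (blowup_derive_neq x Hx H). }
  exfalso.
  destruct (blowup_unbounded x (f x) (proj1 Hx)) as [y [Hy Hfy]].
  destruct (MVT_gen f y x f') as [c [Hc E]].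
  - intros t. rewrite Rmin_left, Rmax_right by lra. intros; apply bs; lra.
  - intros t. rewrite Rmin_left, Rmax_right by lra. intros Ht.
    eapply is_derive_continuity_pt, (bs_derive _ _ _ _ _ bs); lra.
  - rewrite Rmin_left, Rmax_right in Hc by lra.
    assert (Nc : f' c < 0) by nra.
    assert (c < x) by (destruct (Req_dec c x); [subst; lra|lra]).
    destruct (IVT_interv f' c x) as [z [Hz Ez]]; auto.
    + intros t Ht. eapply is_derive_continuity_pt, (bs_derive2 _ _ _ _ _ bs); lra.
    + apply (blowup_derive_neq z); auto. lra.
Qed.

Lemma blowup_decr (x y : R) : 0 < x < y -> y <= a -> f y < f x.
Proof.
  intros Hxy Hy. assert (Ha := bs_pos _ _ _ _ _ bs).
  destruct (MVT_gen f x ((x + y) / 2) f') as [c [Hc E]].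
  - intros t. rewrite Rmin_left, Rmax_right by lra. intros; apply bs; lra.
  - intros t. rewrite Rmin_left, Rmax_right by lra. intros Ht.
    eapply is_derive_continuity_pt, (bs_derive _ _ _ _ _ bs); lra.
  - destruct (MVT_gen f ((x + y) / 2) y f') as [c' [Hc' E']].
    + intros t. rewrite Rmin_left, Rmax_right by lra. intros; apply bs; lra.
    + intros t. rewrite Rmin_left, Rmax_right by lra. intros Ht.
      eapply is_derive_continuity_pt, (bs_derive _ _ _ _ _ bs); lra.
    + rewrite Rmin_left, Rmax_right in Hc, Hc' by lra.
      assert (N := blowup_derive_neg c ltac:(lra)).
      assert (N' : f' c' <= 0).
      { destruct (Req_dec c' a) as [->|]; [rewrite blowup_derive_mid; lra|].
        apply Rlt_le, blowup_derive_neg; lra. }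
      nra.
Qed.

(** Otherwise the constant [f a] would solve the same equation with the same data at [a]. This
    excludes a double root of the cubic at [f a]. *)
Lemma blowup_derive2_neq : 6 * f a ^ 2 + p * f a + q <> 0.
Proof.
  intros E. assert (Ha := bs_pos _ _ _ _ _ bs).
  assert (X : f (a / 2) = f a).
  { apply (quadratic_ode_unique p q (a / 2) a a f f' (fun _ => f a) (fun _ => 0)); try lra.
    - intros t Ht; apply bs; lra.
    - intros t Ht; apply bs; lra.
    - intros t Ht. auto_derive; auto.
    - intros t Ht. rewrite E. auto_derive; auto.
    - apply blowup_derive_mid. }
  assert (Y := blowup_decr (a / 2) a ltac:(lra) ltac:(lra)). lra.
Qed.

Lemma blowup_first_integral (x y : R) : 0 < x < 2 * a -> 0 < y < 2 * a ->
  f' x ^ 2 - 4 * f x ^ 3 - p * f x ^ 2 - 2 * q * f x =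
  f' y ^ 2 - 4 * f y ^ 3 - p * f y ^ 2 - 2 * q * f y.
Proof.
  set (I := fun t => f' t ^ 2 - 4 * f t ^ 3 - p * f t ^ 2 - 2 * q * f t).
  assert (D : forall t, 0 < t < 2 * a -> is_derive I t 0).
  { intros t Ht. assert (D1 := bs_derive _ _ _ _ _ bs t Ht).
    assert (D2 := bs_derive2 _ _ _ _ _ bs t Ht). unfold I. auto_derive.
    - repeat split; eexists; eassumption.
    - derive_subst D1. derive_subst D2. ring. }
  assert (L : forall x y, 0 < x -> x <= y -> y < 2 * a -> I x = I y).
  { intros u v Hu Huv Hv. apply Rle_antisym.
    - apply is_derive_incr with (fun _ => 0); auto; intros; [apply D|]; lra.
    - apply Ropp_le_cancel.
      apply (is_derive_incr (fun t => - I t) (fun _ => 0)); auto; intros; [|lra].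
      assert (D1 := D t ltac:(lra)). auto_derive; [now exists 0|]. derive_subst D1. ring. }
  intros Hx Hy. fold (I x) (I y).
  destruct (Rle_dec x y); [apply L; lra|symmetry; apply L; lra].
Qed.

(** Just before [a] the value of [f] lies slightly above [A]. If B > A, the cubic would be negative
    there although it equals a square; B = A is the double root excluded by [blowup_derive2_neq]. *)
Lemma blowup_root_order (A B C : R) :
  f a = A -> C < A -> p = - 4 * (A + B + C) -> q = 2 * (A * B + A * C + B * C) ->
  (forall x, 0 < x < a -> f' x ^ 2 = 4 * (f x - A) * (f x - B) * (f x - C)) -> B < A.
Proof.
  intros HA HC Hp Hq HI. assert (Ha := bs_pos _ _ _ _ _ bs).
  destruct (Rtotal_order B A) as [H|[H|H]]; auto; exfalso.
  - apply blowup_derive2_neq. rewrite HA, Hp, Hq, H. ring.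
  - assert (Ct := is_derive_continuity_pt _ _ _ (bs_derive _ _ _ _ _ bs a ltac:(lra))).
    destruct (Ct (B - A) ltac:(lra)) as [e [He Hc]].
    assert (M := Rmin_pos e a He Ha). assert (M1 := Rmin_l e a). assert (M2 := Rmin_r e a).
    set (x := a - Rmin e a / 2). assert (Hx : 0 < x < a) by (unfold x; lra).
    assert (X : Rabs (f x - f a) < B - A).
    { apply (Hc x). split; [split; [exact I|lra]|]. simpl. unfold Rdist, x.
      replace (a - Rmin e a / 2 - a) with (- (Rmin e a / 2)) by ring.
      rewrite Rabs_Ropp, Rabs_pos_eq; lra. }
    apply Rabs_lt_between in X. rewrite HA in X.
    assert (D := blowup_decr x a Hx ltac:(lra)). rewrite HA in D.
    assert (N := blowup_derive_neg x Hx). specialize (HI x Hx).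
    assert (0 < f' x ^ 2) by nra.
    assert (0 < (f x - A) * (f x - C)) by (apply Rmult_lt_0_compat; lra). nra.
Qed.

End Blowup.

(** * Elliptic integrals *)

Lemma is_derive_eq (f g d : R -> R) (a b : R) :
  a <= b -> (forall t, a <= t <= b -> is_derive f t (d t)) ->
  (forall t, a <= t <= b -> is_derive g t (d t)) -> f a - g a = f b - g b.
Proof.
  intros Hab Df Dg.
  assert (D : forall t, a <= t <= b -> is_derive (fun t => f t - g t) t 0).
  { intros t Ht. replace 0 with (d t - d t) by ring.
    exact (is_derive_minus _ _ _ _ _ (Df t Ht) (Dg t Ht)). }
  apply Rle_antisym.
  - apply (is_derive_incr (fun t => f t - g t) (fun _ => 0)); auto; intros; lra.
  - apply Ropp_le_cancel.
    apply (is_derive_incr (fun t => - (f t - g t)) (fun _ => 0)); auto; intros; [|lra].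
    rewrite <- Ropp_0. apply (is_derive_opp (fun t => f t - g t)). auto.
Qed.

Definition ellipticF_integrand (k theta : R) : R := / sqrt (1 - k ^ 2 * sin theta ^ 2).
Definition ellipticI_integrand (k t : R) : R := / sqrt ((1 - t ^ 2) * (1 - k ^ 2 * t ^ 2)).
(** [ellipticK] is defined by the algebraic integrand and [jacobi_sn] by the trigonometric one; this
    proper integral links the two through t = sin theta. *)
Definition ellipticI (x k : R) : R := RInt (ellipticI_integrand k) 0 x.

Section Modulus.

Variable k : R.
Hypothesis hk : 0 < k < 1.

Lemma ellipticF_arg_pos (t : R) : 0 < 1 - k ^ 2 * sin t ^ 2.
Proof. assert (B := SIN_bound t). assert (H1 : sin t ^ 2 <= 1) by nra. assert (H2 := pow2_ge_0 (sin t)). nra. Qed.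

Lemma ellipticF_integrand_continuous (t : R) : continuous (ellipticF_integrand k) t.
Proof.
  apply (ex_derive_continuous (ellipticF_integrand k)). unfold ellipticF_integrand.
  assert (H := ellipticF_arg_pos t). auto_derive. split.
  - simpl in H |- *. lra.
  - split; auto. apply Rgt_not_eq, sqrt_lt_R0. simpl in H |- *. lra.
Qed.

Lemma is_derive_ellipticF (p : R) :
  is_derive (fun p => ellipticF p k) p (ellipticF_integrand k p).
Proof.
  apply (is_derive_RInt (ellipticF_integrand k) _ 0).
  - apply filter_forall. intros x. apply (RInt_correct (ellipticF_integrand k)).
    apply ex_RInt_continuous. intros; apply ellipticF_integrand_continuous.
  - apply ellipticF_integrand_continuous.
Qed.

Lemma ellipticF_0 : ellipticF 0 k = 0.
Proof. unfold ellipticF. exact (RInt_point 0 _). Qed.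

Lemma ellipticF_integrand_pos (t : R) : 0 < ellipticF_integrand k t.
Proof. apply Rinv_0_lt_compat, sqrt_lt_R0, ellipticF_arg_pos. Qed.

Lemma ellipticF_incr (p r : R) : p < r -> ellipticF p k < ellipticF r k.
Proof.
  intros H. destruct (MVT_gen (fun p => ellipticF p k) p r (ellipticF_integrand k)) as [c [_ E]].
  - intros; apply is_derive_ellipticF.
  - intros. eapply is_derive_continuity_pt, is_derive_ellipticF.
  - assert (P := ellipticF_integrand_pos c). nra.
Qed.

Lemma ellipticF_inj (p r : R) : ellipticF p k = ellipticF r k -> p = r.
Proof.
  intros E. destruct (Rtotal_order p r) as [H|[H|H]]; auto; apply ellipticF_incr in H; lra.
Qed.

Lemma ellipticF_opp (p : R) : ellipticF (- p) k = - ellipticF p k.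
Proof.
  assert (Pos : forall p, 0 <= p -> ellipticF (- p) k = - ellipticF p k).
  { intros r Hr.
    assert (X := is_derive_eq (fun t => ellipticF (- t) k) (fun t => - ellipticF t k)
       (fun t => - ellipticF_integrand k t) 0 r Hr).
    cbv beta in X. rewrite Ropp_0, ellipticF_0 in X.
    assert (0 - - 0 = ellipticF (- r) k - - ellipticF r k); [|lra].
    apply X.
    - intros t _. assert (D := is_derive_ellipticF (- t)).
      replace (- ellipticF_integrand k t) with (scal (- 1) (ellipticF_integrand k (- t))).
      + apply (is_derive_comp (fun p => ellipticF p k) (fun t => - t)); auto.
        auto_derive; auto.
      + unfold ellipticF_integrand. rewrite sin_neg.
        change (- 1 * / sqrt (1 - k ^ 2 * (- sin t) ^ 2) = - / sqrt (1 - k ^ 2 * sin t ^ 2)).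
        replace ((- sin t) ^ 2) with (sin t ^ 2) by ring. ring.
    - intros t _. apply (is_derive_opp (fun t => ellipticF t k)), is_derive_ellipticF. }
  destruct (Rle_dec 0 p); auto.
  assert (E := Pos (- p) ltac:(lra)). rewrite Ropp_involutive in E. lra.
Qed.

(** Injectivity lets [iota] be evaluated at any argument presented as a value of [ellipticF]; every
    later value of sn is computed in this way. *)
Lemma jacobi_am_ellipticF (p : R) : jacobi_am (ellipticF p k) k = p.
Proof.
  unfold jacobi_am. apply (iota_unique (V := R_CompleteNormedModule)); auto.
  intros y. apply ellipticF_inj.
Qed.

Lemma ellipticI_arg_pos (t : R) : -1 < t < 1 -> 0 < 1 - t ^ 2 /\ 0 < 1 - k ^ 2 * t ^ 2.
Proof. intros Ht. split; [nra|]. assert (t ^ 2 < 1) by nra. assert (0 <= t ^ 2) by nra. nra. Qed.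

Lemma ellipticI_integrand_continuous (t : R) : -1 < t < 1 -> continuous (ellipticI_integrand k) t.
Proof.
  intros Ht. apply (ex_derive_continuous (ellipticI_integrand k)). unfold ellipticI_integrand.
  destruct (ellipticI_arg_pos t Ht) as [H1 H2].
  assert (H := Rmult_lt_0_compat _ _ H1 H2). auto_derive. split.
  - simpl in H |- *. lra.
  - split; auto. apply Rgt_not_eq, sqrt_lt_R0. simpl in H |- *. lra.
Qed.

Lemma ellipticI_correct (x : R) : -1 < x < 1 ->
  is_RInt (ellipticI_integrand k) 0 x (ellipticI x k).
Proof.
  intros Hx. apply (RInt_correct (ellipticI_integrand k)).
  apply ex_RInt_continuous. intros z Hz. apply ellipticI_integrand_continuous.
  revert Hz. unfold Rmin, Rmax. destruct Rle_dec; lra.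
Qed.

Lemma is_derive_ellipticI (x : R) : -1 < x < 1 ->
  is_derive (fun x => ellipticI x k) x (ellipticI_integrand k x).
Proof.
  intros Hx. apply (is_derive_RInt (ellipticI_integrand k) _ 0).
  - assert (P : 0 < 1 - Rabs x) by (unfold Rabs; destruct Rcase_abs; lra).
    exists (mkposreal _ P). intros y Hy. apply ellipticI_correct.
    change (Rabs (y - x) < 1 - Rabs x) in Hy. revert Hy.
    unfold Rabs. repeat destruct Rcase_abs; lra.
  - apply ellipticI_integrand_continuous; auto.
Qed.

Lemma ellipticI_0 : ellipticI 0 k = 0.
Proof. unfold ellipticI. exact (RInt_point 0 _). Qed.

Lemma ellipticI_sin (p : R) : 0 <= p < PI / 2 -> ellipticI (sin p) k = ellipticF p k.
Proof.
  intros Hp.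
  assert (X := is_derive_eq (fun t => ellipticI (sin t) k) (fun t => ellipticF t k)
    (ellipticF_integrand k) 0 p (proj1 Hp)).
  cbv beta in X. rewrite sin_0, ellipticI_0, ellipticF_0 in X.
  assert (0 - 0 = ellipticI (sin p) k - ellipticF p k); [|lra].
  apply X.
  - intros t Ht. assert (C := cos_gt_0 t ltac:(lra) ltac:(lra)).
    assert (T := sin2_cos2 t). unfold Rsqr in T.
    assert (B : -1 < sin t < 1) by nra.
    replace (ellipticF_integrand k t) with (scal (cos t) (ellipticI_integrand k (sin t))).
    + apply (is_derive_comp (fun x => ellipticI x k) sin); [apply is_derive_ellipticI; auto|].
      apply is_derive_Reals, derivable_pt_lim_sin.
    + change (cos t * ellipticI_integrand k (sin t) = ellipticF_integrand k t).
      unfold ellipticI_integrand, ellipticF_integrand.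
      assert (P := ellipticF_arg_pos t). assert (P' := sqrt_lt_R0 _ P).
      replace (1 - sin t ^ 2) with (cos t ^ 2) by lra.
      rewrite sqrt_mult by (try apply pow2_ge_0; lra). rewrite sqrt_pow2 by lra.
      field. lra.
  - intros t _. apply is_derive_ellipticF.
Qed.

Lemma ellipticI_asin (x : R) : 0 <= x < 1 -> ellipticI x k = ellipticF (asin x) k.
Proof.
  intros Hx. rewrite <- ellipticI_sin, sin_asin; [auto|lra|].
  assert (B := asin_bound_lt x ltac:(lra)). split; [|lra].
  destruct (proj1 Hx) as [h| <-]; [|rewrite asin_0; lra].
  apply Rlt_le, sin_increasing_0; try lra. rewrite sin_0, sin_asin; lra.
Qed.

(** The singularity at 1 disappears in the angle: the limit is continuity of [ellipticF] at PI/2,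
    transported by asin. *)
Lemma ellipticI_lim (eps : R) : 0 < eps ->
  exists d, 0 < d < 1 /\
  forall x, 1 - d < x < 1 -> Rabs (ellipticI x k - ellipticF (PI / 2) k) < eps.
Proof.
  intros He. assert (PP := PI_RGT_0).
  assert (C := is_derive_continuity_pt _ _ _ (is_derive_ellipticF (PI / 2))).
  destruct (C eps He) as [e [He' Hc]].
  set (e' := Rmin (e / 2) (PI / 4)).
  assert (L1 : e' <= e / 2) by apply Rmin_l. assert (L2 : e' <= PI / 4) by apply Rmin_r.
  assert (L3 : 0 < e') by (apply Rmin_pos; lra).
  assert (S1 : 0 < sin (PI / 2 - e')) by (apply sin_gt_0; lra).
  assert (S2 : sin (PI / 2 - e') < 1).
  { rewrite <- sin_PI2. apply sin_increasing_1; lra. }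
  exists (1 - sin (PI / 2 - e')). split; [lra|].
  intros x Hx. rewrite ellipticI_asin by lra.
  assert (B := asin_bound_lt x ltac:(lra)).
  assert (B2 : PI / 2 - e' < asin x).
  { apply sin_increasing_0; try lra. rewrite sin_asin; lra. }
  apply (Hc (asin x)). split; [split; [exact I|lra]|].
  simpl. unfold Rdist. apply Rabs_lt_between. lra.
Qed.

Lemma ellipticK_eq : ellipticK k = ellipticF (PI / 2) k.
Proof.
  unfold ellipticK. apply is_RInt_gen_unique; try apply _.
  intros P [eps HP].
  destruct (ellipticI_lim eps (cond_pos eps)) as [d [Hd H]].
  apply (Filter_prod _ _ _ (fun x => x = 0) (fun x => 1 - d < x < 1)).
  - reflexivity.
  - exists (mkposreal d (proj1 Hd)). intros y Hy Hy1.
    change (Rabs (y - 1) < d) in Hy. apply Rabs_lt_between in Hy. lra.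
  - intros x y -> Hy. exists (ellipticI y k). split.
    + apply ellipticI_correct. lra.
    + apply HP. apply H. auto.
Qed.

Lemma ellipticK_pos : 0 < ellipticK k.
Proof.
  rewrite ellipticK_eq, <- ellipticF_0. apply ellipticF_incr. assert (P := PI_RGT_0). lra.
Qed.

(** As the limit at 1 exists, it can be read along any points accumulating at 1, such as those
    produced by a substitution. *)
Lemma ellipticK_unique (l : R) :
  (forall eps, 0 < eps -> forall d, 0 < d -> exists x, 1 - d < x < 1 /\ Rabs (ellipticI x k - l) < eps) ->
  ellipticK k = l.
Proof.
  intros H. rewrite ellipticK_eq.
  destruct (Req_dec (ellipticF (PI / 2) k) l) as [|N]; auto. exfalso.
  assert (P : 0 < Rabs (ellipticF (PI / 2) k - l) / 2).
  { apply Rdiv_lt_0_compat; [apply Rabs_pos_lt|]; lra. }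
  destruct (ellipticI_lim _ P) as [d [Hd Hl]].
  destruct (H _ P d (proj1 Hd)) as [x [Hx Hl']]. specialize (Hl x Hx).
  revert Hl Hl' P. unfold Rabs. repeat destruct Rcase_abs; lra.
Qed.

End Modulus.

Lemma ellipticK_incr (k l : R) : 0 < k -> k < l -> l < 1 -> ellipticK k < ellipticK l.
Proof.
  intros Hk Hkl Hl. rewrite !ellipticK_eq by lra. assert (P := PI_RGT_0).
  apply RInt_lt; [lra| | |].
  - intros; apply ellipticF_integrand_continuous; lra.
  - intros; apply ellipticF_integrand_continuous; lra.
  - intros x Hx. assert (S := sin_gt_0 x ltac:(lra) ltac:(lra)).
    assert (P1 := ellipticF_arg_pos k ltac:(lra) x). assert (P2 := ellipticF_arg_pos l ltac:(lra) x).
    assert (0 < sin x ^ 2) by (apply pow_lt; auto). assert (k ^ 2 < l ^ 2) by nra.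
    apply Rinv_lt_contravar.
    + apply Rmult_lt_0_compat; apply sqrt_lt_R0; auto.
    + apply sqrt_lt_1; nra.
Qed.

Definition compl_modulus (k : R) : R := sqrt (1 - k ^ 2).

Lemma compl_modulus_bounds (k : R) : 0 < k < 1 -> 0 < compl_modulus k < 1.
Proof.
  intros Hk. unfold compl_modulus. split; [apply sqrt_lt_R0; nra|].
  apply Rlt_le_trans with (sqrt 1); [apply sqrt_lt_1; nra|rewrite sqrt_1; lra].
Qed.

(** K increases with the modulus while K of the complementary modulus decreases, so their ratio is
    strictly monotone. *)
Lemma modulus_unique (k l : R) : 0 < k < 1 -> 0 < l < 1 ->
  ellipticK (compl_modulus k) / ellipticK k = ellipticK (compl_modulus l) / ellipticK l -> k = l.
Proof.
  assert (W : forall k l, 0 < k < 1 -> 0 < l < 1 -> k < l ->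
    ellipticK (compl_modulus k) / ellipticK k = ellipticK (compl_modulus l) / ellipticK l -> False).
  { intros u v Hu Hv Huv E.
    assert (B1 := compl_modulus_bounds u Hu). assert (B2 := compl_modulus_bounds v Hv).
    assert (L : compl_modulus v < compl_modulus u) by (apply sqrt_lt_1; nra).
    apply ellipticK_incr in L; try lra. assert (L2 := ellipticK_incr u v ltac:(lra) Huv ltac:(lra)).
    assert (P1 := ellipticK_pos u Hu). assert (P2 := ellipticK_pos v Hv).
    assert (P3 := ellipticK_pos _ B2).
    assert (X : ellipticK (compl_modulus u) * ellipticK v = ellipticK (compl_modulus v) * ellipticK u).
    { apply Rmult_eq_reg_r with (/ (ellipticK u * ellipticK v)).
      - transitivity (ellipticK (compl_modulus u) / ellipticK u); [field; lra|].
        rewrite E. field; lra.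
      - apply Rinv_neq_0_compat. nra. }
    nra. }
  intros Hk Hl E. destruct (Rtotal_order k l) as [H|[H|H]]; auto; exfalso; eauto.
Qed.

(* Landen's transformation: the substitution [t = (1 + l) s / (1 + l s^2)]. *)
Lemma landen (l : R) : 0 < l < 1 ->
  ellipticK (2 * sqrt l / (1 + l)) = (1 + l) * ellipticK l.
Proof.
  intros Hl. set (k := 2 * sqrt l / (1 + l)).
  assert (Sq : sqrt l * sqrt l = l) by (apply sqrt_sqrt; lra).
  assert (Sp : 0 < sqrt l) by (apply sqrt_lt_R0; lra).
  assert (S1 : sqrt l < 1) by (rewrite <- sqrt_1; apply sqrt_lt_1; lra).
  assert (Hk : 0 < k < 1).
  { unfold k. split; [apply Rdiv_lt_0_compat; lra|].
    apply Rmult_lt_reg_r with (1 + l); [lra|]. unfold Rdiv. rewrite Rmult_assoc, Rinv_l; nra. }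
  assert (Hk2 : k ^ 2 = 4 * l / (1 + l) ^ 2).
  { unfold k. rewrite <- Sq at 3. field. lra. }
  set (t := fun s => (1 + l) * s / (1 + l * s ^ 2)).
  assert (Dn : forall s, 0 < 1 + l * s ^ 2) by (intros s; assert (H := pow2_ge_0 s); nra).
  (* This factorization shows at once that t s < 1 and that 1 - t s <= 1 - s, so t s tends to 1 with
     s. *)
  assert (T1 : forall s, 1 - t s = (1 - s) * (1 - l * s) / (1 + l * s ^ 2)).
  { intros s. unfold t. field. specialize (Dn s). lra. }
  assert (Ht : forall s, 0 <= s < 1 -> 0 <= t s < 1 /\ 1 - t s <= 1 - s).
  { intros s Hs. specialize (Dn s). assert (N : 0 < 1 - l * s) by nra. repeat split.
    - unfold t. apply Rmult_le_pos; [apply Rmult_le_pos; lra|apply Rlt_le, Rinv_0_lt_compat; lra].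
    - apply Rminus_gt_0_lt. unfold Rgt. rewrite T1. apply Rdiv_lt_0_compat; [|lra].
      apply Rmult_lt_0_compat; lra.
    - rewrite T1. apply Rmult_le_reg_r with (1 + l * s ^ 2); auto.
      unfold Rdiv. rewrite Rmult_assoc, Rinv_l, Rmult_1_r by lra.
      apply Rmult_le_compat_l; [lra|]. assert (0 <= l * s) by nra. assert (0 <= l * s ^ 2) by (simpl; nra). lra. }
  assert (E : forall s, 0 <= s < 1 -> ellipticI (t s) k = (1 + l) * ellipticI s l).
  { intros s Hs.
    assert (X := is_derive_eq (fun s => ellipticI (t s) k) (fun s => (1 + l) * ellipticI s l)
      (fun s => (1 + l) * ellipticI_integrand l s) 0 s (proj1 Hs)).
    cbv beta in X. replace (t 0) with 0 in X by (unfold t; field).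
    rewrite !ellipticI_0 in X.
    assert (0 - (1 + l) * 0 = ellipticI (t s) k - (1 + l) * ellipticI s l); [|lra].
    apply X.
    - intros u Hu. destruct (Ht u ltac:(lra)) as [[Ht0 Ht1] _]. specialize (Dn u).
      set (t' := (1 + l) * (1 - l * u ^ 2) / (1 + l * u ^ 2) ^ 2).
      assert (Dt : is_derive t u t').
      { unfold t, t'. auto_derive; [simpl in Dn |- *; lra|]. field. lra. }
      replace ((1 + l) * ellipticI_integrand l u) with (scal t' (ellipticI_integrand k (t u))).
      + apply (is_derive_comp (fun x => ellipticI x k) t); auto.
        apply is_derive_ellipticI; auto. lra.
      + change (t' * ellipticI_integrand k (t u) = (1 + l) * ellipticI_integrand l u).
        unfold ellipticI_integrand.
        destruct (ellipticI_arg_pos l Hl u ltac:(lra)) as [A1 A2].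
        assert (A := Rmult_lt_0_compat _ _ A1 A2).
        assert (N : 0 < 1 - l * u ^ 2) by nra.
        (* The point of the substitution: the radicand for [k] is the one for [l] times a perfect
           square, whose root cancels against dt/ds up to the constant 1 + l. *)
        replace ((1 - t u ^ 2) * (1 - k ^ 2 * t u ^ 2))
          with (((1 - u ^ 2) * (1 - l ^ 2 * u ^ 2)) * ((1 - l * u ^ 2) / (1 + l * u ^ 2) ^ 2) ^ 2).
        2:{ rewrite Hk2. unfold t. field. lra. }
        assert (N' : 0 < (1 - l * u ^ 2) / (1 + l * u ^ 2) ^ 2)
          by (apply Rdiv_lt_0_compat; [|apply pow_lt]; lra).
        rewrite sqrt_mult by (try apply pow2_ge_0; lra).
        rewrite (sqrt_pow2 ((1 - l * u ^ 2) / _)) by lra.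
        assert (Q := sqrt_lt_R0 _ A). unfold t'. field. repeat split; lra.
    - intros u Hu. apply (is_derive_scal (fun s => ellipticI s l)), is_derive_ellipticI; auto. lra. }
  apply (ellipticK_unique k Hk). intros eps He d Hd.
  destruct (ellipticI_lim l Hl (eps / 2) ltac:(lra)) as [d' [Hd' H]].
  assert (M := Rmin_pos d d' Hd (proj1 Hd')).
  assert (M1 := Rmin_l d d'). assert (M2 := Rmin_r d d').
  set (s := 1 - Rmin d d' / 2). assert (Hs : 0 <= s < 1) by (unfold s; lra).
  destruct (Ht s Hs) as [[Q0 Q1] Q2].
  exists (t s). split; [unfold s in *; lra|].
  rewrite E, (ellipticK_eq l Hl) by auto.
  replace ((1 + l) * ellipticI s l - (1 + l) * ellipticF (PI / 2) l)
    with ((1 + l) * (ellipticI s l - ellipticF (PI / 2) l)) by ring.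
  rewrite Rabs_mult, Rabs_pos_eq by lra.
  assert (H' := H s ltac:(unfold s; lra)). assert (H0 := Rabs_pos (ellipticI s l - ellipticF (PI / 2) l)). nra.
Qed.

(** * Inversion of a blow-up solution by an elliptic integral *)

Section Inversion.

Variables (f f' : R -> R) (p q a E1 E2 E3 : R).
Hypothesis bs : blowup_solution f f' p q a.
Hypothesis HE : E3 < E2 < E1.
Hypothesis Hfa : f a = E1.
Hypothesis Hint : forall x, 0 < x < a -> f' x ^ 2 = 4 * (f x - E1) * (f x - E2) * (f x - E3).

(** The substitution s^2 = (E1 - E3) / (f - E3) brings the cubic to Legendre's form: the pole of f
    goes to s = 0, f = E1 to s = 1 and f = E2 to s = 1 / kap. *)
Let lam : R := sqrt (E1 - E3).
Let kap : R := sqrt ((E2 - E3) / (E1 - E3)).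
Let s (x : R) : R := lam / sqrt (f x - E3).

Lemma inversion_lam : 0 < lam /\ lam ^ 2 = E1 - E3.
Proof. unfold lam. split; [apply sqrt_lt_R0; lra|]. simpl. rewrite Rmult_1_r. apply sqrt_sqrt; lra. Qed.

Lemma inversion_kap : 0 < kap < 1 /\ kap ^ 2 = (E2 - E3) / (E1 - E3).
Proof.
  assert (0 < (E2 - E3) / (E1 - E3) < 1).
  { split; [apply Rdiv_lt_0_compat; lra|]. apply Rmult_lt_reg_r with (E1 - E3); [lra|].
    unfold Rdiv. rewrite Rmult_assoc, Rinv_l; lra. }
  unfold kap. repeat split; [apply sqrt_lt_R0; lra| |].
  - rewrite <- sqrt_1. apply sqrt_lt_1; lra.
  - simpl. rewrite Rmult_1_r. apply sqrt_sqrt; lra.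
Qed.

Lemma inversion_above (x : R) : 0 < x < a -> E1 < f x.
Proof. intros Hx. rewrite <- Hfa. apply (blowup_decr f f' p q a bs); lra. Qed.

Lemma inversion_s_bound (x : R) : 0 < x < a -> 0 < s x < 1.
Proof.
  intros Hx. assert (A := inversion_above x Hx). destruct inversion_lam as [Hl _].
  assert (lam < sqrt (f x - E3)) by (apply sqrt_lt_1; lra).
  unfold s. split; [apply Rdiv_lt_0_compat; lra|].
  apply Rmult_lt_reg_r with (sqrt (f x - E3)); [lra|]. unfold Rdiv. rewrite Rmult_assoc, Rinv_l; lra.
Qed.

Lemma inversion_s_sqr (x : R) : 0 < x < a -> / s x ^ 2 = (f x - E3) / lam ^ 2.
Proof.
  intros Hx. assert (A := inversion_above x Hx). destruct inversion_lam as [Hl _].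
  assert (P := sqrt_lt_R0 (f x - E3) ltac:(lra)).
  assert (S := sqrt_sqrt (f x - E3) ltac:(lra)).
  unfold s. rewrite <- S at 2. field. lra.
Qed.

Lemma inversion_derive (x : R) : 0 < x < a ->
  is_derive (fun x => ellipticI (s x) kap) x lam.
Proof.
  intros Hx. assert (A := inversion_above x Hx). destruct inversion_lam as [Hl Hl2].
  destruct inversion_kap as [Hk Hk2]. assert (Hs := inversion_s_bound x Hx).
  assert (Ha := bs_pos _ _ _ _ _ bs).
  set (r := sqrt (f x - E3)). assert (P : 0 < r) by (apply sqrt_lt_R0; lra).
  assert (S : r * r = f x - E3) by (apply sqrt_sqrt; lra).
  set (AB := (f x - E1) * (f x - E2)).
  assert (HAB : 0 < AB) by (apply Rmult_lt_0_compat; lra).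
  assert (Qp := sqrt_lt_R0 _ HAB). assert (QQ := sqrt_sqrt AB ltac:(lra)).
  (* The first integral determines f' up to sign; the decrease of f selects the negative root. *)
  assert (F' : f' x = - 2 * r * sqrt AB).
  { assert (N := blowup_derive_neg f f' p q a bs x Hx). assert (I := Hint x Hx).
    assert (X : (f' x - 2 * r * sqrt AB) * (f' x + 2 * r * sqrt AB) = 0).
    { transitivity (f' x ^ 2 - 4 * (r * r) * (sqrt AB * sqrt AB)); [ring|].
      rewrite I, S, QQ. unfold AB. ring. }
    apply Rmult_integral in X. assert (0 < r * sqrt AB) by (apply Rmult_lt_0_compat; auto).
    destruct X; lra. }
  assert (D := bs_derive _ _ _ _ _ bs x ltac:(lra)).
  assert (Ds : is_derive s x (- lam * f' x / (2 * r ^ 3))).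
  { unfold s. auto_derive; fold r.
    - repeat split; try lra; [now exists (f' x)|]. replace (f x + - E3) with (f x - E3) by ring.
      fold r; lra.
    - derive_subst D. replace (f x + - E3) with (f x - E3) by ring. fold r. field. lra. }
  assert (Es : s x = lam / r) by reflexivity.
  replace lam with (scal (- lam * f' x / (2 * r ^ 3)) (ellipticI_integrand kap (s x))).
  { apply (is_derive_comp (fun x => ellipticI x kap) s); auto.
    apply is_derive_ellipticI; auto. lra. }
  change (- lam * f' x / (2 * r ^ 3) * ellipticI_integrand kap (s x) = lam).
  unfold ellipticI_integrand.
  replace ((1 - s x ^ 2) * (1 - kap ^ 2 * s x ^ 2)) with (AB * (/ r ^ 2) ^ 2).
  - rewrite sqrt_mult, sqrt_pow2; try apply pow2_ge_0; try lra.
    + rewrite F'. field. lra.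
    + apply Rlt_le, Rinv_0_lt_compat, pow_lt; auto.
  - rewrite Hk2, Es. unfold AB.
    replace (f x - E1) with (r ^ 2 - lam ^ 2) by (rewrite Hl2; simpl; lra).
    replace (f x - E2) with (r ^ 2 - (E2 - E3)) by (simpl; lra).
    rewrite <- Hl2. field. lra.
Qed.

(** The two sides differ by a constant on (0, a), and both tend to 0 with x because the growth of f
    drives s to 0. *)
Lemma inversion (x : R) : 0 < x < a -> ellipticI (s x) kap = lam * x.
Proof.
  intros Hx. destruct inversion_lam as [Hl Hl2]. destruct inversion_kap as [Hk _].
  assert (C : forall y, 0 < y < x -> ellipticI (s y) kap - lam * y = ellipticI (s x) kap - lam * x).
  { intros y Hy. apply (is_derive_eq (fun x => ellipticI (s x) kap) (fun x => lam * x) (fun _ => lam)).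
    - lra.
    - intros; apply inversion_derive; lra.
    - intros t _. auto_derive; auto. ring. }
  destruct (Req_dec (ellipticI (s x) kap) (lam * x)) as [|N]; auto. exfalso.
  set (e := Rabs (ellipticI (s x) kap - lam * x)).
  assert (He : 0 < e) by (apply Rabs_pos_lt; lra).
  assert (Ct := is_derive_continuity_pt _ _ _ (is_derive_ellipticI kap Hk 0 ltac:(lra))).
  destruct (Ct (e / 2) ltac:(lra)) as [d [Hd Hc]].
  (* The point y is chosen so that both quantities are below e/2: the threshold E3 + (lam/d)^2 makes
     s y < d, and y < e / (2 lam) bounds lam y. *)
  destruct (blowup_unbounded f f' p q a bs (Rmin x (e / (2 * lam))) (E3 + (lam / d) ^ 2)) as [y [Hy Hfy]].
  { apply Rmin_pos; [lra|]. apply Rdiv_lt_0_compat; lra. }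
  assert (M1 := Rmin_l x (e / (2 * lam))). assert (M2 := Rmin_r x (e / (2 * lam))).
  assert (Hs := inversion_s_bound y ltac:(lra)).
  assert (Hsd : s y < d).
  { assert (0 < lam / d) by (apply Rdiv_lt_0_compat; lra).
    assert (lam / d < sqrt (f y - E3)).
    { rewrite <- (sqrt_pow2 (lam / d)) by lra. apply sqrt_lt_1; try apply pow2_ge_0; try lra.
      assert (Z := pow2_ge_0 (lam / d)). lra. }
    unfold s. apply Rmult_lt_reg_r with (sqrt (f y - E3)); [lra|].
    unfold Rdiv. rewrite Rmult_assoc, Rinv_l, Rmult_1_r by lra.
    replace lam with (d * (lam / d)) at 1 by (field; lra). apply Rmult_lt_compat_l; lra. }
  specialize (Hc (s y)). simpl in Hc. unfold Rdist in Hc. rewrite ellipticI_0, !Rminus_0_r in Hc.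
  assert (X : Rabs (ellipticI (s y) kap) < e / 2).
  { apply Hc. split; [split; [exact I|lra]|]. rewrite Rabs_pos_eq; lra. }
  assert (Y : lam * y < e / 2).
  { apply Rlt_le_trans with (lam * (e / (2 * lam))); [apply Rmult_lt_compat_l; lra|].
    right. field. lra. }
  assert (Y' : 0 < lam * y) by (apply Rmult_lt_0_compat; lra).
  specialize (C y ltac:(lra)). unfold e in *. rewrite <- C in X, Y.
  revert X Y. unfold Rabs. repeat destruct Rcase_abs; lra.
Qed.

(** As x tends to a, f tends to E1 and s to 1, while [inversion] gives the value lam x, which tends
    to lam a. *)
Lemma inversion_ellipticK : ellipticK kap = lam * a.
Proof.
  destruct inversion_lam as [Hl Hl2]. destruct inversion_kap as [Hk _].
  assert (Ha := bs_pos _ _ _ _ _ bs).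
  apply ellipticK_unique; auto. intros eps He d Hd.
  assert (Cs : continuity_pt s a).
  { assert (D := bs_derive _ _ _ _ _ bs a ltac:(lra)).
    assert (ex_derive s a).
    { unfold s. auto_derive. replace (f a + - E3) with (E1 - E3) by lra. fold lam.
      repeat split; try lra. now exists (f' a). }
    destruct H as [l Hl']. eapply is_derive_continuity_pt; eauto. }
  assert (Sa : s a = 1). { unfold s. rewrite Hfa. fold lam. field. lra. }
  destruct (Cs d Hd) as [e [He' Hc]].
  set (h := Rmin (a / 2) (Rmin (e / 2) (eps / (2 * lam)))).
  assert (Q : 0 < eps / (2 * lam)) by (apply Rdiv_lt_0_compat; lra).
  assert (H1 : h <= a / 2) by apply Rmin_l.
  assert (H2 : h <= e / 2) by (eapply Rle_trans; [apply Rmin_r|apply Rmin_l]).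
  assert (H3 : h <= eps / (2 * lam)) by (eapply Rle_trans; [apply Rmin_r|apply Rmin_r]).
  assert (H0 : 0 < h) by (repeat apply Rmin_pos; lra).
  assert (Hs := inversion_s_bound (a - h) ltac:(lra)).
  exists (s (a - h)). split.
  - split; [|lra]. specialize (Hc (a - h)). simpl in Hc. unfold Rdist in Hc. rewrite Sa in Hc.
    assert (X : Rabs (s (a - h) - 1) < d).
    { apply Hc. split; [split; [exact I|lra]|]. replace (a - h - a) with (- h) by ring.
      rewrite Rabs_Ropp, Rabs_pos_eq; lra. }
    apply Rabs_lt_between in X. lra.
  - rewrite inversion by lra. replace (lam * (a - h) - lam * a) with (- (lam * h)) by ring.
    rewrite Rabs_Ropp, Rabs_pos_eq by nra.
    apply Rle_lt_trans with (lam * (eps / (2 * lam))); [apply Rmult_le_compat_l; lra|].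
    replace (lam * (eps / (2 * lam))) with (eps / 2) by (field; lra). lra.
Qed.

Lemma inversion_ns (x : R) : 0 < x < a -> jacobi_ns (lam * x) kap ^ 2 = (f x - E3) / lam ^ 2.
Proof.
  intros Hx. assert (Hs := inversion_s_bound x Hx). destruct inversion_kap as [Hk _].
  rewrite <- inversion_s_sqr by auto. unfold jacobi_ns, jacobi_sn.
  rewrite <- (inversion x Hx), ellipticI_asin, jacobi_am_ellipticF, sin_asin by lra.
  field. lra.
Qed.

(** The Laurent expansion is demanded on both sides of 0; oddness of [ellipticF] supplies the left
    one. *)
Lemma inversion_ns_opp (x : R) : 0 < x < a -> jacobi_ns (- (lam * x)) kap ^ 2 = (f x - E3) / lam ^ 2.
Proof.
  intros Hx. assert (Hs := inversion_s_bound x Hx). destruct inversion_kap as [Hk _].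
  rewrite <- inversion_s_sqr by auto. unfold jacobi_ns, jacobi_sn.
  rewrite <- (inversion x Hx), ellipticI_asin, <- ellipticF_opp, jacobi_am_ellipticF, sin_neg, sin_asin by lra.
  field. lra.
Qed.

End Inversion.

(** * Lambert series with exponential weights; the cosine as a series in the square *)

Lemma ex_series_lambert_exp (Q E : R) (p : nat) :
  0 < Q < 1 -> 1 <= E -> Q * E < 1 -> ex_series (fun n => INR n ^ p * lambert Q n * E ^ n).
Proof.
  intros HQ HE HQE.
  assert (HE' : 0 < / E <= 1).
  { split; [apply Rinv_0_lt_compat; lra|]. rewrite <- Rinv_1. apply Rinv_le_contravar; lra. }
  assert (Hr : Q < / E). { apply Rmult_lt_reg_r with E; [lra|]. rewrite Rinv_l; lra. }
  destruct (lambert_geom_bound Q ((Q + / E) / 2) p) as [C [HC B]]; try lra.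
  apply ex_series_dom with (fun n => C * ((Q + / E) / 2 * E) ^ n).
  - intros n. assert (P := pow_le E n ltac:(lra)). rewrite Rabs_pos_eq.
    + rewrite Rpow_mult_distr, <- Rmult_assoc. apply Rmult_le_compat_r; auto.
    + apply Rmult_le_pos; auto. apply Rmult_le_pos; [apply pow_le, pos_INR|apply lambert_bound; auto].
  - apply ex_series_scal_geom. split; [apply Rmult_le_pos; lra|].
    replace ((Q + / E) / 2 * E) with ((Q * E + 1) / 2) by (field; lra). lra.
Qed.

Lemma is_series_cos (x : R) : is_series (fun i => cos_n i * (x ^ 2) ^ i) (cos x).
Proof.
  unfold cos. destruct (exist_cos (Rsqr x)) as [l Hl]. apply is_series_Reals.
  unfold cos_in in Hl. replace (x ^ 2) with (Rsqr x) by (unfold Rsqr; ring). exact Hl.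
Qed.

(** The value is cos x at v = x^2 and cosh x at v = - x^2, so that the Fourier parts of W and V
    become one function of v. *)
Definition cos_pseries : R -> R := PSeries cos_n.

Lemma cos_pseries_radius (v : R) : Rbar_lt (Rabs v) (CV_radius cos_n).
Proof.
  assert (P := Rabs_pos v).
  apply Rbar_lt_le_trans with (Rabs (sqrt (Rabs v + 1) ^ 2)).
  - rewrite pow2_sqrt by lra. simpl. rewrite (Rabs_pos_eq (_ + _)); lra.
  - apply CV_radius_ge. exists (cos (sqrt (Rabs v + 1))). apply is_series_cos.
Qed.

Lemma cos_pseries_sqr (x : R) : cos_pseries (x ^ 2) = cos x.
Proof. apply is_series_unique, is_series_cos. Qed.

Lemma cos_pseries_opp_sqr (x : R) : cos_pseries (- x ^ 2) = cosh x.
Proof.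
  assert (E1 := CV_radius_inside _ _ (cos_pseries_radius (- x ^ 2))).
  apply PSeries_correct in E1. fold (cos_pseries (- x ^ 2)) in E1. apply is_pseries_R in E1.
  set (l := cos_pseries (- x ^ 2)) in *.
  assert (He : is_pseries (fun n => / INR (fact (2 * n))) (x ^ 2) l).
  { apply is_pseries_R. refine (is_series_ext _ _ _ _ E1). intros n. eq_R. unfold cos_n.
    replace (- x ^ 2) with ((-1) * x ^ 2) by ring. rewrite Rpow_mult_distr.
    transitivity (((-1) ^ n * (-1) ^ n) * (/ INR (fact (2 * n)) * (x ^ 2) ^ n)).
    { field. apply INR_fact_neq_0. }
    rewrite <- Rpow_mult_distr. replace (-1 * -1) with 1 by ring. rewrite pow1. apply Rmult_1_l. }
  (* the even part of the exponential series is its sum at [x] and [-x] *)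
  assert (S : is_series (fun n => (/ INR (fact n) * x ^ n + / INR (fact n) * (- x) ^ n) * / 2) (cosh x)).
  { assert (X1 := proj1 (is_pseries_R _ _ _) (is_exp_Reals x)).
    assert (X2 := proj1 (is_pseries_R _ _ _) (is_exp_Reals (- x))).
    exact (is_series_scal_r (/ 2) _ _ (is_series_plus _ _ _ _ X1 X2)). }
  set (b := fun n => if Nat.even n then / INR (fact n) else 0).
  assert (S' : is_pseries b x (cosh x)).
  { apply is_pseries_R. refine (is_series_ext _ _ _ _ S). intros n.
    change ((/ INR (fact n) * x ^ n + / INR (fact n) * (- x) ^ n) * / 2 = b n * x ^ n).
    replace (- x) with ((-1) * x) by ring. rewrite Rpow_mult_distr. unfold b.
    destruct (Nat.Even_or_Odd n) as [[m ->]|[m ->]].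
    - rewrite Nat.even_even, pow_1_even. field. apply INR_fact_neq_0.
    - rewrite Nat.even_odd, Nat.add_1_r, pow_1_odd. ring. }
  assert (T : is_pseries b x (l + x * 0)).
  { apply is_pseries_odd_even.
    - apply is_pseries_ext with (2 := He). intros n. unfold b. now rewrite Nat.even_even.
    - apply is_pseries_R. apply is_series_ext with (fun n => 0 * 0 ^ n).
      + intros n. unfold b. rewrite Nat.even_odd. ring_R.
      + assert (X := is_series_scal_l 0 _ _ (is_series_geom 0 ltac:(rewrite Rabs_R0; lra))).
        change (is_series (fun n => 0 * 0 ^ n) (0 * / (1 - 0))) in X.
        rewrite Rmult_0_l in X. exact X. }
  apply is_pseries_unique in T. apply is_pseries_unique in S'. lra.
Qed.

Lemma pow_fact_le_exp (x : R) (n : nat) : 0 <= x -> x ^ n / INR (fact n) <= exp x.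
Proof.
  intros Hx. assert (E := proj1 (is_pseries_R _ _ _) (is_exp_Reals x)).
  rewrite <- (is_series_unique _ _ E). unfold Rdiv. rewrite Rmult_comm.
  apply (term_le_Series (fun n => / INR (fact n) * x ^ n)).
  - intros k. apply Rmult_le_pos; [apply Rlt_le, Rinv_0_lt_compat, INR_fact_lt_0|apply pow_le; auto].
  - now exists (exp x).
Qed.

Section Weierstrass.

Variable y0 : R.
Hypothesis Hy0 : 0 < y0.

Definition nome2 : R := exp (- (4 * y0)).
Notation Q := nome2.
Notation b := (lambert nome2).

Lemma nome2_bounds : 0 < Q < 1.
Proof.
  unfold nome2. split; [apply exp_pos|]. rewrite <- exp_0. apply exp_increasing. lra.
Qed.

Lemma exp_mult_INR (y : R) (n : nat) : exp (y * INR n) = exp y ^ n.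
Proof.
  rewrite <- Rpower_pow by apply exp_pos. unfold Rpower. rewrite ln_exp. f_equal; ring.
Qed.

(** The range of y reaches up to the next pole: Q exp (2 y) < 1 means y < 2 y0. *)
Lemma ex_series_lambert_exp_lt (p : nat) (y : R) : 0 <= y < 2 * y0 ->
  ex_series (fun n => INR n ^ p * b n * exp (2 * y * INR n)).
Proof.
  intros Hy. apply ex_series_ext with (fun n => INR n ^ p * b n * exp (2 * y) ^ n).
  { intros n. rewrite exp_mult_INR. reflexivity. }
  apply ex_series_lambert_exp; [apply nome2_bounds| |].
  - rewrite <- exp_0. destruct (Req_dec y 0) as [->|]; [rewrite Rmult_0_r; lra|].
    apply Rlt_le, exp_increasing; lra.
  - unfold nome2. rewrite <- exp_plus, <- exp_0. apply exp_increasing. lra.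
Qed.

Lemma lambert_pos (n : nat) : 0 <= b n.
Proof. apply lambert_bound, nome2_bounds. Qed.

Lemma ex_series_lambert_bounded (p : nat) (c : nat -> R) (M y : R) : 0 <= y < 2 * y0 ->
  (forall n, Rabs (c n) <= M * exp (2 * y * INR n)) ->
  ex_series (fun n => INR n ^ p * b n * c n).
Proof.
  intros Hy Hc.
  apply ex_series_dom with (fun n => M * (INR n ^ p * b n * exp (2 * y * INR n))).
  - intros n. assert (0 <= INR n ^ p * b n)
      by (apply Rmult_le_pos; [apply pow_le, pos_INR|apply lambert_pos]).
    rewrite Rabs_mult, Rabs_pos_eq by auto.
    replace (M * (INR n ^ p * b n * exp (2 * y * INR n)))
      with (INR n ^ p * b n * (M * exp (2 * y * INR n))) by ring.
    apply Rmult_le_compat_l; auto.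
  - apply ex_series_Rscal, ex_series_lambert_exp_lt; auto.
Qed.

(** * The Weierstrass function on the two axes *)

Definition cos_sum (x : R) : R := Series (fun n => b n * cos (2 * INR n * x)).
Definition cos_sum' (x : R) : R := Series (fun n => b n * (- (2 * INR n) * sin (2 * INR n * x))).
Definition cos_sum'' (x : R) : R := Series (fun n => b n * (- (2 * INR n) ^ 2 * cos (2 * INR n * x))).
Definition cosh_sum (x : R) : R := Series (fun n => b n * cosh (2 * INR n * x)).
Definition cosh_sum' (x : R) : R := Series (fun n => b n * (2 * INR n * sinh (2 * INR n * x))).
Definition cosh_sum'' (x : R) : R := Series (fun n => b n * ((2 * INR n) ^ 2 * cosh (2 * INR n * x))).

Lemma ex_series_lambert_cos (p : nat) (x : R) :
  ex_series (fun n => INR n ^ p * b n * cos (2 * INR n * x)) /\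
  ex_series (fun n => INR n ^ p * b n * sin (2 * INR n * x)).
Proof.
  split; apply ex_series_lambert_bounded with 1 0; try lra; intros n;
    rewrite Rmult_0_r, Rmult_0_l, exp_0, Rmult_1_r; apply Rabs_le;
    [apply COS_bound|apply SIN_bound].
Qed.

Lemma is_derive_cos_sum (x : R) : is_derive cos_sum x (cos_sum' x).
Proof.
  apply (is_derive_Series (fun n x => b n * cos (2 * INR n * x))
    (fun n x => b n * (- (2 * INR n) * sin (2 * INR n * x)))
    (fun n x => b n * (- (2 * INR n) ^ 2 * cos (2 * INR n * x)))
    (fun n => 4 * (INR n ^ 2 * b n)) x 1); try lra.
  - intros n t _. auto_derive; auto. ring.
  - intros n t _. auto_derive; auto. ring.
  - intros n t _. rewrite !Rabs_mult, Rabs_Ropp, (Rabs_pos_eq (b n)), (Rabs_pos_eq (_ ^ _))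
      by (try apply pow2_ge_0; apply lambert_pos).
    replace (4 * (INR n ^ 2 * b n)) with (b n * ((2 * INR n) ^ 2 * 1)) by ring.
    apply Rmult_le_compat_l; [apply lambert_pos|]. apply Rmult_le_compat_l; [apply pow2_ge_0|].
    apply Rabs_le, COS_bound.
  - apply ex_series_Rscal, ex_series_lambert, nome2_bounds.
  - intros t _. refine (ex_series_ext _ _ _ (proj1 (ex_series_lambert_cos 0 t))). intros n; simpl; ring_R.
  - refine (ex_series_ext _ _ _ (ex_series_Rscal (-2) _ (proj2 (ex_series_lambert_cos 1 x)))).
    intros n. change (-2 * (INR n ^ 1 * b n * sin (2 * INR n * x)) = b n * (- (2 * INR n) * sin (2 * INR n * x))). ring.
Qed.

Lemma is_derive_cos_sum' (x : R) : is_derive cos_sum' x (cos_sum'' x).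
Proof.
  apply (is_derive_Series (fun n x => b n * (- (2 * INR n) * sin (2 * INR n * x)))
    (fun n x => b n * (- (2 * INR n) ^ 2 * cos (2 * INR n * x)))
    (fun n x => b n * ((2 * INR n) ^ 3 * sin (2 * INR n * x)))
    (fun n => 8 * (INR n ^ 3 * b n)) x 1); try lra.
  - intros n t _. auto_derive; auto. ring.
  - intros n t _. auto_derive; auto. ring.
  - intros n t _. assert (P := pos_INR n).
    rewrite !Rabs_mult, (Rabs_pos_eq (b n)), (Rabs_pos_eq (_ ^ _))
      by (try apply pow_le; try lra; apply lambert_pos).
    replace (8 * (INR n ^ 3 * b n)) with (b n * ((2 * INR n) ^ 3 * 1)) by ring.
    apply Rmult_le_compat_l; [apply lambert_pos|]. apply Rmult_le_compat_l; [apply pow_le; lra|].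
    apply Rabs_le, SIN_bound.
  - apply ex_series_Rscal, ex_series_lambert, nome2_bounds.
  - intros t _. refine (ex_series_ext _ _ _ (ex_series_Rscal (-2) _ (proj2 (ex_series_lambert_cos 1 t)))).
    intros n. change (-2 * (INR n ^ 1 * b n * sin (2 * INR n * t)) = b n * (- (2 * INR n) * sin (2 * INR n * t))). ring.
  - refine (ex_series_ext _ _ _ (ex_series_Rscal (-4) _ (proj1 (ex_series_lambert_cos 2 x)))).
    intros n. change (-4 * (INR n ^ 2 * b n * cos (2 * INR n * x)) = b n * (- (2 * INR n) ^ 2 * cos (2 * INR n * x))). ring.
Qed.

Lemma hyperbolic_bound (t y : R) (n : nat) : Rabs t <= y ->
  0 <= cosh (2 * INR n * t) <= exp (2 * y * INR n) /\
  Rabs (sinh (2 * INR n * t)) <= exp (2 * y * INR n).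
Proof.
  intros Ht. assert (P := pos_INR n).
  assert (M : forall u v, u <= v -> exp u <= exp v).
  { intros u v [H| ->]; [apply Rlt_le, exp_increasing; auto|lra]. }
  apply Rabs_le_between in Ht.
  assert (H1 : exp (2 * INR n * t) <= exp (2 * y * INR n)) by (apply M; nra).
  assert (H2 : exp (- (2 * INR n * t)) <= exp (2 * y * INR n)) by (apply M; nra).
  assert (P1 := exp_pos (2 * INR n * t)). assert (P2 := exp_pos (- (2 * INR n * t))).
  unfold cosh, sinh. repeat split; try lra. apply Rabs_le. lra.
Qed.

Lemma ex_series_lambert_cosh (p : nat) (x : R) : Rabs x < 2 * y0 ->
  ex_series (fun n => INR n ^ p * b n * cosh (2 * INR n * x)) /\
  ex_series (fun n => INR n ^ p * b n * sinh (2 * INR n * x)).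
Proof.
  intros Hx. assert (Px := Rabs_pos x).
  split; apply ex_series_lambert_bounded with 1 (Rabs x); try lra; intros n;
    destruct (hyperbolic_bound x (Rabs x) n) as [H1 H2]; try lra; rewrite Rmult_1_l; auto.
  rewrite Rabs_pos_eq; lra.
Qed.

Lemma cosh_sinh_derive (a x : R) :
  is_derive (fun t => cosh (a * t)) x (a * sinh (a * x)) /\
  is_derive (fun t => sinh (a * t)) x (a * cosh (a * x)).
Proof. unfold cosh, sinh. split; auto_derive; auto; field. Qed.

Lemma near_lt (x t y : R) : Rabs x < y -> Rabs (t - x) < (y - Rabs x) / 2 -> Rabs t <= (y + Rabs x) / 2.
Proof. unfold Rabs. repeat destruct Rcase_abs; lra. Qed.

Lemma is_derive_cosh_sum (x : R) : Rabs x < 2 * y0 -> is_derive cosh_sum x (cosh_sum' x).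
Proof.
  (* The midpoint between |x| and 2 y0 bounds |t| for all t near x and still lies in the range of
     convergence. *)
  intros Hx. set (y := (2 * y0 + Rabs x) / 2).
  assert (Px := Rabs_pos x).
  assert (N : forall t, Rabs (t - x) < (2 * y0 - Rabs x) / 2 -> Rabs t <= y) by (intros t; apply near_lt; auto).
  apply (is_derive_Series (fun n x => b n * cosh (2 * INR n * x))
    (fun n x => b n * (2 * INR n * sinh (2 * INR n * x)))
    (fun n x => b n * ((2 * INR n) ^ 2 * cosh (2 * INR n * x)))
    (fun n => 4 * (INR n ^ 2 * b n * exp (2 * y * INR n))) x ((2 * y0 - Rabs x) / 2)); try lra.
  - intros n t _. destruct (cosh_sinh_derive (2 * INR n) t) as [D1 D2].
    apply (is_derive_scal (fun t => cosh (2 * INR n * t))); auto.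
  - intros n t _. destruct (cosh_sinh_derive (2 * INR n) t) as [D1 D2].
    apply (is_derive_scal (fun t => 2 * INR n * sinh (2 * INR n * t))).
    replace ((2 * INR n) ^ 2 * cosh (2 * INR n * t)) with (2 * INR n * (2 * INR n * cosh (2 * INR n * t))) by ring.
    apply (is_derive_scal (fun t => sinh (2 * INR n * t))); auto.
  - intros n t Ht. destruct (hyperbolic_bound t y n (N t Ht)) as [H1 _].
    rewrite !Rabs_mult, (Rabs_pos_eq (b n)), (Rabs_pos_eq (_ ^ _)), (Rabs_pos_eq (cosh _))
      by (try apply pow2_ge_0; try lra; apply lambert_pos).
    replace (4 * (INR n ^ 2 * b n * exp (2 * y * INR n)))
      with (b n * ((2 * INR n) ^ 2 * exp (2 * y * INR n))) by ring.
    apply Rmult_le_compat_l; [apply lambert_pos|]. apply Rmult_le_compat_l; [apply pow2_ge_0|lra].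
  - apply ex_series_Rscal, ex_series_lambert_exp_lt. unfold y; lra.
  - intros t Ht. specialize (N t Ht).
    refine (ex_series_ext _ _ _ (proj1 (ex_series_lambert_cosh 0 t _))).
    + intros n; simpl; ring_R.
    + unfold y in N; lra.
  - refine (ex_series_ext _ _ _ (ex_series_Rscal 2 _ (proj2 (ex_series_lambert_cosh 1 x Hx)))).
    intros n. change (2 * (INR n ^ 1 * b n * sinh (2 * INR n * x)) = b n * (2 * INR n * sinh (2 * INR n * x))). ring.
Qed.

Lemma is_derive_cosh_sum' (x : R) : Rabs x < 2 * y0 -> is_derive cosh_sum' x (cosh_sum'' x).
Proof.
  intros Hx. set (y := (2 * y0 + Rabs x) / 2).
  assert (Px := Rabs_pos x).
  assert (N : forall t, Rabs (t - x) < (2 * y0 - Rabs x) / 2 -> Rabs t <= y) by (intros t; apply near_lt; auto).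
  apply (is_derive_Series
    (fun n x => b n * (2 * INR n * sinh (2 * INR n * x)))
    (fun n x => b n * ((2 * INR n) ^ 2 * cosh (2 * INR n * x)))
    (fun n x => b n * ((2 * INR n) ^ 3 * sinh (2 * INR n * x)))
    (fun n => 8 * (INR n ^ 3 * b n * exp (2 * y * INR n))) x ((2 * y0 - Rabs x) / 2)); try lra.
  - intros n t _. destruct (cosh_sinh_derive (2 * INR n) t) as [D1 D2].
    apply (is_derive_scal (fun t => 2 * INR n * sinh (2 * INR n * t))).
    replace ((2 * INR n) ^ 2 * cosh (2 * INR n * t)) with (2 * INR n * (2 * INR n * cosh (2 * INR n * t))) by ring.
    apply (is_derive_scal (fun t => sinh (2 * INR n * t))); auto.
  - intros n t _. destruct (cosh_sinh_derive (2 * INR n) t) as [D1 D2].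
    apply (is_derive_scal (fun t => (2 * INR n) ^ 2 * cosh (2 * INR n * t))).
    replace ((2 * INR n) ^ 3 * sinh (2 * INR n * t)) with ((2 * INR n) ^ 2 * (2 * INR n * sinh (2 * INR n * t))) by ring.
    apply (is_derive_scal (fun t => cosh (2 * INR n * t))); auto.
  - intros n t Ht. destruct (hyperbolic_bound t y n (N t Ht)) as [_ H1].
    assert (P := pos_INR n).
    rewrite !Rabs_mult, (Rabs_pos_eq (b n)), (Rabs_pos_eq (_ ^ _))
      by (try apply pow_le; try lra; apply lambert_pos).
    replace (8 * (INR n ^ 3 * b n * exp (2 * y * INR n)))
      with (b n * ((2 * INR n) ^ 3 * exp (2 * y * INR n))) by ring.
    apply Rmult_le_compat_l; [apply lambert_pos|]. apply Rmult_le_compat_l; [apply pow_le; lra|lra].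
  - apply ex_series_Rscal, ex_series_lambert_exp_lt. unfold y; lra.
  - intros t Ht. specialize (N t Ht).
    refine (ex_series_ext _ _ _ (ex_series_Rscal 2 _ (proj2 (ex_series_lambert_cosh 1 t _)))).
    + intros n. change (2 * (INR n ^ 1 * b n * sinh (2 * INR n * t)) = b n * (2 * INR n * sinh (2 * INR n * t))). ring.
    + unfold y in N; lra.
  - refine (ex_series_ext _ _ _ (ex_series_Rscal 4 _ (proj1 (ex_series_lambert_cosh 2 x Hx)))).
    intros n. change (4 * (INR n ^ 2 * b n * cosh (2 * INR n * x)) = b n * ((2 * INR n) ^ 2 * cosh (2 * INR n * x))). ring.
Qed.

(** The constants of [lambert_trig_ode]. Shifting W by mu / 12 would remove the linear term of the
    equation and give Weierstrass's own normalization. *)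
Definition wp_mu : R := 4 - 96 * Series b.
Definition wp_beta : R := 192 * (Series (fun n => INR n * b n) + corr_coef nome2 0).

(* [wp_re] and [wp_im] are the functions W and V of the introduction, with derivatives [wp_re']
   and [wp_im']. *)
Definition wp_re (x : R) : R := / sin x ^ 2 - 8 * cos_sum x.
Definition wp_re' (x : R) : R := - 2 * cos x / sin x ^ 3 - 8 * cos_sum' x.
Definition wp_im (y : R) : R := / sinh y ^ 2 + 8 * cosh_sum y.
Definition wp_im' (y : R) : R := - 2 * cosh y / sinh y ^ 3 + 8 * cosh_sum' y.

Lemma cosh_sinh_sqr (x : R) : cosh x * cosh x - sinh x * sinh x = 1.
Proof.
  unfold cosh, sinh. rewrite exp_Ropp. field. assert (X := exp_pos x); lra.
Qed.

Lemma cosh_abs (x : R) : cosh (Rabs x) = cosh x.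
Proof.
  unfold Rabs. destruct Rcase_abs; auto. unfold cosh. rewrite Ropp_involutive. field.
Qed.

Lemma wp_re_derive (x : R) : 0 < x < PI -> is_derive wp_re x (wp_re' x).
Proof.
  intros Hx. assert (S := sin_gt_0 x (proj1 Hx) (proj2 Hx)).
  assert (D := is_derive_cos_sum x). unfold wp_re, wp_re'. auto_derive.
  - repeat split; [nra|now exists (cos_sum' x)].
  - derive_subst D. field. lra.
Qed.

Lemma wp_im_derive (x : R) : 0 < x < 2 * y0 -> is_derive wp_im x (wp_im' x).
Proof.
  intros Hx. assert (S := sinh_lt 0 x (proj1 Hx)). rewrite sinh_0 in S.
  assert (D := is_derive_cosh_sum x ltac:(rewrite Rabs_pos_eq; lra)).
  unfold wp_im, wp_im'. auto_derive.
  - repeat split; try (eexists; eassumption); nra.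
  - derive_subst D. field. lra.
Qed.

Lemma wp_re_derive2 (x : R) : 0 < x < PI ->
  is_derive wp_re' x (6 * wp_re x ^ 2 + - wp_mu * wp_re x + - wp_beta).
Proof.
  intros Hx. assert (S := sin_gt_0 x (proj1 Hx) (proj2 Hx)).
  assert (HQ := nome2_bounds).
  assert (D := is_derive_cos_sum' x).
  assert (T := sin2_cos2 x). unfold Rsqr in T.
  assert (A := lambert_trig_ode nome2 1 (fun n => cos (2 * INR n * x)) HQ ltac:(lra) ltac:(lra)).
  cbv beta zeta in A.
  specialize (A ltac:(intros n; rewrite pow1; apply Rabs_le, COS_bound)).
  specialize (A ltac:(rewrite Rmult_0_r, Rmult_0_l; apply cos_0)).
  assert (HM : forall m n : nat, 2 * cos (2 * INR m * x) * cos (2 * INR n * x) =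
     cos (2 * INR (m + n) * x) + cos (2 * INR (absdiff m n) * x)).
  { intros m n. assert (E : cos (2 * INR (absdiff m n) * x) = cos (2 * INR m * x - 2 * INR n * x)).
    { unfold absdiff. destruct (Nat.le_ge_cases m n) as [h|h].
      - replace (m - n + (n - m))%nat with (n - m)%nat by lia. rewrite minus_INR by auto.
        rewrite <- cos_neg. f_equal. ring.
      - replace (m - n + (n - m))%nat with (m - n)%nat by lia. rewrite minus_INR by auto.
        f_equal. ring. }
    rewrite E, plus_INR, cos_minus.
    replace (2 * (INR m + INR n) * x) with (2 * INR m * x + 2 * INR n * x) by ring.
    rewrite cos_plus. ring. }
  specialize (A HM (/ sin x ^ 2)).
  assert (HG : / sin x ^ 2 * (1 - cos (2 * INR 1 * x)) = 2).
  { change (INR 1) with 1. rewrite Rmult_1_r, cos_2a. replace (cos x * cos x) with (1 - sin x * sin x) by lra.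
    field. lra. }
  specialize (A HG). fold (cos_sum x) in A.
  fold wp_mu wp_beta (wp_re x) in A.
  replace (6 * wp_re x ^ 2 + - wp_mu * wp_re x + - wp_beta)
    with (6 * (/ sin x ^ 2) ^ 2 - 4 * / sin x ^ 2 - 8 * cos_sum'' x).
  2:{ replace (cos_sum'' x) with (-4 * Series (fun n => INR n ^ 2 * b n * cos (2 * INR n * x))).
      - unfold wp_beta in *. lra.
      - unfold cos_sum''. rewrite <- Series_scal_l. apply Series_ext. intros n. ring. }
  unfold wp_re'. auto_derive.
  - repeat split; [apply Rgt_not_eq; repeat apply Rmult_lt_0_compat; lra|now exists (cos_sum'' x)].
  - derive_subst D.
    assert (E : (2 * sin x ^ 4 + 6 * cos x * cos x * sin x ^ 2) / sin x ^ 6 = 6 * (/ sin x ^ 2) ^ 2 - 4 * / sin x ^ 2).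
    { replace (6 * cos x * cos x) with (6 * (1 - sin x * sin x)) by lra. field. lra. }
    rewrite <- E. field. lra.
Qed.

(** This is [lambert_trig_ode] with E = exp (2 x), g = - 1 / sinh^2 x and U = - V. The square is
    insensitive to the sign of U, the linear term is not, hence the opposite sign of mu. *)
Lemma wp_im_derive2 (x : R) : 0 < x < 2 * y0 ->
  is_derive wp_im' x (6 * wp_im x ^ 2 + wp_mu * wp_im x + - wp_beta).
Proof.
  intros Hx. assert (S := sinh_lt 0 x (proj1 Hx)). rewrite sinh_0 in S.
  assert (HQ := nome2_bounds).
  assert (D := is_derive_cosh_sum' x ltac:(rewrite Rabs_pos_eq; lra)).
  assert (T := cosh_sinh_sqr x).
  assert (A := lambert_trig_ode nome2 (exp (2 * x)) (fun n => cosh (2 * INR n * x)) HQ).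
  cbv beta zeta in A.
  specialize (A ltac:(rewrite <- exp_0; apply Rlt_le, exp_increasing; lra)).
  specialize (A ltac:(unfold nome2; rewrite <- exp_plus, <- exp_0; apply exp_increasing; lra)).
  assert (HB : forall n : nat, Rabs (cosh (2 * INR n * x)) <= exp (2 * x) ^ n).
  { intros n. rewrite <- exp_mult_INR.
    destruct (hyperbolic_bound x x n ltac:(rewrite Rabs_pos_eq; lra)) as [H _].
    rewrite Rabs_pos_eq; lra. }
  specialize (A HB).
  specialize (A ltac:(rewrite Rmult_0_r, Rmult_0_l; apply cosh_0)).
  assert (HM : forall m n : nat, 2 * cosh (2 * INR m * x) * cosh (2 * INR n * x) =
     cosh (2 * INR (m + n) * x) + cosh (2 * INR (absdiff m n) * x)).
  { intros m n. assert (E : cosh (2 * INR (absdiff m n) * x) = cosh (2 * INR m * x - 2 * INR n * x)).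
    { rewrite <- (cosh_abs (2 * INR m * x - 2 * INR n * x)), <- (cosh_abs (2 * INR (absdiff m n) * x)).
      f_equal. unfold absdiff. destruct (Nat.le_ge_cases m n) as [h|h].
      - replace (m - n + (n - m))%nat with (n - m)%nat by lia. rewrite minus_INR by auto.
        rewrite <- Rabs_Ropp. f_equal. ring.
      - replace (m - n + (n - m))%nat with (m - n)%nat by lia. rewrite minus_INR by auto.
        f_equal. ring. }
    rewrite E, plus_INR.
    replace (2 * (INR m + INR n) * x) with (2 * INR m * x + 2 * INR n * x) by ring.
    unfold cosh.
    replace (- (2 * INR m * x + 2 * INR n * x)) with (- (2 * INR m * x) + - (2 * INR n * x)) by ring.
    replace (- (2 * INR m * x - 2 * INR n * x)) with (- (2 * INR m * x) + 2 * INR n * x) by ring.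
    unfold Rminus. rewrite !exp_plus. field. }
  specialize (A HM (- / sinh x ^ 2)).
  assert (HG : - / sinh x ^ 2 * (1 - cosh (2 * INR 1 * x)) = 2).
  { change (INR 1) with 1. rewrite Rmult_1_r.
    replace (cosh (2 * x)) with (1 + 2 * sinh x * sinh x).
    - field. lra.
    - unfold cosh, sinh. replace (- (2 * x)) with (- x + - x) by ring.
      replace (2 * x) with (x + x) by ring. rewrite !exp_plus, exp_Ropp.
      field. assert (X := exp_pos x); lra. }
  specialize (A HG). fold (cosh_sum x) in A.
  replace (- / sinh x ^ 2 - 8 * cosh_sum x) with (- wp_im x) in A by (unfold wp_im; ring).
  fold wp_mu wp_beta in A.
  replace (6 * wp_im x ^ 2 + wp_mu * wp_im x + - wp_beta)
    with (6 * (/ sinh x ^ 2) ^ 2 + 4 * / sinh x ^ 2 + 8 * cosh_sum'' x).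
  2:{ replace (cosh_sum'' x) with (4 * Series (fun n => INR n ^ 2 * b n * cosh (2 * INR n * x))).
      - unfold wp_beta in *. lra.
      - unfold cosh_sum''. rewrite <- Series_scal_l. apply Series_ext. intros n. ring. }
  unfold wp_im'. auto_derive.
  - repeat split; [apply Rgt_not_eq, (pow_lt (sinh x) 3); auto|now exists (cosh_sum'' x)].
  - derive_subst D.
    assert (E : (- 2 * sinh x ^ 4 + 6 * cosh x * cosh x * sinh x ^ 2) / sinh x ^ 6 = 6 * (/ sinh x ^ 2) ^ 2 + 4 * / sinh x ^ 2).
    { replace (6 * cosh x * cosh x) with (6 * (1 + sinh x * sinh x)) by lra. field. lra. }
    rewrite <- E. field. lra.
Qed.

Lemma wp_re_sym (x : R) : wp_re (2 * (PI / 2) - x) = wp_re x.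
Proof.
  replace (2 * (PI / 2) - x) with (PI - x) by field. unfold wp_re. rewrite sin_PI_x.
  f_equal. f_equal. unfold cos_sum. apply Series_ext. intros n. f_equal.
  replace (2 * INR n * (PI - x)) with (- (2 * INR n * x) + 2 * INR n * PI) by ring.
  rewrite cos_period. apply cos_neg.
Qed.

Lemma Series_id_geom (t : R) : 0 <= t < 1 ->
  is_series (fun n => INR n * t ^ n) (t / (1 - t) ^ 2).
Proof.
  intros Ht.
  assert (E0 : ex_series (fun n => t ^ n)) by (apply ex_series_geom; rewrite Rabs_pos_eq; lra).
  assert (E : ex_series (fun n => INR n * t ^ n)).
  { destruct (Req_dec t 0) as [->|Nt].
    - exists (sum_f_R0 (fun n => INR n * 0 ^ n) 0). apply is_series_finite.
      intros n Hn. rewrite pow_i by lia. ring.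
    - refine (ex_series_ext _ _ _ (ex_series_poly_geom 1 t ltac:(lra))). intros n. simpl; ring_R. }
  replace (t / (1 - t) ^ 2) with (Series (fun n => INR n * t ^ n)); [apply Series_correct, E|].
  assert (X : Series (fun n => INR n * t ^ n) = t * Series (fun n => INR n * t ^ n) + t * / (1 - t)).
  { rewrite (Series_incr_1 (fun n => INR n * t ^ n) E) at 1.
    rewrite <- (Series_geom t) by (rewrite Rabs_pos_eq; lra).
    rewrite <- !Series_scal_l, <- Series_plus; [|apply ex_series_Rscal; auto..].
    change (INR 0) with 0. rewrite Rmult_0_l, Rplus_0_l. apply Series_ext. intros n.
    rewrite S_INR, <- tech_pow_Rmult. ring. }
  apply Rmult_eq_reg_r with (1 - t); [|lra].
  transitivity (t * / (1 - t)); [lra|field; lra].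
Qed.

(** Expanding 1 / sinh^2 y as 4 sum n exp (- 2 n y) uncovers the symmetry about y0: the n-th term
    becomes 4 n (exp (- 2 n y) + Q^n exp (2 n y)) / (1 - Q^n), where y -> 2 y0 - y exchanges the two
    exponentials. *)
Lemma wp_im_lattice (y : R) : 0 < y < 2 * y0 ->
  wp_im y = Series (fun n => 4 * INR n * exp (- (2 * y * INR n)) + 8 * (b n * cosh (2 * INR n * y))).
Proof.
  intros Hy.
  assert (Ht : 0 <= exp (- (2 * y)) < 1).
  { split; [apply Rlt_le, exp_pos|]. rewrite <- exp_0. apply exp_increasing. lra. }
  assert (X := Series_id_geom _ Ht).
  assert (E : ex_series (fun n => b n * cosh (2 * INR n * y))).
  { refine (ex_series_ext _ _ _ (proj1 (ex_series_lambert_cosh 0 y _))).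
    - intros n; simpl; ring_R.
    - rewrite Rabs_pos_eq; lra. }
  assert (X4 : is_series (fun n => 4 * INR n * exp (- (2 * y * INR n)))
     (4 * (exp (- (2 * y)) / (1 - exp (- (2 * y))) ^ 2))).
  { refine (is_series_ext _ _ _ _ (is_series_scal_l 4 _ _ X)). intros n.
    rewrite <- exp_mult_INR.
    change (4 * (INR n * exp (- (2 * y) * INR n)) = 4 * INR n * exp (- (2 * y * INR n))).
    replace (- (2 * y * INR n)) with (- (2 * y) * INR n) by ring. ring. }
  rewrite Series_plus; [|now exists (4 * (exp (- (2 * y)) / (1 - exp (- (2 * y))) ^ 2))|apply ex_series_Rscal; auto].
  rewrite Series_scal_l, (is_series_unique _ _ X4). unfold wp_im. f_equal.
  unfold sinh. replace (- (2 * y)) with (- y + - y) by ring. rewrite exp_plus.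
  assert (P := exp_pos y). rewrite exp_Ropp in *.
  assert (1 < exp y) by (rewrite <- exp_0; apply exp_increasing; lra).
  assert (1 < exp y * exp y) by nra. field. repeat split; simpl; nra.
Qed.

Lemma wp_im_sym (y : R) : 0 < y < 2 * y0 -> wp_im (2 * y0 - y) = wp_im y.
Proof.
  intros Hy. rewrite !wp_im_lattice by lra. apply Series_ext. intros n.
  destruct (Nat.eq_dec n 0) as [->|Hn]. { rewrite lambert_0. change (INR 0) with 0. ring. }
  unfold lambert. assert (B := pow_lt_1_S Q n nome2_bounds ltac:(lia)).
  assert (Hq := nome2_bounds).
  assert (EQ : Q ^ n = exp (- (4 * y0 * INR n))).
  { unfold nome2. rewrite <- exp_mult_INR. f_equal; ring. }
  unfold cosh.
  replace (exp (- (2 * (2 * y0 - y) * INR n))) with (Q ^ n * exp (2 * INR n * y))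
    by (rewrite EQ, <- exp_plus; f_equal; ring).
  replace (exp (- (2 * y * INR n))) with (exp (- (2 * INR n * y))) by (f_equal; ring).
  replace (exp (- (2 * INR n * (2 * y0 - y)))) with (Q ^ n * exp (2 * INR n * y))
    by (rewrite EQ, <- exp_plus; f_equal; ring).
  replace (exp (2 * INR n * (2 * y0 - y))) with (exp (- (2 * INR n * y)) / Q ^ n).
  - field. lra.
  - apply Rmult_eq_reg_r with (Q ^ n); [|lra]. unfold Rdiv. rewrite Rmult_assoc, Rinv_l, Rmult_1_r by lra.
    rewrite EQ, <- exp_plus. f_equal. ring.
Qed.

Lemma inv_sqr_blowup (M c : R) : 0 < c -> exists d, 0 < d < 1 / 2 /\ forall x, 0 < x < d -> M < / (c * x) ^ 2.
Proof.
  intros Hc. set (d := / (2 + Rabs M)).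
  assert (P := Rabs_pos M). assert (L := Rle_abs M).
  exists (Rmin (/ 4) (d / c)).
  assert (Pd : 0 < d) by (apply Rinv_0_lt_compat; lra).
  assert (H1 := Rmin_l (/ 4) (d / c)). assert (H2 := Rmin_r (/ 4) (d / c)).
  split. { split; [apply Rmin_pos; [lra|apply Rdiv_lt_0_compat; lra]|lra]. }
  intros x Hx. assert (Hcx : 0 < c * x < d).
  { split; [apply Rmult_lt_0_compat; lra|].
    apply Rlt_le_trans with (c * (d / c)); [apply Rmult_lt_compat_l; lra|right; field; lra]. }
  assert (Y : / d < / (c * x)) by (apply Rinv_lt_contravar; [apply Rmult_lt_0_compat|]; lra).
  unfold d in Y. rewrite Rinv_inv in Y.
  rewrite <- pow_inv. nra.
Qed.

Lemma cos_sum_le (x : R) : cos_sum x <= Series b.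
Proof.
  apply Rle_trans with (1 := Rle_abs _). apply Series_Rabs_le.
  - intros n. rewrite Rabs_mult, Rabs_pos_eq by apply lambert_pos.
    rewrite <- (Rmult_1_r (b n)) at 2. apply Rmult_le_compat_l; [apply lambert_pos|].
    apply Rabs_le, COS_bound.
  - apply ex_series_lambert_0, nome2_bounds.
Qed.

Lemma wp_re_blowup (M : R) : exists d, 0 < d /\ forall x, 0 < x < d -> M < wp_re x.
Proof.
  destruct (inv_sqr_blowup (M + 8 * Series b) 1 ltac:(lra)) as [d [Hd H]].
  exists d. split; [lra|]. intros x Hx. specialize (H x Hx). rewrite Rmult_1_l in H.
  assert (HP := PI2_1).
  assert (S := sin_gt_0 x ltac:(lra) ltac:(lra)).
  assert (Sx := sin_lt_x x ltac:(lra)).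
  assert (I : / x ^ 2 <= / sin x ^ 2) by (apply Rinv_le_contravar; [apply pow_lt; auto|apply pow_incr; lra]).
  assert (C := cos_sum_le x). unfold wp_re. lra.
Qed.

Lemma cosh_sum_ge (y : R) : Rabs y < 2 * y0 -> Series b <= cosh_sum y.
Proof.
  intros Hy. apply Series_le.
  - intros n. assert (P := lambert_pos n). split; auto.
    rewrite <- (Rmult_1_r (b n)) at 1. apply Rmult_le_compat_l; auto.
    set (u := 2 * INR n * y). assert (H' := exp_pos (- u)).
    assert (C : exp u * exp (- u) = 1) by (rewrite <- exp_plus, Rplus_opp_r; apply exp_0).
    assert (Z : 0 <= (exp u - 1) ^ 2 * exp (- u)) by (apply Rmult_le_pos; [apply pow2_ge_0|lra]).
    replace ((exp u - 1) ^ 2 * exp (- u)) with ((exp u - 2) * (exp u * exp (- u)) + exp (- u)) in Z by ring.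
    rewrite C in Z. unfold cosh. lra.
  - refine (ex_series_ext _ _ _ (proj1 (ex_series_lambert_cosh 0 y Hy))). intros n; simpl; ring_R.
Qed.

Lemma Series_lambert_pos : 0 <= Series b.
Proof.
  apply Rle_trans with (b 0%nat); [apply lambert_pos|]. apply term_le_Series; [apply lambert_pos|].
  apply ex_series_lambert_0, nome2_bounds.
Qed.

Lemma wp_im_blowup (M : R) : exists d, 0 < d /\ forall x, 0 < x < d -> M < wp_im x.
Proof.
  destruct (inv_sqr_blowup M 2 ltac:(lra)) as [d [Hd H]].
  exists (Rmin d (2 * y0)). split; [apply Rmin_pos; lra|]. intros x Hx.
  assert (H1 := Rmin_l d (2 * y0)). assert (H2 := Rmin_r d (2 * y0)).
  specialize (H x ltac:(lra)).
  assert (C := cosh_sum_ge x ltac:(rewrite Rabs_pos_eq; lra)). assert (P := Series_lambert_pos).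
  assert (S := sinh_lt 0 x ltac:(lra)). rewrite sinh_0 in S.
  assert (L : sinh x <= 2 * x).
  (* From exp (- x) >= 1 - x follows exp x <= 1 / (1 - x), which is at most 1 + 2 x because x < 1/2;
     the bound 1/2 in [inv_sqr_blowup] serves this. *)
  { assert (E := exp_ineq1_le (- x)). assert (E' := exp_pos x).
    assert (E2 : exp x * exp (- x) = 1) by (rewrite <- exp_plus, Rplus_opp_r; apply exp_0).
    unfold sinh. assert (exp x <= 1 + 2 * x) by nra. lra. }
  assert (I : / (2 * x) ^ 2 <= / sinh x ^ 2) by (apply Rinv_le_contravar; [apply pow_lt; auto|apply pow_incr; lra]).
  unfold wp_im. lra.
Qed.

Lemma wp_re_blowup_solution : blowup_solution wp_re wp_re' (- wp_mu) (- wp_beta) (PI / 2).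
Proof.
  assert (P := PI_RGT_0). split; [lra| | | |apply wp_re_blowup].
  - intros x Hx. apply wp_re_derive. lra.
  - intros x Hx. apply wp_re_derive2. lra.
  - intros x Hx. apply wp_re_sym.
Qed.

Lemma wp_im_blowup_solution : blowup_solution wp_im wp_im' wp_mu (- wp_beta) y0.
Proof.
  split; [auto|apply wp_im_derive|apply wp_im_derive2|apply wp_im_sym|apply wp_im_blowup].
Qed.

(** * The Laurent series at 0 *)

Definition lam_coef (j : nat) : R := cos_n j * 4 ^ j * Series (fun n => INR n ^ (2 * j) * b n).

(** Each cosine is expanded and the sums are exchanged. With r^2 = |v|, the term (2 n r)^(2j) /
    (2j)! is at most exp (4 n r) / 4^j: doubling the frequency buys a geometric factor in j, and r <
    y0 keeps the sum over n convergent. *)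
Lemma is_pseries_lam (v : R) : Rabs v < y0 ^ 2 ->
  is_pseries lam_coef v (Series (fun n => b n * cos_pseries (4 * INR n ^ 2 * v))).
Proof.
  intros Hv. assert (Pv := Rabs_pos v).
  set (r := sqrt (Rabs v)).
  assert (Hr : 0 <= r < y0).
  { split; [apply sqrt_pos|]. rewrite <- (sqrt_pow2 y0) by lra. apply sqrt_lt_1; auto. apply pow2_ge_0. }
  assert (Hr2 : r ^ 2 = Rabs v) by (apply pow2_sqrt; auto).
  set (F := fun n j => b n * (cos_n j * (4 * INR n ^ 2 * v) ^ j)).
  assert (HF : forall n j, Rabs (F n j) <= (INR n ^ 0 * b n * exp (2 * (2 * r) * INR n)) * (/ 4) ^ j).
  { intros n j. unfold F. assert (P := pos_INR n).
    rewrite Rabs_mult, Rabs_pos_eq by apply lambert_pos.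
    replace (INR n ^ 0 * b n * exp (2 * (2 * r) * INR n) * (/ 4) ^ j)
      with (b n * (exp (2 * (2 * r) * INR n) * (/ 4) ^ j)) by (simpl; ring).
    apply Rmult_le_compat_l; [apply lambert_pos|].
    assert (X : Rabs (cos_n j * (4 * INR n ^ 2 * v) ^ j) =
       (2 * (2 * r) * INR n) ^ (2 * j) / INR (fact (2 * j)) * (/ 4) ^ j).
    { unfold cos_n. rewrite Rabs_mult, Rabs_div by apply INR_fact_neq_0.
      rewrite pow_1_abs, (Rabs_pos_eq (INR _)) by apply pos_INR.
      rewrite <- RPow_abs, !Rabs_mult, (Rabs_pos_eq 4), (Rabs_pos_eq (INR n ^ 2)) by (try apply pow2_ge_0; lra).
      rewrite <- Hr2, pow_mult. unfold Rdiv. rewrite Rmult_1_l.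
      transitivity (((2 * (2 * r) * INR n) ^ 2 * / 4) ^ j * / INR (fact (2 * j))).
      - rewrite Rmult_comm. do 2 f_equal. field.
      - rewrite Rpow_mult_distr. ring. }
    rewrite X.
    apply Rmult_le_compat_r; [apply pow_le; lra|].
    apply pow_fact_le_exp. repeat apply Rmult_le_pos; lra. }
  assert (ea : ex_series (fun n => INR n ^ 0 * b n * exp (2 * (2 * r) * INR n)))
    by (apply ex_series_lambert_exp_lt; lra).
  assert (eb : ex_series (fun j => (/ 4) ^ j)) by (apply ex_series_geom; rewrite Rabs_pos_eq; lra).
  assert (Ecol : forall j, Series (fun n => F n j) = lam_coef j * v ^ j).
  { intros j. unfold F, lam_coef. rewrite Rmult_assoc, (Rmult_comm (Series _)), <- Rmult_assoc, <- Series_scal_l.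
    apply Series_ext. intros n. rewrite !Rpow_mult_distr, <- pow_mult. ring. }
  apply is_pseries_R.
  replace (Series (fun n => b n * cos_pseries (4 * INR n ^ 2 * v))) with (Series (fun n => Series (F n))).
  - rewrite (Series_swap F _ _ HF ea eb).
    apply is_series_ext with (fun j => Series (fun n => F n j)); [intros; apply Ecol|].
    apply Series_correct. exact (ex_series_Series_col F _ _ HF ea eb).
  - apply Series_ext. intros n. unfold F. rewrite Series_scal_l. reflexivity.
Qed.

(** Coefficients of x^2 W x in v = x^2, and equally of x^2 V x in v = - x^2; the leading 1 is the
    double pole. *)
Definition wp_coef (n : nat) : R :=
  match n with O => 1 | S j => csc_coef j - 8 * lam_coef j end.

Definition wp_radius : R := Rmin (PI ^ 2) (y0 ^ 2).

Lemma wp_radius_pos : 0 < wp_radius.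
Proof. apply Rmin_pos; apply pow_lt; auto. apply PI_RGT_0. Qed.

Lemma is_pseries_wp (v : R) : Rabs v < wp_radius ->
  is_pseries wp_coef v
    (1 + v * (PSeries csc_coef v - 8 * Series (fun n => b n * cos_pseries (4 * INR n ^ 2 * v)))).
Proof.
  intros Hv. assert (L1 := Rmin_l (PI ^ 2) (y0 ^ 2)). assert (L2 := Rmin_r (PI ^ 2) (y0 ^ 2)).
  fold wp_radius in *.
  assert (E1 := is_pseries_csc v ltac:(lra)). rewrite <- (is_pseries_unique _ _ _ E1) in E1.
  assert (E2 := is_pseries_lam v ltac:(lra)).
  apply is_pseries_R in E1. apply is_pseries_R in E2. apply is_pseries_R.
  apply (is_series_decr_1 (fun n => wp_coef n * v ^ n)).
  assert (E := is_series_minus _ _ _ _ E1 (is_series_scal_l 8 _ _ E2)).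
  apply (is_series_scal_l v) in E.
  match type of E with is_series _ ?l => match goal with |- is_series _ ?l' => replace l' with l end end.
  - refine (is_series_ext _ _ _ _ E). intros n.
    change (v * (csc_coef n * v ^ n + - (8 * (lam_coef n * v ^ n))) = wp_coef (S n) * v ^ S n).
    unfold wp_coef. rewrite <- tech_pow_Rmult. ring.
  - match goal with |- _ = plus (1 + ?B) _ => set (X := B) end.
    change (X = 1 + X + - (1 * 1)). ring.
Qed.

Lemma wp_re_pseries (x : R) : 0 < x -> x ^ 2 < wp_radius ->
  wp_re x = PSeries wp_coef (x ^ 2) / x ^ 2.
Proof.
  intros Hx Hx2. assert (L1 := Rmin_l (PI ^ 2) (y0 ^ 2)). fold wp_radius in L1.
  assert (P := PI_RGT_0). assert (x < PI) by nra.
  rewrite (is_pseries_unique _ _ _ (is_pseries_wp (x ^ 2) ltac:(rewrite Rabs_pos_eq; [lra|apply pow2_ge_0]))).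
  unfold wp_re. rewrite csc_sqr_expansion by lra.
  replace (cos_sum x) with (Series (fun n => b n * cos_pseries (4 * INR n ^ 2 * x ^ 2))); [field; lra|].
  apply Series_ext. intros n. rewrite <- cos_pseries_sqr. do 2 f_equal. ring.
Qed.

Lemma wp_im_pseries (x : R) : 0 < x -> x ^ 2 < wp_radius ->
  wp_im x = PSeries wp_coef (- x ^ 2) / x ^ 2.
Proof.
  intros Hx Hx2. assert (L1 := Rmin_l (PI ^ 2) (y0 ^ 2)). fold wp_radius in L1.
  assert (P := PI_RGT_0). assert (x < PI) by nra.
  rewrite (is_pseries_unique _ _ _ (is_pseries_wp (- x ^ 2)
    ltac:(rewrite Rabs_Ropp, Rabs_pos_eq; [lra|apply pow2_ge_0]))).
  unfold wp_im. rewrite csch_sqr_expansion by lra.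
  replace (cosh_sum x) with (Series (fun n => b n * cos_pseries (4 * INR n ^ 2 * - x ^ 2))); [field; lra|].
  apply Series_ext. intros n. rewrite <- cos_pseries_opp_sqr. do 2 f_equal. ring.
Qed.

End Weierstrass.

(** * Functions given by a power series on a fixed interval around 0 *)

Definition analytic (r : R) (f : R -> R) : Prop :=
  exists a : nat -> R, forall v, Rabs v < r -> is_pseries a v (f v).

Lemma analytic_radius (r : R) (a : nat -> R) (f : R -> R) (v : R) :
  (forall v, Rabs v < r -> is_pseries a v (f v)) -> Rabs v < r -> Rbar_lt (Rabs v) (CV_radius a).
Proof.
  intros H Hv. assert (P := Rabs_pos v).
  assert (Q : Rabs ((Rabs v + r) / 2) = (Rabs v + r) / 2) by (apply Rabs_pos_eq; lra).
  apply Rbar_lt_le_trans with (Rabs ((Rabs v + r) / 2)).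
  - rewrite Q. simpl. lra.
  - apply CV_radius_ge. exists (f ((Rabs v + r) / 2)). apply is_pseries_R, H. lra.
Qed.

Lemma analytic_plus (r : R) (f g : R -> R) :
  analytic r f -> analytic r g -> analytic r (fun v => f v + g v).
Proof.
  intros [a Ha] [b Hb]. exists (PS_plus a b). intros v Hv.
  apply (is_pseries_plus a b v (f v) (g v)); auto.
Qed.

Lemma analytic_mult (r : R) (f g : R -> R) :
  analytic r f -> analytic r g -> analytic r (fun v => f v * g v).
Proof.
  intros [a Ha] [b Hb]. exists (PS_mult a b). intros v Hv.
  apply is_pseries_mult; auto; [apply (analytic_radius r a f)|apply (analytic_radius r b g)]; auto.
Qed.

Lemma analytic_const (r c : R) : analytic r (fun _ => c).
Proof.
  exists (fun n => match n with O => c | _ => 0 end). intros v _. apply is_pseries_R.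
  assert (X := is_series_finite (fun n => match n with O => c | _ => 0 end * v ^ n) 0).
  unfold sum_f_R0 in X. rewrite pow_O, Rmult_1_r in X. apply X.
  intros n Hn. destruct n; [lia|ring].
Qed.

Lemma is_pseries_id (c w : R) : is_pseries (fun n => match n with S O => c | _ => 0 end) w (c * w).
Proof.
  apply is_pseries_R.
  assert (X := is_series_finite (fun n => match n with S O => c | _ => 0 end * w ^ n) 1).
  unfold sum_f_R0 in X. rewrite pow_1, Rmult_0_l, Rplus_0_l in X. apply X.
  intros n Hn. destruct n as [|[|n]]; [lia|lia|ring].
Qed.

Lemma analytic_id (r : R) : analytic r (fun v => v).
Proof.
  eexists. intros v _. assert (X := is_pseries_id 1 v). rewrite Rmult_1_l in X. exact X.
Qed.

(** This replaces continuation from the real to the imaginary axis: an identity on v > 0, where it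
    concerns W, extends to v < 0, where it concerns V. *)
Lemma analytic_zero (r : R) (f : R -> R) : analytic r f ->
  (forall v, 0 < v < r -> f v = 0) -> forall v, Rabs v < r -> f v = 0.
Proof.
  intros [a Ha] H0 v Hv. assert (P := Rabs_pos v).
  assert (Z : forall n, a n = 0).
  { apply (is_pseries_zero_right a r); [lra|]. intros w Hw. rewrite <- (H0 w Hw).
    apply Ha. rewrite Rabs_pos_eq; lra. }
  rewrite <- (is_pseries_unique _ _ _ (Ha v Hv)).
  unfold PSeries. rewrite (Series_ext _ (fun n => 0 * 0)).
  - rewrite Series_scal_l. ring.
  - intros n. rewrite Z. ring.
Qed.

(** * First integrals, roots of the cubic and periods *)

Section Periods.

Variable y0 : R.
Hypothesis Hy0 : 0 < y0.

Notation mu := (wp_mu y0).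
Notation beta := (wp_beta y0).
Notation W := (wp_re y0).
Notation W' := (wp_re' y0).
Notation V := (wp_im y0).
Notation V' := (wp_im' y0).
Notation rho := (wp_radius y0).
Let G : R -> R := PSeries (wp_coef y0).
Let G' : R -> R := PSeries (PS_derive (wp_coef y0)).

Lemma wp_coef_radius (v : R) : Rabs v < rho -> Rbar_lt (Rabs v) (CV_radius (wp_coef y0)).
Proof. intros Hv. eapply analytic_radius with (2 := Hv). intros w Hw. apply is_pseries_wp; auto. Qed.

Lemma wp_pseries_analytic : analytic rho G /\ analytic rho G'.
Proof.
  split.
  - exists (wp_coef y0). intros v Hv. apply PSeries_correct, CV_radius_inside, wp_coef_radius, Hv.
  - exists (PS_derive (wp_coef y0)). intros v Hv. apply PSeries_correct, ex_pseries_derive, wp_coef_radius, Hv.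
Qed.

Lemma is_derive_ext_radius (f g : R -> R) (l x : R) :
  (forall t, 0 < t -> t ^ 2 < rho -> f t = g t) -> 0 < x -> x ^ 2 < rho ->
  is_derive g x l -> is_derive f x l.
Proof.
  intros E Hx Hr D. assert (Pr := wp_radius_pos y0 Hy0).
  assert (Lr : 0 < Rmin x (sqrt rho - x)).
  { apply Rmin_pos; auto. assert (x < sqrt rho); [|lra].
    rewrite <- (sqrt_pow2 x) by lra. apply sqrt_lt_1; auto; [apply pow2_ge_0|lra]. }
  apply is_derive_ext_loc with (2 := D). exists (mkposreal _ Lr). intros t Ht.
  change (Rabs (t - x) < Rmin x (sqrt rho - x)) in Ht.
  assert (M1 := Rmin_l x (sqrt rho - x)). assert (M2 := Rmin_r x (sqrt rho - x)).
  apply Rabs_lt_between in Ht. symmetry. apply E; [lra|].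
  rewrite <- (pow2_sqrt rho) by lra. assert (0 < t < sqrt rho) by lra. nra.
Qed.

Lemma wp_re'_pseries (x : R) : 0 < x -> x ^ 2 < rho ->
  W' x = (2 * x ^ 2 * G' (x ^ 2) - 2 * G (x ^ 2)) / x ^ 3.
Proof.
  intros Hx Hr. assert (L1 := Rmin_l (PI ^ 2) (y0 ^ 2)). fold rho in L1.
  assert (P := PI_RGT_0). assert (Hxpi : x < PI) by nra.
  assert (D1 := wp_re_derive y0 Hy0 x ltac:(lra)).
  assert (DG : is_derive G (x ^ 2) (G' (x ^ 2))).
  { apply is_derive_PSeries, wp_coef_radius. rewrite Rabs_pos_eq; [auto|apply pow2_ge_0]. }
  assert (D2 : is_derive (fun x => G (x ^ 2) / x ^ 2) x ((2 * x ^ 2 * G' (x ^ 2) - 2 * G (x ^ 2)) / x ^ 3)).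
  { auto_derive.
    - repeat split; [now exists (G' (x ^ 2))|nra].
    - replace (x * (x * 1)) with (x ^ 2) by ring. derive_subst DG. field. lra. }
  assert (D3 := is_derive_ext_radius _ _ _ x (wp_re_pseries y0 Hy0) Hx Hr D2).
  apply is_derive_unique in D1. apply is_derive_unique in D3. lra.
Qed.

Lemma wp_im'_pseries (x : R) : 0 < x < 2 * y0 -> x ^ 2 < rho ->
  V' x = (- 2 * x ^ 2 * G' (- x ^ 2) - 2 * G (- x ^ 2)) / x ^ 3.
Proof.
  intros Hx Hr.
  assert (D1 := wp_im_derive y0 Hy0 x Hx).
  assert (DG : is_derive G (- x ^ 2) (G' (- x ^ 2))).
  { apply is_derive_PSeries, wp_coef_radius. rewrite Rabs_Ropp, Rabs_pos_eq; [auto|apply pow2_ge_0]. }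
  assert (D2 : is_derive (fun x => G (- x ^ 2) / x ^ 2) x ((- 2 * x ^ 2 * G' (- x ^ 2) - 2 * G (- x ^ 2)) / x ^ 3)).
  { auto_derive.
    - repeat split; [now exists (G' (- x ^ 2))|nra].
    - replace (x * (x * 1)) with (x ^ 2) by ring. derive_subst DG. field. lra. }
  assert (D3 := is_derive_ext_radius _ _ _ x (wp_im_pseries y0 Hy0) (proj1 Hx) Hr D2).
  apply is_derive_unique in D1. apply is_derive_unique in D3. lra.
Qed.

(* First integral of W and, through the common power series [G] evaluated at negative
   argument, the one of V with the same constant. *)
Lemma wp_first_integrals : exists c,
  (forall x, 0 < x < PI -> W' x ^ 2 = 4 * W x ^ 3 - mu * W x ^ 2 - 2 * beta * W x + c) /\
  (forall y, 0 < y < 2 * y0 -> V' y ^ 2 = 4 * V y ^ 3 + mu * V y ^ 2 - 2 * beta * V y - c).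
Proof.
  assert (HP := PI_RGT_0). assert (Hrho := wp_radius_pos y0 Hy0).
  assert (IW := blowup_first_integral _ _ _ _ _ (wp_re_blowup_solution y0 Hy0)).
  assert (IV := blowup_first_integral _ _ _ _ _ (wp_im_blowup_solution y0 Hy0)).
  set (c := W' (PI / 2) ^ 2 - 4 * W (PI / 2) ^ 3 + mu * W (PI / 2) ^ 2 + 2 * beta * W (PI / 2)).
  assert (H1 : forall x, 0 < x < PI -> W' x ^ 2 = 4 * W x ^ 3 - mu * W x ^ 2 - 2 * beta * W x + c).
  { intros x Hx. assert (E := IW x (PI / 2) ltac:(lra) ltac:(lra)). unfold c. lra. }
  (* [N v] is v^3 times the defect in the first integral of W, with W = G / v and W' = (2 v G' - 2
     G) / v^(3/2), hence free of denominators. It is written with sums and products only so that the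
     closure lemmas for [analytic] match it. *)
  set (N := fun v => (2 * v * G' v + - 2 * G v) * (2 * v * G' v + - 2 * G v) + - 4 * (G v * (G v * G v))
     + mu * v * (G v * G v) + 2 * beta * (v * v) * G v + - c * (v * (v * v))).
  assert (AN : analytic rho N).
  { destruct wp_pseries_analytic as [A1 A2].
    unfold N. repeat lazymatch goal with
      | |- analytic _ (fun v => @?f v + @?g v) => apply analytic_plus
      | |- analytic _ (fun v => @?f v * @?g v) => apply analytic_mult
      | |- analytic _ (fun v => v) => apply analytic_id
      | |- analytic _ (Rmult ?c) => apply (analytic_mult _ (fun _ => c) (fun v => v))
      | |- analytic _ G => exact A1
      | |- analytic _ G' => exact A2
      | |- analytic _ (fun v => ?c) => apply analytic_const
      end. }
  assert (NZ : forall v, Rabs v < rho -> N v = 0).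
  { apply (analytic_zero rho N AN). intros v Hv.
    set (x := sqrt v). assert (Hx : 0 < x) by (apply sqrt_lt_R0; lra).
    assert (Ex : x ^ 2 = v) by (apply pow2_sqrt; lra).
    assert (L1 := Rmin_l (PI ^ 2) (y0 ^ 2)). fold rho in L1.
    assert (Hxpi : x < PI) by nra.
    assert (E := H1 x ltac:(lra)).
    rewrite (wp_re'_pseries x Hx), (wp_re_pseries y0 Hy0 x Hx) in E by lra. fold G in E.
    transitivity (x ^ 6 * (((2 * x ^ 2 * G' (x ^ 2) - 2 * G (x ^ 2)) / x ^ 3) ^ 2
      - (4 * (G (x ^ 2) / x ^ 2) ^ 3 - mu * (G (x ^ 2) / x ^ 2) ^ 2 - 2 * beta * (G (x ^ 2) / x ^ 2) + c))).
    - unfold N. rewrite <- Ex. field. lra.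
    - rewrite E. ring. }
  exists c. split; auto.
  assert (H2 : forall y, 0 < y < 2 * y0 -> y ^ 2 < rho ->
    V' y ^ 2 = 4 * V y ^ 3 + mu * V y ^ 2 - 2 * beta * V y - c).
  { intros y Hy Hr.
    assert (Z := NZ (- y ^ 2) ltac:(rewrite Rabs_Ropp, Rabs_pos_eq; [auto|apply pow2_ge_0])).
    rewrite (wp_im'_pseries y Hy Hr), (wp_im_pseries y0 Hy0 y (proj1 Hy) Hr). fold G.
    apply Rminus_diag_uniq. transitivity (N (- y ^ 2) / y ^ 6); [|rewrite Z; field; lra].
    unfold N. field. lra. }
  intros y Hy.
  (* The power series speaks only of small y; as the first integral of V is constant on (0, 2 y0),
     its value at the single point [y1] suffices. *)
  set (y1 := Rmin y0 (sqrt rho / 2)).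
  assert (Hs : 0 < sqrt rho) by (apply sqrt_lt_R0; auto).
  assert (M1 := Rmin_l y0 (sqrt rho / 2)). assert (M2 := Rmin_r y0 (sqrt rho / 2)).
  assert (M : 0 < y1) by (apply Rmin_pos; lra). fold y1 in M1, M2.
  assert (Hy1 : y1 ^ 2 < rho) by (rewrite <- (pow2_sqrt rho) by lra; nra).
  assert (E := H2 y1 ltac:(lra) Hy1). assert (E' := IV y y1 Hy ltac:(lra)). lra.
Qed.

(** The derivatives vanish at the midpoints, so W (PI/2) and - V y0 are roots of the cubic; [wp_e2]
    is defined by the sum mu / 4 of the three roots. *)
Definition wp_e1 : R := W (PI / 2).
Definition wp_e3 : R := - V y0.
Definition wp_e2 : R := mu / 4 - wp_e1 - wp_e3.

(** Both are compared with - 8 [Series (lambert Q)]: [wp_e1] exceeds it because every cosine is at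
    most 1, [wp_e3] stays below it because every cosh is at least 1. *)
Lemma wp_e3_lt_e1 : wp_e3 < wp_e1.
Proof.
  unfold wp_e1, wp_e3, wp_re, wp_im. rewrite sin_PI2.
  assert (S := sinh_lt 0 y0 Hy0). rewrite sinh_0 in S.
  assert (C := cosh_sum_ge y0 Hy0 y0 ltac:(rewrite Rabs_pos_eq; lra)).
  assert (0 < / sinh y0 ^ 2) by (apply Rinv_0_lt_compat, pow_lt; auto).
  assert (L := cos_sum_le y0 Hy0 (PI / 2)). lra.
Qed.

(** With the sum of the roots built into [wp_e2], the cubic and the product differ by a linear
    polynomial A X + B, which vanishes at the distinct points [wp_e1] and [wp_e3]. *)
Lemma wp_factor :
  - beta = 2 * (wp_e1 * wp_e2 + wp_e1 * wp_e3 + wp_e2 * wp_e3) /\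
  (forall x, 0 < x < PI -> W' x ^ 2 = 4 * (W x - wp_e1) * (W x - wp_e2) * (W x - wp_e3)) /\
  (forall y, 0 < y < 2 * y0 -> V' y ^ 2 = 4 * (V y - - wp_e3) * (V y - - wp_e2) * (V y - - wp_e1)).
Proof.
  assert (HP := PI_RGT_0). assert (L := wp_e3_lt_e1).
  destruct wp_first_integrals as [c [H1 H2]].
  assert (Z1 := H1 (PI / 2) ltac:(lra)). assert (Z3 := H2 y0 ltac:(lra)).
  rewrite (blowup_derive_mid _ _ _ _ _ (wp_re_blowup_solution y0 Hy0)) in Z1.
  rewrite (blowup_derive_mid _ _ _ _ _ (wp_im_blowup_solution y0 Hy0)) in Z3.
  fold wp_e1 in Z1. replace (V y0) with (- wp_e3) in Z3 by (unfold wp_e3; ring).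
  set (A := - 2 * beta - 4 * (wp_e1 * wp_e2 + wp_e1 * wp_e3 + wp_e2 * wp_e3)).
  set (B := c + 4 * wp_e1 * wp_e2 * wp_e3).
  assert (F : forall X, 4 * X ^ 3 - mu * X ^ 2 - 2 * beta * X + c
    = 4 * (X - wp_e1) * (X - wp_e2) * (X - wp_e3) + A * X + B).
  { intros X. unfold A, B. replace mu with (4 * (wp_e1 + wp_e2 + wp_e3)) by (unfold wp_e2; field). ring. }
  assert (Y1 : A * wp_e1 + B = 0) by (specialize (F wp_e1); lra).
  assert (Y3 : A * wp_e3 + B = 0) by (specialize (F wp_e3); lra).
  assert (A0 : A = 0).
  { assert (E : A * (wp_e1 - wp_e3) = 0) by lra. apply Rmult_integral in E. destruct E; lra. }
  assert (B0 : B = 0) by (rewrite A0 in Y1; lra).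
  rewrite A0, B0 in F. split; [|split].
  - unfold A in A0. lra.
  - intros x Hx. rewrite H1, F by auto. ring.
  - intros y Hy. rewrite H2 by auto. specialize (F (- V y)).
    transitivity (- (4 * (- V y) ^ 3 - mu * (- V y) ^ 2 - 2 * beta * - V y + c)); [ring|].
    rewrite F. ring.
Qed.

(** Each axis settles one inequality: [blowup_root_order] for W puts the middle root below [wp_e1],
    and for V, whose roots are the negatives, above [wp_e3]. *)
Lemma wp_roots : wp_e3 < wp_e2 < wp_e1.
Proof.
  assert (HP := PI_RGT_0). assert (L := wp_e3_lt_e1).
  destruct wp_factor as [HB [F1 F2]].
  assert (Hmu : mu = 4 * (wp_e1 + wp_e2 + wp_e3)) by (unfold wp_e2; field).
  split.
  - apply Ropp_lt_cancel.
    apply (blowup_root_order _ _ _ _ _ (wp_im_blowup_solution y0 Hy0) (- wp_e3) (- wp_e2) (- wp_e1));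
      try lra.
    + unfold wp_e3; ring.
    + intros x Hx. apply F2. lra.
  - apply (blowup_root_order _ _ _ _ _ (wp_re_blowup_solution y0 Hy0) wp_e1 wp_e2 wp_e3); try lra.
    + reflexivity.
    + intros x Hx. apply F1. lra.
Qed.

Definition wp_scale : R := sqrt (wp_e1 - wp_e3).
Definition wp_modulus : R := sqrt ((wp_e2 - wp_e3) / (wp_e1 - wp_e3)).

Lemma wp_scale_spec : 0 < wp_scale /\ wp_scale ^ 2 = wp_e1 - wp_e3.
Proof. apply inversion_lam with wp_e2. apply wp_roots. Qed.

Lemma wp_modulus_spec : 0 < wp_modulus < 1 /\ wp_modulus ^ 2 = (wp_e2 - wp_e3) / (wp_e1 - wp_e3).
Proof. apply inversion_kap. apply wp_roots. Qed.

Lemma wp_ellipticK : ellipticK wp_modulus = wp_scale * (PI / 2).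
Proof.
  destruct wp_factor as [_ [F1 _]].
  apply (inversion_ellipticK _ _ _ _ _ _ _ _ (wp_re_blowup_solution y0 Hy0) wp_roots eq_refl).
  intros x Hx. apply F1. lra.
Qed.

(** For V the ordered roots are - e3, - e2, - e1: the scale is the same, and the squared modulus (e1
    - e2) / (e1 - e3) is the complementary one. *)
Lemma wp_ellipticK_compl : ellipticK (compl_modulus wp_modulus) = wp_scale * y0.
Proof.
  destruct wp_factor as [_ [_ F2]]. assert (R := wp_roots).
  assert (I := inversion_ellipticK V V' mu (- beta) y0 (- wp_e3) (- wp_e2) (- wp_e1)
    (wp_im_blowup_solution y0 Hy0) ltac:(lra) ltac:(unfold wp_e3; ring)
    ltac:(intros x Hx; apply F2; lra)).
  replace (- wp_e3 - - wp_e1) with (wp_e1 - wp_e3) in I by ring. fold wp_scale in I.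
  rewrite <- I. f_equal. unfold compl_modulus. f_equal.
  rewrite (proj2 wp_modulus_spec). field. lra.
Qed.

Lemma wp_ns (x : R) : 0 < x < PI / 2 ->
  jacobi_ns (wp_scale * x) wp_modulus ^ 2 = (W x - wp_e3) / wp_scale ^ 2 /\
  jacobi_ns (- (wp_scale * x)) wp_modulus ^ 2 = (W x - wp_e3) / wp_scale ^ 2.
Proof.
  intros Hx. destruct wp_factor as [_ [F1 _]].
  assert (F : forall x, 0 < x < PI / 2 ->
     W' x ^ 2 = 4 * (W x - wp_e1) * (W x - wp_e2) * (W x - wp_e3)) by (intros; apply F1; lra).
  split.
  - exact (inversion_ns _ _ _ _ _ _ _ _ (wp_re_blowup_solution y0 Hy0) wp_roots eq_refl F x Hx).
  - exact (inversion_ns_opp _ _ _ _ _ _ _ _ (wp_re_blowup_solution y0 Hy0) wp_roots eq_refl F x Hx).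
Qed.

End Periods.

(** * The polynomials of the Laurent expansion *)

(** Coefficients of 2 w Y' - 2 Y, which is u^3 times the u-derivative of Y / u^2 = ns^2 when w =
    u^2; [shift_coef c] is the passage from Y to Y - c w. *)
Definition euler_coef (A : nat -> R) (n : nat) : R := (2 * INR n - 2) * A n.
Definition shift_coef (c : R) (A : nat -> R) (n : nat) : R :=
  match n with S O => A 1%nat - c | _ => A n end.

(* Coefficients of [(2 w Y' - 2 Y)^2 = 4 Y (Y - w) (Y - k^2 w)] for [Y = w ns^2 (sqrt w)], which is
   Jacobi's equation for ns; it determines [Y] from [Y(0) = 1]. *)
Definition ns2_recursion (k : R) (A : nat -> R) : Prop :=
  A 0%nat = 1 /\ forall n, PS_mult (euler_coef A) (euler_coef A) n =
    4 * PS_mult A (PS_mult (shift_coef 1 A) (shift_coef (k ^ 2) A)) n.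

Section PolynomialFamilies.

(** The polynomial is quantified before [k] and [A]: it must be the same for all moduli. Closure
    under sums and products then follows the recursion without explicit polynomials. *)
Definition poly_family (E : R -> (nat -> R) -> R) : Prop :=
  exists p : {poly R}, forall k A, 0 < k < 1 -> ns2_recursion k A -> E k A = peval p (k ^ 2).

Lemma poly_family_const (c : R) : poly_family (fun _ _ => c).
Proof. exists (poly.polyC c). intros k A _ _. symmetry. exact (poly.hornerC c (k ^ 2)). Qed.

Lemma poly_family_sqr : poly_family (fun k _ => k ^ 2).
Proof. exists (poly.polyX R). intros k A _ _. symmetry. exact (poly.hornerX (k ^ 2)). Qed.

Lemma poly_family_plus E F : poly_family E -> poly_family F -> poly_family (fun k A => E k A + F k A).
Proof.
  intros [p Hp] [q Hq]. exists (GRing.add p q). intros k A Hk HA.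
  rewrite (Hp k A Hk HA), (Hq k A Hk HA). symmetry. exact (poly.hornerD p q (k ^ 2)).
Qed.

Lemma poly_family_mult E F : poly_family E -> poly_family F -> poly_family (fun k A => E k A * F k A).
Proof.
  intros [p Hp] [q Hq]. exists (GRing.mul p q). intros k A Hk HA.
  rewrite (Hp k A Hk HA), (Hq k A Hk HA). symmetry. exact (poly.hornerM p q (k ^ 2)).
Qed.

Lemma poly_family_ext E F : poly_family E ->
  (forall k A, 0 < k < 1 -> ns2_recursion k A -> F k A = E k A) -> poly_family F.
Proof.
  intros [p Hp] H. exists p. intros k A Hk HA. rewrite H; auto.
Qed.

Lemma poly_family_sum (E : nat -> R -> (nat -> R) -> R) (n : nat) :
  (forall i, (i <= n)%nat -> poly_family (E i)) -> poly_family (fun k A => sum_f_R0 (fun i => E i k A) n).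
Proof.
  induction n as [|n IH]; intros H; simpl; [apply H; lia|].
  apply poly_family_plus; auto.
Qed.

End PolynomialFamilies.

Lemma PS_mult_SS (a b : nat -> R) (m : nat) :
  PS_mult a b (S (S m)) = a 0%nat * b (S (S m)) + a (S (S m)) * b 0%nat
    + sum_f_R0 (fun i => a (S i) * b (S (m - i))) m.
Proof.
  unfold PS_mult. rewrite tech5, Nat.sub_diag, decomp_sum by lia. simpl pred. rewrite Nat.sub_0_r.
  rewrite (sum_eq (fun i => a (S i) * b (S m - i)%nat) (fun i => a (S i) * b (S (m - i)))).
  - simpl sum_f_R0. ring.
  - intros i Hi. do 2 f_equal. lia.
Qed.

(** In degree n the unknown [A n] enters the left side with factor - 4 (2 n - 2) and the right side
    with factor 12, hence altogether with 8 n + 4 up to sign, which never vanishes; everything else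
    involves lower indices. Degree 1 is where k^2 enters and gives (1 + k^2) / 3. *)
Lemma ns2_recursion_poly (n : nat) : poly_family (fun _ A => A n).
Proof.
  induction n as [n IH] using lt_wf_ind.
  destruct n as [|[|m]].
  - apply poly_family_ext with (1 := poly_family_const 1). intros k A _ [H _]. exact H.
  - apply poly_family_ext with (fun k _ => / 3 * (1 + k ^ 2)).
    + apply poly_family_mult; [apply poly_family_const|].
      apply poly_family_plus; [apply poly_family_const|apply poly_family_sqr].
    + intros k A _ [H0 H]. specialize (H 1%nat). unfold PS_mult, sum_f_R0 in H.
      unfold euler_coef, shift_coef in H. simpl in H. rewrite H0 in H. lra.
  - set (C := fun (k : R) A => euler_coef A).
    set (B := fun (k : R) A => shift_coef 1 A).
    set (D := fun (k : R) A => shift_coef (k ^ 2) A).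
    set (BD := fun (k : R) A => PS_mult (B k A) (D k A)).
    assert (PC : forall i, (i < S (S m))%nat -> poly_family (fun k A => C k A i)).
    { intros i Hi. apply poly_family_mult; [apply poly_family_const|apply IH; auto]. }
    assert (PB : forall i, (i < S (S m))%nat -> poly_family (fun k A => B k A i)).
    { intros i Hi. unfold B, shift_coef. destruct i as [|[|i]]; try (apply IH; lia).
      apply (poly_family_plus (fun _ A => A 1%nat) (fun _ _ => - 1)); [apply IH; lia|apply poly_family_const]. }
    assert (PD : forall i, (i < S (S m))%nat -> poly_family (fun k A => D k A i)).
    { intros i Hi. unfold D, shift_coef. destruct i as [|[|i]]; try (apply IH; lia).
      apply poly_family_ext with (fun k A => A 1%nat + (- 1) * k ^ 2).
      - apply (poly_family_plus (fun _ A => A 1%nat)); [apply IH; lia|].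
        apply poly_family_mult; [apply poly_family_const|apply poly_family_sqr].
      - intros. ring. }
    assert (PBD : forall i, (i < S (S m))%nat -> poly_family (fun k A => BD k A i)).
    { intros i Hi. apply (poly_family_sum (fun j k A => B k A j * D k A (i - j)%nat)).
      intros j Hj. apply poly_family_mult; [apply PB|apply PD]; lia. }
    apply poly_family_ext with (fun k A => / (8 * INR (S (S m)) + 4) *
      (sum_f_R0 (fun i => C k A (S i) * C k A (S (m - i))) m
       + - 4 * (sum_f_R0 (fun i => B k A (S i) * D k A (S (m - i))) m
              + sum_f_R0 (fun i => A (S i) * BD k A (S (m - i))) m))).
    + apply poly_family_mult; [apply poly_family_const|].
      apply poly_family_plus.
      * apply (poly_family_sum (fun i k A => C k A (S i) * C k A (S (m - i)))).
        intros i Hi. apply poly_family_mult; apply PC; lia.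
      * apply poly_family_mult; [apply poly_family_const|]. apply poly_family_plus.
        -- apply (poly_family_sum (fun i k A => B k A (S i) * D k A (S (m - i)))).
           intros i Hi. apply poly_family_mult; [apply PB|apply PD]; lia.
        -- apply (poly_family_sum (fun i k A => A (S i) * BD k A (S (m - i)))).
           intros i Hi. apply poly_family_mult; [apply IH|apply PBD]; lia.
    + intros k A _ [H0 H]. specialize (H (S (S m))).
      fold (C k A) (B k A) (D k A) (BD k A) in H.
      rewrite (PS_mult_SS (C k A)), (PS_mult_SS A) in H.
      replace (BD k A (S (S m))) with (2 * A (S (S m))
        + sum_f_R0 (fun i => B k A (S i) * D k A (S (m - i))) m) in H.
      2:{ unfold BD. rewrite PS_mult_SS.
          change (B k A 0%nat) with (A 0%nat). change (D k A 0%nat) with (A 0%nat).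
          change (B k A (S (S m))) with (A (S (S m))). change (D k A (S (S m))) with (A (S (S m))).
          rewrite H0. ring. }
      replace (BD k A 0%nat) with 1 in H.
      2:{ change (1 = A 0%nat * A 0%nat). rewrite H0. ring. }
      replace (C k A 0%nat) with (-2) in H by (unfold C, euler_coef; rewrite H0; simpl; ring).
      replace (C k A (S (S m))) with ((2 * INR (S (S m)) - 2) * A (S (S m))) in H by reflexivity.
      rewrite H0 in H. assert (P := pos_INR (S (S m))).
      apply Rmult_eq_reg_l with (8 * INR (S (S m)) + 4); [|lra].
      rewrite <- Rmult_assoc, Rinv_r, Rmult_1_l by lra. lra.
Qed.

(** * Laurent coefficients of ns^2 in terms of those of W *)

Section LaurentCoefficients.

Variable y0 : R.
Hypothesis Hy0 : 0 < y0.

Notation lam := (wp_scale y0).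
Notation kap := (wp_modulus y0).
Notation e3 := (wp_e3 y0).

Let H (v : R) : R := PSeries (wp_coef y0) v - e3 * v.
Let EH (v : R) : R := 2 * v * PSeries (PS_derive (wp_coef y0)) v - 2 * PSeries (wp_coef y0) v.

(** From ns^2 (lam x) = (W x - e3) / lam^2: with u = lam x and w = u^2, the function w ns^2 equals
    x^2 (W x - e3), a power series in x^2 = w / lam^2. *)
Definition ns2_coef (n : nat) : R := shift_coef e3 (wp_coef y0) n / (lam ^ 2) ^ n.

Definition ns2_radius : R := lam ^ 2 * wp_radius y0.

Lemma ns2_radius_pos : 0 < ns2_radius.
Proof.
  apply Rmult_lt_0_compat; [apply pow_lt, wp_scale_spec; auto|apply wp_radius_pos; auto].
Qed.

Lemma ns2_radius_arg (w : R) : Rabs w < ns2_radius -> Rabs (w / lam ^ 2) < wp_radius y0.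
Proof.
  intros Hw. assert (Hl := proj1 (wp_scale_spec y0 Hy0)). assert (L : 0 < lam ^ 2) by (apply pow_lt; auto).
  unfold Rdiv. rewrite Rabs_mult, (Rabs_pos_eq (/ lam ^ 2)) by (apply Rlt_le, Rinv_0_lt_compat; auto).
  apply Rmult_lt_reg_r with (lam ^ 2); auto. rewrite Rmult_assoc, Rinv_l, Rmult_1_r by lra.
  unfold ns2_radius in Hw. lra.
Qed.

Lemma is_pseries_shift (c w l : R) (A : nat -> R) :
  is_pseries A w l -> is_pseries (shift_coef c A) w (l - c * w).
Proof.
  intros HA. assert (X := is_pseries_minus _ _ _ _ _ HA (is_pseries_id c w)).
  apply is_pseries_ext with (2 := X). intros n.
  change (A n + - (match n with S O => c | _ => 0 end) = shift_coef c A n).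
  destruct n as [|[|n]]; unfold shift_coef; ring.
Qed.

Lemma is_pseries_scale_arg (A : nat -> R) (s w l : R) : s <> 0 ->
  is_pseries A (w / s) l -> is_pseries (fun n => A n / s ^ n) w l.
Proof.
  intros Hs HA. apply is_pseries_R. apply is_pseries_R in HA.
  refine (is_series_ext _ _ _ _ HA). intros n. eq_R.
  unfold Rdiv. rewrite Rpow_mult_distr, pow_inv. ring.
Qed.

Lemma is_pseries_ns2_coef (w : R) : Rabs w < ns2_radius -> is_pseries ns2_coef w (H (w / lam ^ 2)).
Proof.
  intros Hw. assert (Hl := proj1 (wp_scale_spec y0 Hy0)). assert (L : 0 < lam ^ 2) by (apply pow_lt; auto).
  apply is_pseries_scale_arg; [lra|]. apply is_pseries_shift.
  apply PSeries_correct, CV_radius_inside, wp_coef_radius; auto. apply ns2_radius_arg; auto.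
Qed.

Lemma is_pseries_euler_coef (w : R) : Rabs w < ns2_radius ->
  is_pseries (euler_coef ns2_coef) w (EH (w / lam ^ 2)).
Proof.
  intros Hw. assert (Hl := proj1 (wp_scale_spec y0 Hy0)). assert (L : 0 < lam ^ 2) by (apply pow_lt; auto).
  set (v := w / lam ^ 2). assert (Hr := wp_coef_radius y0 Hy0 v (ns2_radius_arg w Hw)).
  assert (X1 := PSeries_correct _ _ (CV_radius_inside _ _ Hr)).
  assert (X2 := PSeries_correct _ _ (ex_pseries_derive _ _ Hr)).
  apply is_pseries_incr_1 in X2. apply is_pseries_R in X1. apply is_pseries_R in X2.
  assert (X := is_series_minus _ _ _ _ (is_series_scal_l 2 _ _ X2) (is_series_scal_l 2 _ _ X1)).
  apply is_pseries_R.
  match type of X with is_series _ ?l => replace (EH v) with l end.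
  - refine (is_series_ext _ _ _ _ X). intros n.
    change (2 * (PS_incr_1 (PS_derive (wp_coef y0)) n * v ^ n) + - (2 * (wp_coef y0 n * v ^ n))
      = euler_coef ns2_coef n * w ^ n).
    replace (w ^ n) with (v ^ n * (lam ^ 2) ^ n)
      by (rewrite <- Rpow_mult_distr; f_equal; unfold v; field; lra).
    assert (P : (lam ^ 2) ^ n <> 0) by (apply pow_nonzero; lra).
    unfold euler_coef, ns2_coef, shift_coef, PS_incr_1, PS_derive.
    destruct n as [|[|n]].
    + change (zero : R) with 0. change (INR 0) with 0. eq_R. rewrite !pow_O. field; lra.
    + eq_R. change (INR 1) with 1. field; lra.
    + eq_R. field; repeat split; auto; lra.
  - unfold EH. change (2 * (v * PSeries (PS_derive (wp_coef y0)) v) + - (2 * PSeries (wp_coef y0) v)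
      = 2 * v * PSeries (PS_derive (wp_coef y0)) v - 2 * PSeries (wp_coef y0) v). ring.
Qed.

(** The factored first integral of W times x^6, with e1 - e3 = lam^2 and e2 - e3 = kap^2 lam^2, is
    Jacobi's equation for H. It holds for small w > 0, which is enough to equate coefficients. *)
Lemma ns2_coef_recursion : ns2_recursion kap ns2_coef.
Proof.
  assert (HP := PI_RGT_0).
  assert (Hl := proj1 (wp_scale_spec y0 Hy0)). assert (L : 0 < lam ^ 2) by (apply pow_lt; auto).
  split. { unfold ns2_coef, shift_coef, wp_coef. rewrite pow_O. field; lra. }
  assert (HA := is_pseries_ns2_coef). assert (HC := is_pseries_euler_coef).
  assert (HB : forall w, Rabs w < ns2_radius -> is_pseries (shift_coef 1 ns2_coef) w (H (w / lam ^ 2) - 1 * w))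
    by (intros; apply is_pseries_shift; auto).
  assert (HD : forall w, Rabs w < ns2_radius ->
     is_pseries (shift_coef (kap ^ 2) ns2_coef) w (H (w / lam ^ 2) - kap ^ 2 * w))
    by (intros; apply is_pseries_shift; auto).
  assert (RA := fun w => analytic_radius ns2_radius _ _ w HA).
  assert (RC := fun w => analytic_radius ns2_radius _ _ w HC).
  assert (RB := fun w => analytic_radius ns2_radius _ _ w HB).
  assert (RD := fun w => analytic_radius ns2_radius _ _ w HD).
  assert (HBD : forall w, Rabs w < ns2_radius ->
     is_pseries (PS_mult (shift_coef 1 ns2_coef) (shift_coef (kap ^ 2) ns2_coef)) w
       ((H (w / lam ^ 2) - 1 * w) * (H (w / lam ^ 2) - kap ^ 2 * w)))
    by (intros; apply is_pseries_mult; auto).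
  assert (RBD := fun w => analytic_radius ns2_radius _ _ w HBD).
  apply (is_pseries_unique_right _ (fun n => 4 * PS_mult ns2_coef
     (PS_mult (shift_coef 1 ns2_coef) (shift_coef (kap ^ 2) ns2_coef)) n)
     (fun w => EH (w / lam ^ 2) * EH (w / lam ^ 2)) ns2_radius ns2_radius_pos).
  - intros w Hw. assert (Hw' : Rabs w < ns2_radius) by (rewrite Rabs_pos_eq; lra).
    apply is_pseries_mult; auto.
  - intros w Hw. assert (Hw' : Rabs w < ns2_radius) by (rewrite Rabs_pos_eq; lra).
    assert (X : is_pseries (PS_mult ns2_coef
      (PS_mult (shift_coef 1 ns2_coef) (shift_coef (kap ^ 2) ns2_coef))) w
      (H (w / lam ^ 2) * ((H (w / lam ^ 2) - 1 * w) * (H (w / lam ^ 2) - kap ^ 2 * w))))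
      by (apply is_pseries_mult; auto).
    apply is_pseries_R in X. apply is_pseries_R.
    assert (Y := is_series_scal_l 4 _ _ X).
    set (v := w / lam ^ 2) in *. set (x := sqrt v).
    assert (Hv : 0 < v) by (apply Rdiv_lt_0_compat; lra).
    assert (Hx : 0 < x) by (apply sqrt_lt_R0; auto).
    assert (Ex : x ^ 2 = v) by (apply pow2_sqrt; lra).
    assert (Hvr := ns2_radius_arg w Hw'). fold v in Hvr. rewrite Rabs_pos_eq in Hvr by lra.
    assert (L1 := Rmin_l (PI ^ 2) (y0 ^ 2)). fold (wp_radius y0) in L1.
    assert (Hxpi : x < PI) by nra.
    assert (E := proj1 (proj2 (wp_factor y0 Hy0)) x ltac:(lra)).
    rewrite (wp_re'_pseries y0 Hy0 x Hx), (wp_re_pseries y0 Hy0 x Hx), Ex in E by lra.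
    assert (S2 := proj2 (wp_scale_spec y0 Hy0)).
    assert (K2 := proj2 (wp_modulus_spec y0 Hy0)).
    assert (Rt := wp_roots y0 Hy0).
    replace (EH v * EH v) with (4 * (H v * ((H v - 1 * w) * (H v - kap ^ 2 * w)))).
    { refine (is_series_ext _ _ _ _ Y). intros n. symmetry; apply Rmult_assoc. }
    replace w with (lam ^ 2 * v) by (unfold v; field; lra).
    rewrite K2, S2. symmetry.
    transitivity (x ^ 6 * ((2 * v * PSeries (PS_derive (wp_coef y0)) v - 2 * PSeries (wp_coef y0) v) / x ^ 3) ^ 2).
    + unfold EH. field. lra.
    + rewrite E. replace (x ^ 6) with (v ^ 3) by (rewrite <- Ex; ring). unfold H. field. lra.
Qed.

Lemma ns2_coef_laurent : exists d, 0 < d /\ forall u, u <> 0 -> Rabs u < d ->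
  is_series (fun j => ns2_coef (S j) * u ^ (2 * j)) (jacobi_ns u kap ^ 2 - 1 / u ^ 2).
Proof.
  assert (HP := PI_RGT_0). destruct (wp_scale_spec y0 Hy0) as [Hl Hl2].
  assert (Hr := ns2_radius_pos). assert (Sr := sqrt_lt_R0 _ Hr).
  (* The second bound is K of the modulus; below it [wp_ns] applies to |u|, with one case for each
     sign of u. *)
  exists (Rmin (sqrt ns2_radius) (lam * (PI / 2))).
  split. { apply Rmin_pos; auto. apply Rmult_lt_0_compat; lra. }
  intros u Hu0 Hu.
  assert (M1 := Rmin_l (sqrt ns2_radius) (lam * (PI / 2))).
  assert (M2 := Rmin_r (sqrt ns2_radius) (lam * (PI / 2))).
  assert (Pu := Rabs_pos_lt u Hu0).
  set (x := Rabs u / lam).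
  assert (Hx : 0 < x < PI / 2).
  { unfold x. split; [apply Rdiv_lt_0_compat; auto|].
    apply Rmult_lt_reg_r with lam; auto. unfold Rdiv. rewrite Rmult_assoc, Rinv_l, Rmult_1_r by lra. lra. }
  assert (Exu : lam * x = Rabs u) by (unfold x; field; lra).
  assert (Hu2 : Rabs (u ^ 2) < ns2_radius).
  { rewrite <- RPow_abs, <- (pow2_sqrt ns2_radius) by lra. nra. }
  assert (Eu2 : u ^ 2 = lam ^ 2 * x ^ 2) by (rewrite <- pow2_abs, <- Exu; ring).
  assert (Ev : u ^ 2 / lam ^ 2 = x ^ 2) by (rewrite Eu2; field; lra).
  assert (Hv := ns2_radius_arg _ Hu2). rewrite Ev, Rabs_pos_eq in Hv by apply pow2_ge_0.
  assert (X := is_pseries_ns2_coef _ Hu2). rewrite Ev in X.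
  assert (N : jacobi_ns u kap ^ 2 = H (x ^ 2) / u ^ 2).
  { transitivity ((wp_re y0 x - e3) / lam ^ 2).
    - destruct (wp_ns y0 Hy0 x Hx) as [N1 N2]. rewrite Exu in N1, N2.
      unfold Rabs in N1, N2. destruct Rcase_abs; auto. rewrite Ropp_involutive in N2. auto.
    - rewrite (wp_re_pseries y0 Hy0 x) by lra. unfold H. rewrite Eu2. field. lra. }
  apply is_pseries_R in X.
  assert (Y := is_series_incr_1 (fun n => ns2_coef n * (u ^ 2) ^ n) (H (x ^ 2) - 1)).
  assert (Z : is_series (fun j => ns2_coef (S j) * (u ^ 2) ^ S j) (H (x ^ 2) - 1)).
  { apply Y. replace (plus _ _) with (H (x ^ 2)); auto.
    change (H (x ^ 2) = H (x ^ 2) - 1 + ns2_coef 0 * 1).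
    unfold ns2_coef, shift_coef, wp_coef. rewrite pow_O. field; lra. }
  assert (T := is_series_scal_l (/ u ^ 2) _ _ Z).
  replace (jacobi_ns u kap ^ 2 - 1 / u ^ 2) with (/ u ^ 2 * (H (x ^ 2) - 1)) by (rewrite N; field; auto).
  refine (is_series_ext _ _ _ _ T). intros j.
  change (/ u ^ 2 * (ns2_coef (S j) * (u ^ 2) ^ S j) = ns2_coef (S j) * u ^ (2 * j)).
  rewrite <- (tech_pow_Rmult (u ^ 2)), <- pow_mult. field. auto.
Qed.

End LaurentCoefficients.

(** * Uniformization by the modulus and the Eisenstein series *)

Definition half_period_ratio (k : R) : R := PI * ellipticK (compl_modulus k) / (2 * ellipticK k).

Lemma half_period_ratio_pos (k : R) : 0 < k < 1 -> 0 < half_period_ratio k.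
Proof.
  intros Hk. assert (P := PI_RGT_0). assert (P1 := ellipticK_pos k Hk).
  assert (P2 := ellipticK_pos _ (compl_modulus_bounds k Hk)).
  apply Rdiv_lt_0_compat; [apply Rmult_lt_0_compat|]; lra.
Qed.

(** The parameter y0 is prescribed by 2 y0 / PI = K'/K. The modulus built from it has this same
    ratio, so [modulus_unique] returns k; the scale is then the z of the theorem. *)
Lemma wp_uniformization (k : R) : 0 < k < 1 ->
  wp_modulus (half_period_ratio k) = k /\ wp_scale (half_period_ratio k) = 2 * ellipticK k / PI.
Proof.
  intros Hk. assert (P := PI_RGT_0). assert (P1 := ellipticK_pos k Hk).
  assert (Hy := half_period_ratio_pos k Hk). set (y0 := half_period_ratio k) in *.
  destruct (wp_scale_spec y0 Hy) as [Hl _]. destruct (wp_modulus_spec y0 Hy) as [Hm _].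
  assert (E1 := wp_ellipticK y0 Hy). assert (E2 := wp_ellipticK_compl y0 Hy).
  assert (Em : wp_modulus y0 = k).
  { apply modulus_unique; auto. rewrite E1, E2.
    transitivity (2 * y0 / PI); [field; lra|unfold y0, half_period_ratio; field; lra]. }
  split; auto. rewrite <- Em, E1. field. lra.
Qed.

(** The witness is the polynomial from the recursion times (2m-2)!, the factorial by which
    [ns2_laurent] divides. The coefficients obtained from W show that the recursion has a solution
    for every k and that it is the Laurent expansion. *)
Lemma ns2_poly_spec : ns2_laurent ns2_poly.
Proof.
  unfold ns2_poly. apply epsilon_spec.
  destruct (constructive_indefinite_description
    (fun P : nat -> {poly R} => forall n k A, 0 < k < 1 -> ns2_recursion k A -> A n = peval (P n) (k ^ 2)))
    as [P HP].
  { exists (fun n => proj1_sig (constructive_indefinite_description _ (ns2_recursion_poly n))).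
    intros n. exact (proj2_sig (constructive_indefinite_description _ (ns2_recursion_poly n))). }
  exists (fun m => GRing.mul (poly.polyC (INR (fact (2 * pred m)))) (P m)).
  intros k Hk. assert (Hy := half_period_ratio_pos k Hk). destruct (wp_uniformization k Hk) as [Em _].
  assert (HR := ns2_coef_recursion _ Hy). rewrite Em in HR.
  destruct (ns2_coef_laurent _ Hy) as [d [Hd HL]]. rewrite Em in HL.
  exists (mkposreal d Hd). intros u Hu Hu0.
  change (Rabs (u - 0) < d) in Hu. rewrite Rminus_0_r in Hu.
  refine (is_series_ext _ _ _ _ (HL u Hu0 Hu)). intros j. simpl pred.
  replace (peval (GRing.mul (poly.polyC (INR (fact (2 * j)))) (P (S j))) (k ^ 2))
    with (INR (fact (2 * j)) * peval (P (S j)) (k ^ 2)).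
  - rewrite <- (HP (S j) k _ Hk HR). eq_R. field. apply INR_fact_neq_0.
  - symmetry. transitivity (peval (poly.polyC (INR (fact (2 * j)))) (k ^ 2) * peval (P (S j)) (k ^ 2)).
    + exact (poly.hornerM (poly.polyC (INR (fact (2 * j)))) (P (S j)) (k ^ 2)).
    + f_equal. exact (poly.hornerC (INR (fact (2 * j))) (k ^ 2)).
Qed.

(** Putting u = sqrt w turns the expansion in even powers of u into a power series to the right of
    0, where coefficients are unique. *)
Lemma ns2_poly_coef (k : R) (j : nat) : 0 < k < 1 ->
  peval (ns2_poly (S j)) (k ^ 2) = INR (fact (2 * j)) * ns2_coef (half_period_ratio k) (S j).
Proof.
  intros Hk. assert (Hy := half_period_ratio_pos k Hk). destruct (wp_uniformization k Hk) as [Em _].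
  destruct (ns2_coef_laurent _ Hy) as [d [Hd HL]]. rewrite Em in HL.
  destruct (ns2_poly_spec k Hk) as [e He].
  assert (Pm := Rmin_pos d e Hd (cond_pos e)).
  assert (M1 := Rmin_l d e). assert (M2 := Rmin_r d e).
  assert (HS : forall w, 0 < w < Rmin d e ^ 2 -> 0 < sqrt w < Rmin d e).
  { intros w Hw. split; [apply sqrt_lt_R0; lra|].
    rewrite <- (sqrt_pow2 (Rmin d e)) by lra. apply sqrt_lt_1; lra. }
  assert (E : peval (ns2_poly (S j)) (k ^ 2) / INR (fact (2 * j)) = ns2_coef (half_period_ratio k) (S j)).
  { apply (is_pseries_unique_right (fun j => peval (ns2_poly (S j)) (k ^ 2) / INR (fact (2 * j)))
      (fun j => ns2_coef (half_period_ratio k) (S j))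
      (fun w => jacobi_ns (sqrt w) k ^ 2 - 1 / sqrt w ^ 2) (Rmin d e ^ 2)).
    - apply pow_lt; auto.
    - intros w Hw. apply is_pseries_R.
      assert (Hs := HS w Hw).
      assert (X := He (sqrt w)).
      assert (B : ball 0 e (sqrt w)).
      { change (Rabs (sqrt w - 0) < e). rewrite Rminus_0_r, Rabs_pos_eq; lra. }
      specialize (X B ltac:(lra)). refine (is_series_ext _ _ _ _ X). intros n. eq_R.
      rewrite pow_mult, pow2_sqrt by lra. unfold Rdiv. ring.
    - intros w Hw. apply is_pseries_R.
      assert (Hs := HS w Hw).
      assert (X := HL (sqrt w) ltac:(lra) ltac:(rewrite Rabs_pos_eq; lra)).
      refine (is_series_ext _ _ _ _ X). intros n. eq_R.
      rewrite pow_mult, pow2_sqrt by lra. reflexivity. }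
  rewrite <- E. field. apply INR_fact_neq_0.
Qed.

Lemma eisenstein_lambert (Q : R) (m : nat) : 0 < Q < 1 -> (1 <= m)%nat ->
  eisenstein m Q = 1 - 4 * INR m / bernoulli (2 * m) * Series (fun n => INR n ^ (2 * m - 2) * lambert Q n).
Proof.
  intros HQ Hm. unfold eisenstein. f_equal. f_equal.
  rewrite (Series_incr_1 (fun n => INR n ^ (2 * m - 2) * lambert Q n)) by (apply ex_series_lambert; auto).
  rewrite lambert_0, Rmult_0_r, Rplus_0_l. apply Series_ext. intros i. unfold lambert.
  replace (2 * m - 1)%nat with (S (2 * m - 2)) by lia. rewrite <- tech_pow_Rmult. unfold Rdiv. ring.
Qed.

Lemma eisenstein_nome_sqr (k : R) (m : nat) : 0 < k < 1 -> (2 <= m)%nat ->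
  eisenstein m (exp (- PI * ellipticK (compl_modulus k) / ellipticK k) ^ 2) =
    (-1) ^ (m - 1) * INR m * (2 * ellipticK k / PI) ^ (2 * m)
      / (2 ^ (2 * m - 1) * bernoulli (2 * m)) * peval (ns2_poly m) (k ^ 2).
Proof.
  intros Hk Hm. destruct m as [|j]; [lia|].
  assert (P1 := ellipticK_pos k Hk). assert (HP := PI_RGT_0).
  assert (Hy := half_period_ratio_pos k Hk). destruct (wp_uniformization k Hk) as [_ Es].
  set (y0 := half_period_ratio k) in *. assert (HQ := nome2_bounds y0 Hy).
  replace (exp (- PI * ellipticK (compl_modulus k) / ellipticK k) ^ 2) with (nome2 y0).
  2:{ unfold nome2. simpl. rewrite Rmult_1_r, <- exp_plus. f_equal. unfold y0, half_period_ratio. field. lra. }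
  rewrite eisenstein_lambert by (auto; lia). rewrite ns2_poly_coef by auto.
  rewrite <- Es. fold y0. destruct (wp_scale_spec y0 Hy) as [Hl _].
  replace (ns2_coef y0 (S j)) with ((csc_coef j - 8 * lam_coef y0 j) / (wp_scale y0 ^ 2) ^ S j).
  (* Here m >= 2 matters: the coefficient of index 1 also contains - e3. *)
  2:{ unfold ns2_coef, shift_coef, wp_coef. destruct j; [lia|reflexivity]. }
  rewrite pow_mult. unfold csc_coef, lam_coef, cos_n.
  replace (2 * S j - 2)%nat with (2 * j)%nat by lia. replace (S j - 1)%nat with j by lia.
  replace (2 * S j - 1)%nat with (S (2 * j)) by lia.
  set (sg := Series (fun n => INR n ^ (2 * j) * lambert (nome2 y0) n)).
  rewrite bernoulli_even. assert (Pc := cot_coef_pos j).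
  assert (Ef : INR (fact (2 * S j)) = (2 * INR j + 2) * (2 * INR j + 1) * INR (fact (2 * j))).
  { replace (2 * S j)%nat with (S (S (2 * j))) by lia. rewrite !fact_simpl, !mult_INR, !S_INR, mult_INR.
    simpl (INR 2). ring. }
  rewrite Ef. assert (Pj := pos_INR j). assert (Pf := INR_fact_lt_0 (2 * j)).
  replace (2 ^ S (2 * j)) with (2 * 4 ^ j).
  2:{ rewrite <- tech_pow_Rmult, pow_mult. f_equal. f_equal. ring. }
  rewrite <- (tech_pow_Rmult 4). rewrite !S_INR.
  assert (P4 : 0 < 4 ^ j) by (apply pow_lt; lra).
  assert (PL : 0 < (wp_scale y0 ^ 2) ^ S j) by (apply pow_lt, pow_lt; auto).
  assert (Psg : (-1) ^ j * (-1) ^ j = 1) by (rewrite <- Rpow_mult_distr, <- (pow1 j); f_equal; ring).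
  assert (Nz : (-1) ^ j <> 0) by (apply pow_nonzero; lra).
  set (s := (-1) ^ j) in *. set (F := INR (fact (2 * j))) in *.
  set (X := (wp_scale y0 ^ 2) ^ S j) in *. set (c := cot_coef j) in *.
  (* The sign (-1)^j sits in the denominator through the Bernoulli number on one side only; [field]
     does not know that its square is 1. *)
  assert (Es' : s = / s) by (apply Rmult_eq_reg_l with s; [rewrite Psg; field|]; auto).
  transitivity (1 - 8 * 4 ^ j * / s * sg / ((2 * INR j + 1) * F * c)); [field; repeat split; lra|].
  transitivity (1 - 8 * 4 ^ j * s * sg / ((2 * INR j + 1) * F * c)); [rewrite <- Es'; reflexivity|].
  field. repeat split; lra.
Qed.

Theorem theorem3p1 (k : R) (hk : 0 < k < 1) (m : nat) (hm : (2 <= m)%nat) :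
  let K := ellipticK k in
  let K' := ellipticK (sqrt (1 - k ^ 2)) in
  let z := 2 * K / PI in
  let q := exp (- PI * K' / K) in
  eisenstein m (q ^ 2) =
    (-1) ^ (m - 1) * INR m * z ^ (2 * m)
      / (2 ^ (2 * m - 1) * bernoulli (2 * m))
      * peval (ns2_poly m) (k ^ 2)
  /\
  eisenstein m q =
    (-1) ^ (m - 1) * INR m * z ^ (2 * m) * (1 + k) ^ (2 * m)
      / (2 ^ (2 * m - 1) * bernoulli (2 * m))
      * peval (ns2_poly m) (4 * k / (1 + k) ^ 2).
Proof.
  intros K K' z q. split; [exact (eisenstein_nome_sqr k m hk hm)|].
  assert (HP := PI_RGT_0). assert (PK := ellipticK_pos k hk).
  (* [l] is the modulus complementary to [k1], the modulus with k1^2 = 4 k / (1 + k)^2 to which the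
     first formula will be applied. *)
  set (l := (1 - k) / (1 + k)).
  assert (Hl : 0 < l < 1).
  { unfold l. split; [apply Rdiv_lt_0_compat; lra|].
    apply Rmult_lt_reg_r with (1 + k); [lra|]. unfold Rdiv. rewrite Rmult_assoc, Rinv_l; lra. }
  set (k1 := 2 * sqrt k / (1 + k)).
  assert (Sk : 0 < sqrt k) by (apply sqrt_lt_R0; lra).
  assert (Sq : sqrt k * sqrt k = k) by (apply sqrt_sqrt; lra).
  assert (Ek1 : k1 ^ 2 = 4 * k / (1 + k) ^ 2).
  { unfold k1. rewrite <- Sq at 3. field. lra. }
  assert (Ek1' : 1 - k1 ^ 2 = l ^ 2) by (rewrite Ek1; unfold l; field; lra).
  assert (Hk1 : 0 < k1 < 1).
  { assert (0 < k1) by (unfold k1; apply Rdiv_lt_0_compat; lra). nra. }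
  assert (Ec : compl_modulus k1 = l).
  { unfold compl_modulus. rewrite Ek1'. apply sqrt_pow2; lra. }
  assert (L1 := landen k hk). fold k1 K in L1.
  (* Landen's transformation takes [l] to the complementary modulus of k, so K' = (1 + l) K(l). With
     K(k1) = (1 + k) K this gives K(l) / K(k1) = K' / (2 K), and squaring the nome of [k1] yields
     q. *)
  assert (L2 := landen l Hl).
  replace (2 * sqrt l / (1 + l)) with (sqrt (1 - k ^ 2)) in L2.
  2:{ replace (1 - k ^ 2) with ((1 + k) ^ 2 * l) by (unfold l; field; lra).
      rewrite sqrt_mult, sqrt_pow2 by (try apply pow2_ge_0; lra). unfold l. field. lra. }
  fold K' in L2.
  assert (E := eisenstein_nome_sqr k1 m Hk1 hm).
  rewrite Ec, L1, Ek1 in E.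
  replace (exp (- PI * ellipticK l / ((1 + k) * K)) ^ 2) with q in E.
  2:{ unfold q. simpl. rewrite Rmult_1_r, <- exp_plus. f_equal. rewrite L2. unfold l.
      fold K in PK. field. lra. }
  rewrite E. replace (2 * ((1 + k) * K) / PI) with (z * (1 + k)) by (unfold z; field; lra).
  rewrite Rpow_mult_distr. unfold Rdiv. ring.
Qed.
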